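(* Suppose that $f:\mathbb{R}\rightarrow\mathbb{R}$ is twice differentiable with $f'(0)\not=0$, $|f'(w)|\leq A+B|w|^r$ and $|f''(w)|\leq C+D|w|^s$ for all $w\in\mathbb{R}$, where $A$, $B$, $C$, $D$, $r$ and $s$ are non-negative constants. Let $X_{1},\ldots,X_{n}$ be independent random variables with zero mean, unit variance and $\mathbb{E}|X_i|^{r+4}<\infty$ for all $1\leq i\leq n$. Let $\overline{X}=\frac1n\sum_{i=1}^nX_i$, $W=\sqrt n\,\overline X$, and $T_1=\sqrt{n}\big(f(\overline{X})-f(0)\big)/f'(0)$, and let $Z\sim N(0,1)$. Then, for absolutely continuous $h:\mathbb{R}\rightarrow\mathbb{R}$, \begin{align*}|\mathbb{E}h(T_1)-\mathbb{E}h(Z)| &\leq\frac{\|h'\|}{|f'(0)|\sqrt{n}}\bigg\{\frac{1}{n}\sum_{i=1}^{n}\bigg[3A\mathbb{E}|X_{i}|^{3}+\frac{2^rB}{n^{r/2}}\bigg(2^{r+1}\mathbb{E}X_i^{4}\big(\mathbb{E}|W|^{r+1}+\mathbb{E}|W|^{r}\big)\\ &\quad+4\mathbb{E}|Z|^{r+1}\mathbb{E}X_i^{4}+\frac{2^{r+2}}{n^{r/2}}\mathbb{E}|X_i|^{r+4}\bigg)\bigg]+\bigg(C+\frac{D}{n^{s/2}}\mathbb{E}|Z|^{s+2}\bigg)\bigg\}. \end{align*}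
   Context: $\|h'\|$ denotes the (essential) supremum of $|h'|$ over $\mathbb R$; the bound is of interest only when $\|h'\|<\infty$ and is vacuous otherwise. *)

(* Defs.v *)
From HB Require Import structures.
From mathcomp Require Export all_boot all_order all_algebra.
From mathcomp Require Export all_classical all_reals all_analysis.
From mathcomp Require Export ess_sup_inf.
Export Order.TTheory GRing.Theory Num.Theory.
Export numFieldNormedType.Exports.

#[export] Set Implicit Arguments.
#[export] Unset Strict Implicit.
#[export] Unset Printing Implicit Defensive.

Local Open Scope classical_set_scope.
Local Open Scope ring_scope.

(* Mutual independence: the product rule over every subfamily [J]. *)
Definition mutually_independent (d : measure_display) (T : measurableType d)
    (R : realType) (P : probability T R) (I : finType) (X : I -> T -> R) : Prop :=
  forall (J : {set I}) (B : I -> set R),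
    (forall i, measurable (B i)) ->
    P (\bigcap_(i in [set` J]) (X i @^-1` B i)) =
    (\prod_(i in J) P (X i @^-1` B i))%E.

(* The laws are compared on Borel sets only: [normal_prob 0 1] is defined by an
   integral, whose value on a non-measurable set carries no meaning. The second
   parameter of [normal_prob] is the standard deviation. *)
Definition standard_normal (d : measure_display) (T : measurableType d)
    (R : realType) (P : probability T R) (Z : {RV P >-> R}) : Prop :=
  forall B : set R, measurable B -> distribution P Z B = normal_prob 0 1 B.

Definition abs_continuous_on (R : realType) (a b : R) (h : R -> R) : Prop :=
  forall e : R, 0 < e -> exists2 delta : R, 0 < delta &
    forall (m : nat) (u v : 'I_m -> R),
      (forall k, [/\ a <= u k, u k <= v k & v k <= b]) ->
      trivIset setT (fun k => `]u k, v k[%classic) ->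
      \sum_(k < m) (v k - u k) < delta ->
      \sum_(k < m) `|h (v k) - h (u k)| < e.

(* For a function on the whole line, absolute continuity is required on every
   compact interval; this covers functions such as [x |-> x ^+ 2]. *)
Definition abs_continuous (R : realType) (h : R -> R) : Prop :=
  forall a b : R, a <= b -> abs_continuous_on a b h.

(* [h^`()] has an unspecified value where [h] is not derivable. An absolutely
   continuous [h] is derivable almost everywhere, so that these values do not
   affect the essential supremum, which may be [+oo]. *)
Definition deriv_norm (R : realType) (h : R -> R) : \bar R :=
  ess_sup lebesgue_measure (fun x : R => (`|h^`()%classic x|)%:E).

Definition sample_mean (T : Type) (R : realType) (n : nat)
    (X : 'I_n -> T -> R) (w : T) : R :=
  n%:R^-1 * \sum_(i < n) X i w.

Definition scaled_mean (T : Type) (R : realType) (n : nat)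
    (X : 'I_n -> T -> R) (w : T) : R :=
  Num.sqrt n%:R * sample_mean X w.

Definition delta_statistic (T : Type) (R : realType) (n : nat) (f : R -> R)
    (X : 'I_n -> T -> R) (w : T) : R :=
  Num.sqrt n%:R * (f (sample_mean X w) - f 0) / f^`()%classic 0.

(* Main.v *)
(** Write [g w = sqrt n (f (w / sqrt n) - f 0) / f' 0], so that [T1 = g W], and [H = h o g].
    Absolute continuity and [L = ||h'||] make [h] [L]-Lipschitz: the total variation of [h]
    defines a Stieltjes measure dominated by Lebesgue measure, whose density gives back [h']
    almost everywhere.  Then [|E h (T1) - E h Z| <= |E H W - E H Z| + |E h (g Z) - E h Z|].

    The second term is at most [L E|g Z - Z|], and [g z - z] is of order [z^2] by the bound
    on [f''].

    For the first term, let [psi] solve the Stein equation [psi' w - w psi w = H w - E H Z].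
    The key point is a modulus of continuity for [psi'].  If [V] is nondecreasing with mean
    zero and [u] is the solution of [u' = w u - V] given by Gaussian tail integrals, then
    [w u] is nondecreasing, by the Mills ratio inequality.  Applied to
    [V = G + (H - E H Z)] and [V = G - (H - E H Z)], with [G] an odd primitive of the bound
    on [H'], it shows that the increments of [psi'] are dominated by those of [G] and of
    [w u_G].  Expanding [E (psi' W - W psi W)] around the sums that omit
    one summand, with third moments, gives the bound for [r >= 1].  When [r < 1],
    [|w|^r <= (1 - r) + r |w|] reduces the problem to the exponent [1]. *)
From HB Require Import structures.
From mathcomp Require Import finmap.
Require Import Defs.
From mathcomp Require Import measurable_realfun ring lra.

Local Open Scope classical_set_scope.
Local Open Scope ring_scope.

(** * Absolutely continuous functions with bounded derivative *)

Section families.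
Context {R : realType}.
Implicit Types (a b u v : R) (h : R -> R) (s t : seq (R * R)) (p q : R * R).

(** [H'] exists only almost everywhere and has no regularity beyond its growth, so [psi] has no
    usable second derivative. The expansion of [E psi] therefore runs on a Lipschitz bound for
    [p = psi'] on each [[- m, m]], of the form a + b m^r, and this bound has to come from increments
    of [H] alone. Monotonicity of [w u] transfers the question to the explicit odd function
    [growth], for which Gaussian tails can be computed. The condition r >= 1 is the convexity of
    |w|^r: it separates the omitted summand from the rest in the Lipschitz constant, and it yields
    the Jensen step that replaces the moment of a partial sum by that of [W].

    The discrepancy obtained in this way has other constants than the statement. The comparison
    rests on E|X|^3 <= E X^4 <= E|X|^(r+4), which follow from the unit variance, and on a numerical
    bound for the Mills ratio at 0, that is, for pi.

    In the extended reals 0 times [+oo] is 0, so an infinite norm of [h'] makes the bound vacuous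
    only once the bracket is known to be positive; this is proved from f'(0) <> 0. *)

Definition subitv a b p := [&& a <= p.1, p.1 <= p.2 & p.2 <= b].
Definition before_or_after p q := (p.2 <= q.1) || (q.2 <= p.1).
(** Families of non-overlapping intervals are lists of endpoint pairs, which can be concatenated,
    refined and mapped; degenerate intervals are allowed. *)
Definition itvfam a b s := all (subitv a b) s && pairwise before_or_after s.
Definition total_length s := \sum_(p <- s) (p.2 - p.1).
Definition total_increment h s := \sum_(p <- s) `|h p.2 - h p.1|.

Lemma abs_continuous_on_fam a b h : abs_continuous_on a b h ->
  forall e, 0 < e -> exists2 delta, 0 < delta & forall s, itvfam a b s ->
    total_length s < delta -> total_increment h s < e.
Proof.
move=> ach e e0; have [delta d0 H] := ach e e0; exists delta => // s /andP[sab ds].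
rewrite /total_length /total_increment !(big_nth (0,0)) !big_mkord => ls.
apply: (H (size s) (fun k => (nth (0, 0) s k).1) (fun k => (nth (0, 0) s k).2)) => //.
  by move=> k; have /and3P[] := all_nthP (0,0) sab k (ltn_ord k).
have dis (i j : 'I_(size s)) : (i < j)%N ->
    before_or_after (nth (0,0) s i) (nth (0,0) s j).
  by move=> ij; apply: (pairwiseP (0,0) ds) => //; rewrite inE.
move=> i j _ _ [x [/=]]; rewrite !in_itv/= => /andP[ix xi] /andP[jx xj].
apply/eqP; rewrite -val_eqE/=; apply/negPn; rewrite neq_ltn.
apply/negP => /orP[/dis|/dis] /orP[] /=.
- by rewrite leNgt (lt_trans jx xi).
- by rewrite leNgt (lt_trans ix xj).
- by rewrite leNgt (lt_trans ix xj).
- by rewrite leNgt (lt_trans jx xi).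
Qed.

Lemma itv_partition_fam u v l h : itv_partition u v l -> exists t,
  [/\ itvfam u v t, total_length t = v - u &
      total_increment h t = variation u v h l].
Proof.
elim: l u => [|x l IH] u.
  move=> /itv_partition_nil ->; exists [::]; split => //.
    by rewrite /total_length big_nil subrr.
  by rewrite variation_nil /total_increment big_nil.
move=> puv.
have /= ux : u < x by case: puv => /= /andP[].
have pxv : itv_partition x v l by case: puv => /= /andP[_ ? ?]; split.
have xv : x <= v := itv_partition_le pxv.
have [t [/andP[txv dt] lt vt]] := IH _ pxv.
exists ((u, x) :: t); split.
- rewrite /itvfam/= /subitv/= lexx (ltW ux) xv/= dt andbT; apply/andP; split.
    by apply: sub_all txv => p /and3P[xp -> ->]; rewrite (le_trans (ltW ux) xp).
  by apply: sub_all txv => p /and3P[xp _ _]; rewrite /before_or_after/= xp.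
- by rewrite /total_length big_cons/= -/(total_length t) lt; ring.
- rewrite /total_increment big_cons/= -/(total_increment h t) vt.
  rewrite -cat1s (variation_cat (c := x)) ?(ltW ux)//; last exact: itv_partition1.
  by congr (_ + _); rewrite /variation/= big_nat1.
Qed.

(** Replacing each interval by a partition that nearly attains its variation leaves the total length
    unchanged, so the [delta] that serves for [h] also serves for its total variation. The strict
    bound becomes [<=] in the limit. *)
Lemma TV_fam a b h s e delta : 0 < e ->
  (forall u v, a <= u -> u <= v -> v <= b -> total_variation u v h \is a fin_num) ->
  (forall s, itvfam a b s -> total_length s < delta -> total_increment h s < e) ->
  itvfam a b s -> total_length s < delta ->
  \sum_(p <- s) fine (total_variation p.1 p.2 h) <= e.
Proof.
move=> e0 TVfin H sfam sdelta.
suff K : forall eta, 0 < eta -> exists t,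
   [/\ itvfam a b t, total_length t = total_length s,
    (forall q, q \in t -> exists2 p, p \in s & subitv p.1 p.2 q) &
    \sum_(p <- s) fine (total_variation p.1 p.2 h) <= total_increment h t + eta * (size s)%:R].
  apply/ler_addgt0Pr => eta eta0.
  (* The error is incurred once per interval; [(size s).+1] also covers the empty family. *)
  have [|t [tf tl _]] := K (eta / (size s).+1%:R); first by rewrite divr_gt0.
  move=> /le_trans; apply; apply: lerD; first by apply/ltW/H; rewrite // tl.
  by rewrite -mulrA ger_pMr// ler_pdivrMl// mulr1 ler_nat.
move=> eta eta0; elim: s sfam {sdelta} => [_|p s IH].
  exists [::]; split => //; rewrite /total_increment !big_nil.
  by rewrite mulr0 addr0.
rewrite /itvfam/= => /andP[/andP[pab sab] /andP[ps ds]].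
have [|t [/andP[tab dt] tl ts tinc]] := IH; first by rewrite /itvfam sab.
have /and3P[ap p12 pb] := pab.
have pfin := TVfin _ _ ap p12 pb.
have [l pl lp] : exists2 l, itv_partition p.1 p.2 l &
    fine (total_variation p.1 p.2 h) <= variation p.1 p.2 h l + eta.
  have := @ub_ereal_sup_adherent _ [set x%:E | x in variations p.1 p.2 h] eta eta0 pfin.
  move=> [_ [_ [l pl <-] <-]] ltl; exists l => //.
  by rewrite -lee_fin EFinD fineK// -leeBlDr// ltW.
have [t1 [/andP[t1p dt1] l1 v1]] := itv_partition_fam h pl.
exists (t1 ++ t); split.
- rewrite /itvfam all_cat tab andbT pairwise_cat dt1 dt !andbT; apply/andP; split.
    apply: sub_all t1p => q /and3P[? qq ?].
    by rewrite /subitv qq (le_trans ap)//= (le_trans _ pb).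
  apply/allrelP => q q' q1 /ts[p' p's /and3P[? ? ?]].
  have /and3P[? ? ?] := allP t1p _ q1.
  by have /orP[] := allP ps _ p's => h1; apply/orP; [left|right]; lra.
- by rewrite /total_length big_cat big_cons/= -!/(total_length _) l1 tl.
- move=> q; rewrite mem_cat => /orP[q1|/ts[p' p's ?]].
    by exists p; rewrite ?mem_head//; exact: (allP t1p).
  by exists p'; rewrite // inE p's orbT.
- rewrite big_cons /total_increment big_cat/= -!/(total_increment _ _) v1 -natr1.
  by rewrite mulrDr mulr1; lra.
Qed.

End families.

Section variation_ac.
Context {R : realType}.
Implicit Types (a b u v : R) (h : R -> R) (s t : seq (R * R)) (p q : R * R).

(** On an interval shorter than [delta] every partition has increment below 1, so the variation is
    finite there; [[a, b]] is a finite chain of such intervals. *)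
Lemma abs_continuous_on_BV a b h : a <= b -> abs_continuous_on a b h ->
  bounded_variation a b h.
Proof.
move=> ab ach.
have [delta d0 H] := abs_continuous_on_fam ach (@ltr01 R).
have small u v : a <= u -> u <= v -> v <= b -> v - u < delta ->
    total_variation u v h \is a fin_num.
  move=> au uv vb uvd; apply/bounded_variationP => //; exists 1 => _ [l pl <-].
  have [t [/andP[ts td] tl <-]] := itv_partition_fam h pl.
  apply/ltW/H; last by rewrite tl.
  apply/andP; split => //; apply: sub_all ts => p /and3P[? ? ?].
  by apply/and3P; split; lra.
(* [n] counts pieces of length [delta / 2], half of the critical length because [delta] itself is
   excluded. *)
have main n u v : a <= u -> u <= v -> v <= b -> v - u < n%:R * (delta / 2) ->
    total_variation u v h \is a fin_num.
  elim: n u v => [|n IH] u v au uv vb uvn; first by rewrite mul0r in uvn; lra.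
  have [uvd|duv] := ltP (v - u) delta; first exact: small.
  move: uvn; rewrite -natr1 mulrDl mul1r => uvn.
  rewrite (total_variationD (c := u + delta / 2)); [|lra..].
  rewrite fin_numD; apply/andP; split; first by apply: small; lra.
  by apply: IH; lra.
apply/bounded_variationP => //.
apply: (main (Num.bound ((b - a) / (delta / 2)))) => //.
by rewrite -ltr_pdivrMr ?divr_gt0//; apply/archi_boundP/divr_ge0 => //; lra.
Qed.

(** One [delta] serves for the whole line, where the Stieltjes measure is compared with Lebesgue
    measure. Functions on [[a, b]] qualify after composition with [clamp], which extends them by
    constants and does not lengthen intervals. *)
Definition ac_everywhere (F : R -> R) := forall e, 0 < e ->
  exists2 delta, 0 < delta & forall a b s, itvfam a b s -> total_length s < delta ->
    total_increment F s <= e.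

Definition clamp a b x : R := Num.max a (Num.min b x).

Lemma clamp_in a b x : a <= b -> a <= clamp a b x <= b.
Proof.
by move=> ab; rewrite /clamp le_max lexx/= ge_max ab/= ge_min lexx.
Qed.

Lemma clamp_id a b x : a <= x -> x <= b -> clamp a b x = x.
Proof. by move=> ax xb; rewrite /clamp (min_idPr xb) (max_idPr ax). Qed.

Lemma clamp_le a b x y : x <= y -> clamp a b x <= clamp a b y.
Proof.
move=> xy; rewrite /clamp; case: (leP b x); case: (leP b y); case: (leP a b);
  case: (leP a x); case: (leP a y); lra.
Qed.

Lemma clamp_length a b x y : x <= y -> clamp a b y - clamp a b x <= y - x.
Proof.
by rewrite /clamp; case: (leP b x); case: (leP b y); case: (leP a b);
  case: (leP a x); case: (leP a y); lra.
Qed.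

Lemma clamp_fam a b u v s : a <= b -> itvfam u v s ->
  let c p := (clamp a b p.1, clamp a b p.2) in
  itvfam a b (map c s) /\ total_length (map c s) <= total_length s.
Proof.
move=> ab /andP[us ds] c; split.
  apply/andP; split.
    apply/allP => _ /mapP[p /(allP us)/and3P[_ p12 _] ->].
    have /andP[? ?] := clamp_in p.1 ab; have /andP[? ?] := clamp_in p.2 ab.
    by apply/and3P; split => //; exact: clamp_le.
  rewrite pairwise_map; apply: sub_pairwise ds => p q /orP[] pq; apply/orP.
    by left; exact: clamp_le.
  by right; exact: clamp_le.
rewrite /total_length big_map !big_seq; apply: ler_sum => p /(allP us)/and3P[_ ? _].
exact: clamp_length.
Qed.

Lemma ac_everywhere_clamp a b h : a <= b -> abs_continuous_on a b h ->
  ac_everywhere (h \o clamp a b).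
Proof.
move=> ab /abs_continuous_on_fam ach e e0.
have [delta d0 H] := ach e e0; exists delta => // u v s us ls.
have [cs cl] := clamp_fam ab us.
have := H _ cs (le_lt_trans cl ls).
by rewrite /total_increment big_map => /ltW.
Qed.

Lemma ac_everywhere_TV a b h : a <= b -> abs_continuous_on a b h ->
  ac_everywhere (fun x => fine (total_variation a (clamp a b x) h)).
Proof.
move=> ab ach e e0.
have bv := abs_continuous_on_BV ab ach.
have TVfin u v : a <= u -> u <= v -> v <= b -> total_variation u v h \is a fin_num.
  move=> au uv vb; apply/bounded_variationP => //.
  by apply: (bounded_variationl uv vb); apply: (bounded_variationr au _ bv); exact: le_trans vb.
have [delta d0 H] := abs_continuous_on_fam ach e0; exists delta => // u v s us ls.
have [cs cl] := clamp_fam ab us.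
have := TV_fam e0 TVfin H cs (le_lt_trans cl ls).
rewrite big_map /total_increment; apply: le_trans.
move: us => /andP[us _]; rewrite !big_seq; apply: ler_sum => p /(allP us)/and3P[_ p12 _] /=.
have /andP[? ?] := clamp_in p.1 ab; have /andP[? ?] := clamp_in p.2 ab.
have cp := clamp_le a b p12.
rewrite (total_variationD (c := clamp a b p.1) (b := clamp a b p.2))//.
rewrite fineD ?TVfin// addrAC subrr add0r ger0_norm//.
by apply: fine_ge0; exact: total_variation_ge0.
Qed.

Lemma ac_everywhereB (F G : R -> R) : ac_everywhere F -> ac_everywhere G ->
  ac_everywhere (F \- G).
Proof.
move=> acF acG e e0; have e20 : 0 < e / 2 by rewrite divr_gt0.
have [d1 d10 H1] := acF _ e20; have [d2 d20 H2] := acG _ e20.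
exists (Num.min d1 d2); first by rewrite lt_min d10.
move=> a b s sab; rewrite lt_min => /andP[/(H1 _ _ _ sab) h1 /(H2 _ _ _ sab) h2].
rewrite (splitr e); apply: le_trans (lerD h1 h2).
rewrite /total_increment -big_split; apply: ler_sum => p _ /=.
have -> : F p.2 - G p.2 - (F p.1 - G p.1) = (F p.2 - F p.1) - (G p.2 - G p.1) by ring.
exact: ler_normB.
Qed.

Lemma ac_everywhere_continuous (F : R -> R) : ac_everywhere F -> continuous F.
Proof.
move=> acF x; apply/cvgrPdist_le => e e0.
have [delta d0 H] := acF e e0.
have K u v : u <= v -> v - u < delta -> `|F v - F u| <= e.
  move=> uv uvd; have := H u v [:: (u, v)].
  rewrite /itvfam/= /subitv/= !lexx uv => /(_ isT).
  by rewrite /total_length /total_increment !big_seq1/=; exact.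
near=> y.
have /ltr_normlP[? ?] : `|x - y| < delta by near: y; exact: cvgr_dist_lt.
have [xy|/ltW yx] := leP x y; first by rewrite distrC; apply: K => //; lra.
by apply: K => //; lra.
Unshelve. all: by end_near. Qed.

End variation_ac.

(** * Domination of the Stieltjes measure by Lebesgue measure *)

Section stieltjes_ac.
Context {R : realType}.
Notation mu := (@lebesgue_measure R).

Lemma fam_bounds (s : seq (R * R)) :
  (forall p, p \in s -> p.1 <= p.2) -> exists a b, all (subitv a b) s.
Proof.
elim: s => [_|p s IH H]; first by exists 0, 0.
have [|a [b sab]] := IH; first by move=> q qs; apply: H; rewrite inE qs orbT.
exists (Num.min a p.1), (Num.max b p.2) => /=; apply/andP; split.
  by rewrite /subitv ge_min lexx orbT le_max lexx orbT (H p) ?mem_head.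
apply: sub_all sab => q /and3P[? ? ?]; apply/and3P; split => //.
  by rewrite ge_min; apply/orP; left.
by rewrite le_max; apply/orP; left.
Qed.

Lemma stieltjes_ocitv (F : cumulative R R) (u v : R) : u <= v ->
  lebesgue_stieltjes_measure F `]u, v] = (F v - F u)%:E.
Proof.
move=> uv; rewrite /lebesgue_stieltjes_measure /measure_extension measurable_mu_extE/=.
  by rewrite wlength_itv_bnd.
exact: is_ocitv.
Qed.

Lemma ocitv_endpoints (X : set R) : ocitv X -> X !=set0 ->
  exists p : R * R, p.1 < p.2 /\ X = `]p.1, p.2]%classic.
Proof.
by move=> /ocitvP[->[]//|[p ? ->] _]; exists p.
Qed.

Lemma ocitv_disjoint (p q : R * R) : p.1 < p.2 -> q.1 < q.2 ->
  (`]p.1, p.2] `&` `]q.1, q.2] = set0)%classic -> before_or_after p q.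
Proof.
move=> pp qq; apply: contraPT; rewrite /before_or_after negb_or -!ltNge => /andP[h1 h2].
apply/eqP/set0P; exists (Num.min p.2 q.2); split => /=; rewrite in_itv/= lt_min ge_min lexx ?orbT andbT.
  by rewrite pp.
by rewrite qq andbT.
Qed.

(** The sets [A k] may overlap, while absolute continuity speaks of disjoint intervals. In the ring
    generated by half-open intervals the union is a finite disjoint union of nonempty ones, whose
    total length and total increment are the two measures. *)
Lemma stieltjes_finite_union (F : cumulative R R) (e delta : R) (A : nat -> set R) n :
  (forall a b s, itvfam a b s -> total_length s < delta -> total_increment F s <= e) ->
  (forall k, ocitv (A k)) ->
  (mu (\big[setU/set0]_(k < n) A k) < delta%:E)%E ->
  (lebesgue_stieltjes_measure F (\big[setU/set0]_(k < n) A k) <= e%:E)%E.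
Proof.
move=> H Ao.
have [B [fB neB tB oB UB]] : exists B : set (set R),
    [/\ finite_set B, (forall X, B X -> X !=set0), trivIset B id,
      (forall X : set R, X \in B -> ocitv X) &
      \big[setU/set0]_(k < n) A k = \bigcup_(X in B) X].
  apply: (@SetRing.ring_finite_set _ (ocitv_type R)).
  by apply: bigsetU_measurable => k _; apply: SetRing.measurable_subring; exact: Ao.
have /choice[ep epP] : forall X, exists p : R * R, B X ->
    p.1 < p.2 /\ X = `]p.1, p.2]%classic.
  move=> X; have [BX|nBX] := pselect (B X); last by exists (0, 0).
  have [p pX] := ocitv_endpoints (oB _ (mem_set BX)) (neB _ BX).
  by exists p.
have mB X : B X -> measurable X by move=> BX; have [_ ->] := epP _ BX.
have BS X : X \in fset_set B -> B X by rewrite in_fset_set// => /set_mem.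
have EB (m : {measure set (measurableTypeR R) -> \bar R}) :
    m (\big[setU/set0]_(k < n) A k) = (\sum_(X <- fset_set B) m X)%E.
  rewrite UB measure_fin_bigcup//= fsbig_finite//.
pose s := map ep (fset_set B).
have sle p : p \in s -> p.1 <= p.2.
  by move=> /mapP[X /BS/epP[? _] ->]; exact: ltW.
have [a [b sab]] := fam_bounds sle.
have sfam : itvfam a b s.
  rewrite /itvfam sab pairwise_map.
  have := fset_uniq (fset_set B); rewrite uniq_pairwise.
  apply: (@sub_in_pairwise _ (mem (fset_set B))); last exact/allP.
  move=> X Y /BS BX /BS BY /= XY.
  have [lx eX] := epP _ BX; have [ly eY] := epP _ BY.
  apply: ocitv_disjoint => //; rewrite -eX -eY.
  apply/eqP/negPn/negP => /set0P /(tB _ _ BX BY)/eqP.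
  exact/negP.
have -> : mu (\big[setU/set0]_(k < n) A k) = (total_length s)%:E.
  rewrite EB /total_length big_map -sumEFin !big_seq; apply: eq_bigr => X /BS/epP[l eX].
  (* Lebesgue measure is by definition the Stieltjes measure of the identity. *)
  rewrite -[LHS]/(lebesgue_stieltjes_measure idfun X) [in LHS]eX.
  by rewrite stieltjes_ocitv// ltW.
have -> : lebesgue_stieltjes_measure F (\big[setU/set0]_(k < n) A k) = (total_increment F s)%:E.
  rewrite EB /total_increment big_map -sumEFin !big_seq; apply: eq_bigr => X /BS/epP[l eX].
  rewrite -[LHS]/(lebesgue_stieltjes_measure F X) [in LHS]eX stieltjes_ocitv ?ltW// ger0_norm// subr_ge0.
  exact/(cumulative_is_nondecreasing F)/ltW.
by rewrite lte_fin lee_fin; exact: (H a b).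
Qed.

(** A null set has a countable cover by half-open intervals of total length below [delta]. Each
    finite part of the cover has Stieltjes measure at most [e], and continuity from below extends
    this to the whole cover. *)
Lemma stieltjes_dominates (F : cumulative R R) : ac_everywhere F ->
  lebesgue_stieltjes_measure F `<< mu.
Proof.
move=> acF; apply/null_content_dominatesP => N mN N0.
apply/eqP; rewrite eq_le measure_ge0 andbT; apply/lee_addgt0Pr => e e0; rewrite add0e.
have [delta d0 H] := acF _ e0.
have : (mu N < delta%:E)%E by rewrite N0 lte_fin.
rewrite {1}/lebesgue_measure /lebesgue_stieltjes_measure /measure_extension /mu_ext.
move=> /ereal_inf_lt[_ [A [Ao NA] <-] Adelta].
have mA k : measurable (A k : set (measurableTypeR R)).
  by apply: sub_sigma_algebra; exact: Ao.
have mU n : measurable (\big[setU/set0]_(k < n) A k : set (measurableTypeR R)).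
  exact: bigsetU_measurable.
have U_small n : (lebesgue_stieltjes_measure F (\big[setU/set0]_(k < n) A k) <= e%:E)%E.
  apply: (stieltjes_finite_union H Ao).
  apply: le_lt_trans Adelta; rewrite {1}/lebesgue_measure /lebesgue_stieltjes_measure.
  rewrite /measure_extension /mu_ext; apply: ereal_inf_lbound; exists A => //.
  by split => //; exact: (@bigsetU_bigcup _ A n).
apply: (@le_trans _ _ (lebesgue_stieltjes_measure F (\bigcup_k A k))).
  by apply: le_measure => //; apply/mem_set => //; exact: (bigcupT_measurable _ mA).
rewrite -bigcup_bigsetU_bigcup.
have ndU : nondecreasing_seq (fun n => \big[setU/set0]_(k < n.+1) A k).
  by move=> m n mn; apply/subsetPset/subset_bigsetU.
have := @nondecreasing_cvg_mu _ _ _ (lebesgue_stieltjes_measure F) _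
  (fun n => mU n.+1) (bigcupT_measurable _ (fun n => mU n.+1)) ndU.
move=> cU; rewrite -(cvg_lim (@ereal_hausdorff R) cU).
apply: lime_le; first exact: (cvgP _ cU).
by apply: nearW => n; exact: U_small.
Qed.
End stieltjes_ac.

(** * Densities and the Lipschitz bound *)

Section density.
Context {R : realType}.
Notation mu := (@lebesgue_measure R).

Lemma nondecreasing_ac_density (F : R -> R) (a b : R) :
  {homo F : x y / x <= y} -> ac_everywhere F -> a <= b ->
  exists rho : R -> R, mu.-integrable setT (EFin \o rho) /\
    forall x, a <= x -> x <= b -> F x - F a = \int[mu]_(t in `]a, x]) rho t.
Proof.
move=> ndF acF ab.
pose Fc : cumulative R R := HB.pack F
  (isCumulative.Build R _ R F ndF (right_continuousW (ac_everywhere_continuous acF))).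
pose S := lebesgue_stieltjes_measure Fc.
have mab : measurable (`]a, b]%classic : set (measurableTypeR R)) by [].
have Sfin : (S `]a, b]%classic < +oo)%E by rewrite /S stieltjes_ocitv// ltry.
(* The restriction to []a, b]] is a finite measure, so its density is integrable over the whole
   line. *)
pose nu := mfrestr mab Sfin.
have numu : nu `<< mu.
  apply/null_content_dominatesP => N mN N0; rewrite /nu /mfrestr /mrestr.
  have /null_content_dominatesP/(_ N mN N0) SN := stieltjes_dominates (acF : ac_everywhere Fc).
  apply/eqP; rewrite eq_le measure_ge0 andbT -SN; apply: le_measure.
  - by apply/mem_set; exact: measurableI.
  - exact/mem_set.
  - exact: subIsetl.
have [rho [_ rhofin irho rhoE]] := @radon_nikodym_sigma_finite _ _ _ mu nu numu.
exists (fine \o rho); split.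
  by apply: eq_integrable irho => // x _ /=; rewrite fineK.
move=> x ax xb; rewrite /Rintegral.
under eq_integral do rewrite /= fineK//.
rewrite -rhoE// [X in fine X](_ : _ = (F x - F a)%:E)//.
rewrite -[LHS]/(S (`]a, x]%classic `&` `]a, b]%classic)) -(stieltjes_ocitv Fc ax : S _ = (F x - F a)%:E); congr (S _).
apply/seteqP; split => [y []//|y] /=; rewrite !in_itv/= => /andP[-> yx].
by rewrite yx (le_trans yx).
Qed.

(** Jordan decomposition: with [V] the variation from [a], both [V] and [V - h] are nondecreasing
    and absolutely continuous, so each has a density. *)
Lemma ac_density (h : R -> R) (a b : R) : a <= b -> abs_continuous_on a b h ->
  exists rho : R -> R, mu.-integrable setT (EFin \o rho) /\
    forall x, a <= x -> x <= b -> h x - h a = \int[mu]_(t in `[a, x]) rho t.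
Proof.
move=> ab ach.
pose V x := fine (total_variation a (clamp a b x) h).
have bv := abs_continuous_on_BV ab ach.
have TVfin u v : a <= u -> u <= v -> v <= b -> total_variation u v h \is a fin_num.
  move=> au uv vb; apply/bounded_variationP => //.
  by apply: (bounded_variationl uv vb); apply: (bounded_variationr au _ bv); exact: le_trans vb.
have VB x y : x <= y -> `|h (clamp a b y) - h (clamp a b x)| <= V y - V x.
  move=> xy; rewrite /V; have cxy := clamp_le a b xy.
  have /andP[? ?] := clamp_in x ab; have /andP[? ?] := clamp_in y ab.
  rewrite (total_variationD (c := clamp a b x) (b := clamp a b y))//.
  rewrite fineD ?TVfin// addrAC subrr add0r -lee_fin fineK ?TVfin//.
  exact: total_variation_ge.
have ndV : {homo V : x y / x <= y}.
  by move=> x y /VB xy; rewrite -subr_ge0; exact: le_trans xy.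
have ndW : {homo V \- (h \o clamp a b) : x y / x <= y}.
  move=> x y /VB /=; rewrite ler_norml => /andP[_ ?].
  by rewrite lerBlDr; lra.
have acV := ac_everywhere_TV ab ach.
have acW := ac_everywhereB acV (ac_everywhere_clamp ab ach).
have [r1 [i1 E1]] := nondecreasing_ac_density ndV acV ab.
have [r2 [i2 E2]] := nondecreasing_ac_density ndW acW ab.
have i12 : mu.-integrable setT (EFin \o (r1 \- r2)).
  rewrite (_ : _ \o _ = (EFin \o r1) \- (EFin \o r2))%E; first exact: integrableB.
  by apply/funext.
exists (r1 \- r2); split => // x ax xb.
rewrite -Rintegral_itv_obnd_cbnd; last exact: integrableS i12.
rewrite RintegralB//; [|exact: integrableS i1|exact: integrableS i2].
by rewrite -E1// -E2//= !clamp_id//; lra.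
Qed.

Lemma deriv_norm_ge0 (h : R -> R) : (0 <= deriv_norm h)%E.
Proof.
apply: ess_sup_ger => [|x]; last by rewrite lee_fin.
have := @lebesgue_measure_itv R `]-oo, +oo[; rewrite set_itvNyy/= => E.
by rewrite [ltRHS](_ : _ = +oo%E).
Qed.

Lemma ae_deriv_lipschitz (h : R -> R) (L : R) : abs_continuous h ->
  (deriv_norm h <= L%:E)%E -> forall x y, `|h y - h x| <= L * `|y - x|.
Proof.
move=> ach /ess_supP hL.
suff main a b : a < b -> `|h b - h a| <= L * (b - a).
  move=> x y; have [xy|yx|->] := ltgtP x y.
  - by rewrite (@gtr0_norm _ (y - x)) ?subr_gt0// main.
  - by rewrite distrC (distrC y) (@gtr0_norm _ (x - y)) ?subr_gt0// main.
  - by rewrite !subrr !normr0 mulr0.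
move=> ab; have [rho [irho rhoE]] := ac_density (ltW ab) (ach _ _ (ltW ab)).
have irhoS (A : set R) : measurable A -> mu.-integrable A (EFin \o rho).
  by move=> mA; exact: integrableS irho.
have lrho : locally_integrable setT rho := open_integrable_locally openT irho.
have aerho : {ae mu, forall x, `]a, b[%classic x -> `|rho x| <= L}.
  (* Lebesgue differentiation: the primitive of [rho] has derivative [rho] almost everywhere, and
     near [x] it differs from [h] by the constant [h a]. *)
  have := FTC1 (a := BLeft a) (fun y => irhoS _ (measurable_itv _)) lrho.
  apply: filterS2 hL => x /=; rewrite lee_fin => hxL FTC; rewrite in_itv/= => /andP[ax xb].
  have [dF <-] := FTC ax; apply: le_trans hxL; rewrite le_eqVlt; apply/orP; left.
  apply/eqP; congr (`| _ |).
  set G := (fun x0 : R => _) in dF *.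
  transitivity ((G \+ cst (h a))^`()%classic x).
    by rewrite !derive1E deriveD// derive_cst addr0.
  rewrite !derive1E; apply: near_eq_derive; near=> y.
  rewrite /G /= -rhoE ?subrK// ltW//.
    by near: y; exact: lt_nbhsr.
  by near: y; exact: lt_nbhsl.
have -> : h b - h a = \int[mu]_(t in `]a, b[) rho t.
  rewrite (rhoE b (ltW ab) (lexx b)) -Rintegral_itv_bndo_bndc; last exact: irhoS.
  by rewrite -Rintegral_itv_obnd_cbnd//; exact: irhoS.
rewrite -lee_fin EFin_normr_Rintegral//; last exact: irhoS.
have mrho := measurable_int _ (irhoS _ (measurable_itv `]a, b[)).
apply: (le_trans (le_abse_integral mu (measurable_itv _) mrho)).
apply: (@le_trans _ _ (\int[mu]_(t in `]a, b[) L%:E)%E).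
  apply: ae_ge0_le_integral => //.
  - exact: (measurable_int _ (integrable_abse (irhoS _ (measurable_itv `]a, b[)))).
  - move=> x _; rewrite lee_fin -lee_fin; apply: le_trans (deriv_norm_ge0 h) _.
    exact/ess_supP.
rewrite integral_cst//= lebesgue_measure_itv/= lte_fin ab.
by rewrite -EFinD -EFinM.
Unshelve. all: by end_near. Qed.
End density.

(** * Gaussian tails and the Stein equation *)

Section gaussian.
Context {R : realType}.
Notation mu := (@lebesgue_measure R).
Implicit Types (k : R -> R) (w x t p r : R).

Definition gam : R -> R := normal_pdf 0 1.

Lemma gamE x : gam x = gam 0 * expR (- (x ^+ 2 / 2)).
Proof.
rewrite /gam normal_pdfE ?oner_neq0// /normal_fun !subr0 expr0n/= oppr0 mul0r expR0 mulr1.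
by congr (_ * expR _); rewrite expr1n mulNr.
Qed.

Lemma gam_gt0 x : 0 < gam x.
Proof.
by rewrite gamE mulr_gt0 ?expR_gt0// /gam normal_pdfE ?oner_neq0// mulr_gt0 ?normal_peak_gt0 ?expR_gt0 ?oner_neq0.
Qed.

Lemma gam_ge0 x : 0 <= gam x. Proof. exact/ltW/gam_gt0. Qed.

Lemma gam_neq0 x : gam x != 0. Proof. by rewrite gt_eqF// gam_gt0. Qed.

Lemma gamN x : gam (- x) = gam x.
Proof. by rewrite gamE (gamE x) sqrrN. Qed.

Lemma gam_continuous : continuous gam.
Proof. exact/continuous_normal_pdf/oner_neq0. Qed.

Lemma gam_measurable : measurable_fun setT gam.
Proof. exact: measurable_normal_pdf. Qed.

Lemma gam_is_derive x : is_derive x 1 gam (- (x * gam x)).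
Proof.
have -> : gam = fun x => gam 0 * expR (- (x ^+ 2 / 2)) by apply/funext => y; exact: gamE.
apply: is_derive_eq.
by rewrite /GRing.scale/=; field.
Qed.

Lemma gam_sub w t : 0 <= w -> w <= t -> gam t <= gam w * gam (t - w) / gam 0.
Proof.
move=> w0 wt; rewrite (gamE t) (gamE w) (gamE (t - w)).
set a := expR (- (w ^+ 2 / 2)); set b := expR (- ((t - w) ^+ 2 / 2)).
have -> : gam 0 * a * (gam 0 * b) / gam 0 = gam 0 * (a * b) by field; exact: gam_neq0.
rewrite ler_pM2l ?gam_gt0// -expRD ler_expR; nra.
Qed.

Lemma integrable_gam : mu.-integrable setT (EFin \o gam).
Proof. exact: integrable_normal_pdf. Qed.

Lemma Rintegral_gam : \int[mu]_x gam x = 1.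
Proof. by rewrite /Rintegral integral_normal_pdf. Qed.

Definition gint k := mu.-integrable setT (EFin \o (fun t => k t * gam t)).

Lemma integrable_dominated d (T : measurableType d) (m : {measure set T -> \bar R})
  (D : set T) (f g : T -> R) : measurable D -> measurable_fun D f ->
  m.-integrable D (EFin \o g) -> (forall y : T, D y -> `|f y| <= g y) ->
  m.-integrable D (EFin \o f).
Proof.
move=> mD mf ig fg; apply: (le_integrable mD _ _ ig); first exact/measurable_EFinP.
by move=> x Dx /=; rewrite lee_fin (le_trans (fg x Dx))// ler_norm.
Qed.

(** The product [expR (t ^+ 2 / 4) * gam t] is a multiple of the normal density of standard
    deviation [Num.sqrt 2]. *)
Lemma gint_dominated k C : measurable_fun setT k ->
  (forall t, `|k t| <= C * expR (t ^+ 2 / 4)) -> gint k.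
Proof.
move=> mk kC; pose s : R := Num.sqrt 2.
have s0 : s != 0 by rewrite sqrtr_eq0 -ltNge.
have C0 : 0 <= C by have := le_trans (normr_ge0 _) (kC 0); rewrite expr0n/= mul0r expR0 mulr1.
apply: (@integrable_dominated _ _ mu _ _ (fun t => C * gam 0 / normal_peak s * normal_pdf 0 s t)) => //.
- by apply: measurable_funM => //; exact: gam_measurable.
- have := @integrable_normal_pdf R 0 s.
  move=> /(integrableZl measurableT (C * gam 0 / normal_peak s)).
  by apply: eq_integrable => // t _ /=; rewrite EFinM.
move=> t _; rewrite normrM (ger0_norm (gam_ge0 t)).
rewrite normal_pdfE// /normal_fun subr0 sqr_sqrtr//.
rewrite mulrA divfK ?gt_eqF ?normal_peak_gt0// (gamE t).
apply: (@le_trans _ _ (C * expR (t ^+ 2 / 4) * (gam 0 * expR (- (t ^+ 2 / 2))))).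
  by rewrite ler_wpM2r// mulr_ge0 ?gam_ge0 ?expR_ge0.
rewrite mulrACA -expRD; rewrite le_eqVlt; apply/orP; left; apply/eqP.
congr (_ * expR _); by field.
Qed.

Lemma powR_expR_bound p : 0 <= p ->
  exists2 C, 0 <= C & forall t, `|t| `^ p <= C * expR (t ^+ 2 / 4).
Proof.
(* For |t| > 1 the exponent [p] is raised to the even integer 2(m + 1), and the term of order m + 1
   of the exponential series at t^2 / 4 gives [K]. *)
move=> p0; pose m := Num.bound p; pose K := 4 ^+ m.+1 * (m.+1)`!%:R : R.
have K0 : 0 <= K by rewrite mulr_ge0 ?exprn_ge0.
exists (1 + K) => [|t]; first by rewrite addr_ge0.
have e1 : 1 <= expR (t ^+ 2 / 4) by rewrite -expR0 ler_expR divr_ge0 ?sqr_ge0.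
have [t1|t1] := leP `|t| 1.
  apply: (@le_trans _ _ 1); last by rewrite (le_trans e1)// ler_peMl ?expR_ge0// lerDl.
  by rewrite -[leRHS](congr1 (fun f => f p) (powR1 R)) ge0_ler_powR// nnegrE.
apply: (@le_trans _ _ (`|t| `^ (m.+1.*2)%:R)).
  apply: ler_powR; first exact: ltW.
  apply: (le_trans (ltW (archi_boundP p0))); rewrite ler_nat.
  by rewrite -addnn; apply: leq_trans (leq_addr _ _); exact: leqnSn.
rewrite powR_mulrn// -mul2n exprM real_normK ?num_real//.
have := @expR_ge1Dxn R (t ^+ 2 / 4) m (divr_ge0 (sqr_ge0 t) (ler0n _ 4)).
set E := expR _ in e1 *; rewrite expr_div_n => H.
have {}H : t ^+ 2 ^+ m.+1 <= K * E.
  have {}H : t ^+ 2 ^+ m.+1 / 4 ^+ m.+1 / (m.+1)`!%:R <= E by apply: le_trans H; rewrite lerDr.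
  by move: H; rewrite ler_pdivrMr ?ltr0n ?fact_gt0// ler_pdivrMr ?exprn_gt0// /K; lra.
by apply: (le_trans H); rewrite ler_wpM2r ?expR_ge0// lerDr.
Qed.

Lemma continuous_abs_powR p : 0 <= p -> continuous (fun t : R => `|t| `^ p).
Proof.
rewrite le_eqVlt => /predU1P[<-|p0] x.
  under eq_fun do rewrite powRr0.
  exact: cst_continuous.
have [->|x0] := eqVneq x 0; last first.
  suff: {for x, continuous ((@powR R ^~ p) \o Num.norm)} by [].
  apply: continuous_comp; first exact: norm_continuous.
  apply/differentiable_continuous/derivable1_diffP/derivable_powR.
  by rewrite in_itv/= normr_gt0 x0.
apply/cvgrPdist_le => e e0; near=> y.
rewrite normr0 powR0 ?gt_eqF// sub0r normrN ger0_norm ?powR_ge0//.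
have -> : e = (e `^ p^-1) `^ p by rewrite -powRrM mulVf ?gt_eqF// powRr1 ?ltW.
apply: ge0_ler_powR; rewrite ?nnegrE ?powR_ge0//; first exact: ltW.
apply: ltW.
have : `|0 - y| < e `^ p^-1 by near: y; apply: cvgr_dist_lt => //; exact: powR_gt0.
by rewrite sub0r normrN.
Unshelve. all: by end_near. Qed.

Lemma gint_abs_powR p : 0 <= p -> gint (fun t => `|t| `^ p).
Proof.
move=> p0; have [C _ H] := powR_expR_bound p0; apply: (@gint_dominated _ C).
  by apply: continuous_measurable_fun; exact: continuous_abs_powR.
by move=> t; rewrite ger0_norm ?powR_ge0.
Qed.

Lemma gintD k1 k2 : gint k1 -> gint k2 -> gint (k1 \+ k2).
Proof.
move=> i1 i2; apply: eq_integrable (integrableD measurableT i1 i2) => // t _ /=.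
by rewrite mulrDl.
Qed.

Lemma gintZ c k : gint k -> gint (fun t => c * k t).
Proof.
move=> i; apply: eq_integrable (integrableZl measurableT c i) => // t _ /=.
by rewrite -EFinM mulrA.
Qed.

Lemma gint_le k1 k2 : continuous k1 -> gint k2 -> (forall t, `|k1 t| <= k2 t) -> gint k1.
Proof.
move=> c1 i2 H; apply: integrable_dominated i2 _ => //.
  by apply: measurable_funM; [exact: continuous_measurable_fun|exact: gam_measurable].
by move=> t _; rewrite normrM (ger0_norm (gam_ge0 t)) ler_wpM2r ?gam_ge0.
Qed.

Lemma gint_cst c : gint (fun=> c).
Proof.
apply: eq_integrable (gintZ c (gint_abs_powR (lexx 0))) => // t _ /=.
by rewrite powRr0 mulr1.
Qed.

End gaussian.

(** * Gaussian tail integrals *)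

Section tails.
Context {R : realType}.
Notation mu := (@lebesgue_measure R).
Notation gam := (@gam R).
Implicit Types (k : R -> R) (w x t p r : R).

Definition gmean k := \int[mu]_t (k t * gam t).
Definition tail k w := \int[mu]_(t in `[w, +oo[) (k t * gam t).

Lemma gintS k (A : set R) : measurable A -> gint k ->
  mu.-integrable A (EFin \o (fun t => k t * gam t)).
Proof. by move=> mA; exact: integrableS. Qed.

Lemma tailE k w : gint k -> tail k w = gmean k - \int[mu]_(t in `]-oo, w]) (k t * gam t).
Proof.
move=> ik; rewrite /gmean /tail -Rintegral_itv_obnd_cbnd; last exact: gintS.
by rewrite -set_itvNyy Rintegral_itvB//; exact: gintS.
Qed.

Lemma tailD k1 k2 w : gint k1 -> gint k2 -> tail (k1 \+ k2) w = tail k1 w + tail k2 w.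
Proof.
move=> i1 i2; rewrite /tail -RintegralD//; [|exact: gintS..].
by apply: eq_Rintegral => t _ /=; rewrite mulrDl.
Qed.

Lemma tailZ c k w : gint k -> tail (fun t => c * k t) w = c * tail k w.
Proof.
move=> i; rewrite /tail -RintegralZl//; last exact: gintS.
by apply: eq_Rintegral => t _ /=; rewrite mulrA.
Qed.

Lemma gmeanD k1 k2 : gint k1 -> gint k2 -> gmean (k1 \+ k2) = gmean k1 + gmean k2.
Proof.
move=> i1 i2; rewrite /gmean -RintegralD//.
by apply: eq_Rintegral => t _ /=; rewrite mulrDl.
Qed.

Lemma gmeanZ c k : gint k -> gmean (fun t => c * k t) = c * gmean k.
Proof.
move=> i; rewrite /gmean -RintegralZl//.
by apply: eq_Rintegral => t _ /=; rewrite mulrA.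
Qed.

Lemma gmean_cst c : gmean (fun=> c) = c.
Proof.
by rewrite /gmean RintegralZl//; [rewrite Rintegral_gam mulr1|exact: integrable_gam].
Qed.

Lemma tail_ge0 k w : (forall t, w <= t -> 0 <= k t) -> 0 <= tail k w.
Proof.
move=> k0; apply: Rintegral_ge0 => t; rewrite /= in_itv/= andbT => wt.
by rewrite mulr_ge0 ?gam_ge0 ?k0.
Qed.

Lemma tail_le k1 k2 w : gint k1 -> gint k2 ->
  (forall t, w <= t -> k1 t <= k2 t) -> tail k1 w <= tail k2 w.
Proof.
move=> i1 i2 k12; apply: le_Rintegral => //; [exact: gintS..|].
move=> t; rewrite /= in_itv/= andbT => wt.
by rewrite ler_wpM2r ?gam_ge0 ?k12.
Qed.

Lemma tail_is_derive k w : continuous k -> gint k -> is_derive w 1 (tail k) (- (k w * gam w)).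
Proof.
move=> ck ik; pose L x := \int[mu]_(t in `]-oo, x]) (k t * gam t).
have -> : tail k = cst (gmean k) - L by apply/funext => x; rewrite tailE.
have [] := @continuous_FTC1 R (fun t => k t * gam t) -oo%O w (w + 1) _ _ (ltNyr _) _.
- by rewrite ltrDl.
- exact: gintS.
- by apply: continuousM; [exact: ck|exact: gam_continuous].
move=> dL L'; apply: DeriveDef; first exact/derivableB.
by rewrite deriveB// derive_cst -derive1E -/L L' sub0r.
Qed.

(** The difference [tail k - F] has derivative zero, so it only has to vanish at one point. At [w0]
    the integrand is nonnegative from there on, as the fundamental theorem on a half-line
    requires. *)
Lemma tail_FTC k (F : R -> R) (w0 w : R) : continuous k -> gint k ->
  (forall x, is_derive x 1 F (- (k x * gam x))) -> F x @[x --> +oo] --> 0 ->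
  (forall t, w0 <= t -> 0 <= k t) -> tail k w = F w.
Proof.
move=> ck ik dF F0 k0.
have cF : continuous F.
  by move=> x; apply/differentiable_continuous/derivable1_diffP; have [] := dF x.
have -> : tail k w = (tail k - F) w + F w by rewrite /= subrK.
have -> : (tail k - F) w = (tail k - F) w0.
  apply: is_derive_0_is_cst => x; have dT := tail_is_derive x ck ik.
  by apply: is_derive_eq; rewrite subrr.
suff -> : (tail k - F) w0 = 0 by rewrite add0r.
rewrite -[LHS]/(tail k w0 - F w0); apply/eqP; rewrite subr_eq0; apply/eqP.
transitivity (- 0 - (- F w0)); last by rewrite oppr0 opprK add0r.
apply: (@Rintegral_ge0_continuous_FTC2y R (fun t => k t * gam t) (- F) w0 (- 0)).
- by move=> x wx; rewrite mulr_ge0 ?gam_ge0 ?k0.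
- apply: continuous_subspaceT => x; apply: continuousM; first exact: ck.
  exact: gam_continuous.
- exact: cvgN.
- by move=> x _; apply: derivableN; have [] := dF x.
- by apply: cvgN; apply: cvg_at_right_filter; exact: cF.
- move=> x _; have [dFx F'] := dF x.
  by rewrite derive1E deriveN// F' opprK.
Qed.

(* When [k] has Gaussian mean zero, [- stein_u k] is the bounded-growth solution of the
   Stein equation [psi' - w psi = k]. *)
Definition stein_u k w := tail k w / gam w.

Lemma stein_u_is_derive k w : continuous k -> gint k ->
  is_derive w 1 (stein_u k) (w * stein_u k w - k w).
Proof.
move=> ck ik; have dT := tail_is_derive w ck ik; have dg := gam_is_derive w.
have g0 := gam_neq0 w.
have dV := is_deriveV g0 dg.
apply: is_derive_eq; rewrite /GRing.scale/= /stein_u.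
by field.
Qed.

Lemma powR_gam_cvg0 p : 0 <= p -> `|x| `^ p * gam x @[x --> +oo] --> 0.
Proof.
move=> p0; have p10 : 0 <= p + 1 by rewrite addr_ge0.
(* The growth bound at exponent [p + 1] leaves a spare factor 1/x, which tends to zero. *)
have [C C0 H] := @powR_expR_bound R _ p10.
apply: (@squeeze_cvgr _ _ _ _ (cst 0) (fun x => C * gam 0 * x^-1)).
- near=> x; have x0 : 0 < x by near: x; exact: nbhs_pinfty_gt.
  rewrite /= mulr_ge0 ?powR_ge0 ?gam_ge0//= ler_pdivlMr// gamE (gtr0_norm x0).
  have Hx : x `^ p * x <= C * expR (x ^+ 2 / 4).
    by rewrite -[X in _ * X](powRr1 (ltW x0)) -powRD; [have := H x; rewrite gtr0_norm|rewrite (gt_eqF x0) implybT].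
  have -> : expR (- (x ^+ 2 / 2)) = (expR (x ^+ 2 / 4))^-1 * expR (- (x ^+ 2 / 4)).
    by rewrite -expRN -expRD; congr expR; field.
  set E := expR (x ^+ 2 / 4) in Hx *.
  have E0 : 0 < E := expR_gt0 _.
  have e1 : expR (- (x ^+ 2 / 4)) <= 1 by rewrite expR_le1 oppr_le0 divr_ge0 ?sqr_ge0.
  have -> : x `^ p * (gam 0 * (E^-1 * expR (- (x ^+ 2 / 4)))) * x =
     (x `^ p * x / E) * gam 0 * expR (- (x ^+ 2 / 4)) by ring.
  apply: (@le_trans _ _ (C * gam 0 * 1)); last by rewrite mulr1.
  apply: ler_pM => //; rewrite ?expR_ge0//.
    by rewrite mulr_ge0 ?gam_ge0// divr_ge0 ?(ltW E0)// mulr_ge0 ?powR_ge0 ?(ltW x0).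
  by rewrite ler_wpM2r ?gam_ge0// ler_pdivrMr.
- exact: cvg_cst.
- rewrite -[X in _ --> X](mulr0 (C * gam 0)); apply: cvgM; first exact: cvg_cst.
  apply/gtr0_cvgV0; last exact: cvg_id.
  near=> x; near: x; exact: nbhs_pinfty_gt.
Unshelve. all: by end_near. Qed.

Lemma gint_id : gint (@id R).
Proof.
apply: (gint_le _ (gint_abs_powR ler01)) => [x|t]; first exact: cvg_id.
by rewrite powRr1.
Qed.

Lemma gint_sqr : gint (fun t => t ^+ 2).
Proof.
apply: (gint_le _ (gint_abs_powR (ler0n R 2))) => [x|t]; first exact: exprn_continuous.
by rewrite powR_mulrn// normrX.
Qed.

Lemma tail_id w : tail id w = gam w.
Proof.
apply: (tail_FTC (w0 := 0) (F := gam)) => //.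
- by move=> x; exact: cvg_id.
- exact: gint_id.
- exact: gam_is_derive.
- have := powR_gam_cvg0 (lexx 0).
  by under eq_fun do rewrite powRr0 mul1r.
Qed.

Lemma tail_sqr w : tail (fun t => t ^+ 2) w = w * gam w + tail (fun=> 1) w.
Proof.
have ic : gint (fun=> -1 : R) := gint_cst _.
have E : tail (fun t => t ^+ 2 + -1) w = w * gam w.
  (* The derivative of x gam x is (1 - x^2) gam x, and t^2 - 1 is nonnegative from [w0 = 1] on. *)
  apply: (tail_FTC (w0 := 1) (F := fun x => x * gam x)).
  - by move=> x; apply: cvgD; [exact: exprn_continuous|exact: cvg_cst].
  - exact: gintD gint_sqr ic.
  - move=> x; have dg := gam_is_derive x; apply: is_derive_eq.
    by rewrite /GRing.scale/=; ring.
  - have := powR_gam_cvg0 (ler01 : 0 <= 1 :> R); apply: cvg_trans.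
    apply: near_eq_cvg; apply: filterS (nbhs_pinfty_gt (num_real (0 : R))) => x x0 /=.
    by rewrite gtr0_norm// powRr1// ltW.
  - by move=> t t1; nra.
have i1 : gint (fun=> 1 : R) := gint_cst _.
have N1 : tail (fun=> -1) w = -1 * tail (fun=> 1) w.
  by rewrite -tailZ//; apply: eq_Rintegral => t _; rewrite mulr1.
by rewrite -E tailD ?gint_sqr// N1 mulN1r subrK.
Qed.

(** The tail of (t - w)^2 is nonnegative, and its expansion is exactly the difference of the two
    sides. The argument covers negative [w] as well. *)
Lemma mills w : w * gam w <= (1 + w ^+ 2) * tail (fun=> 1) w.
Proof.
have i1 : gint (fun=> 1 : R) := gint_cst _.
have : 0 <= tail (fun t => (t - w) ^+ 2) w by apply: tail_ge0 => t _; exact: sqr_ge0.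
have -> : (fun t => (t - w) ^+ 2) =
  ((fun t => t ^+ 2) \+ (fun t => (- (2 * w)) * t)) \+ (fun t => w ^+ 2 * 1).
  by apply/funext => t /=; ring.
have iw := gintZ (- (2 * w)) gint_id; have iw2 := gintZ (w ^+ 2) i1.
rewrite (tailD w (gintD gint_sqr iw) iw2) (tailD w gint_sqr iw).
by rewrite (tailZ _ _ gint_id) (tailZ _ _ i1) tail_sqr tail_id; lra.
Qed.

End tails.

(** * Reflection, and monotonicity of w u *)

Section reflection.
Context {R : realType}.
Notation mu := (@lebesgue_measure R).
Notation gam := (@gam R).
Implicit Types (k V : R -> R) (w x y z t p r : R).

Lemma gint_norm k : gint k -> gint (fun t => `|k t|).
Proof.
move=> ik; apply: eq_integrable (integrable_abse ik) => // t _ /=.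
by rewrite normrM (ger0_norm (gam_ge0 t)).
Qed.

Lemma continuous_norm k : continuous k -> continuous (fun t => `|k t|).
Proof. by move=> ck x; apply: cvg_norm; exact: ck. Qed.

Lemma continuous_reflect k : continuous k -> continuous (fun t => k (- t)).
Proof.
move=> ck x; suff: {for x, continuous (k \o -%R)} by [].
by apply: continuous_comp; [exact: opp_continuous|exact: ck].
Qed.

Lemma gint_reflect k : continuous k -> gint k -> gint (fun t => k (- t)).
Proof.
move=> ck ik; have cg : continuous (fun t => `|k t| * gam t).
  by move=> x; apply: cvgM; [exact: continuous_norm|exact: gam_continuous].
have g0 x : 0 <= `|k x| * gam x by rewrite mulr_ge0 ?gam_ge0.
have mU : [set: R] = (`]-oo, 0] `|` `]0, +oo[)%classic.
  apply/seteqP; split => x //= _; rewrite !in_itv/= andbT.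
  by case: (leP x 0) => h; [left|right].
have half (h : R -> R) : (forall x, 0 <= h x) -> continuous h ->
    (\int[mu]_(x in `]-oo, 0%R]) (h x)%:E = \int[mu]_(x in `[0%R, +oo[) (h (- x))%:E)%E.
  move=> h0 ch; rewrite -{1}oppr0 ge0_integration_by_substitutionNy//.
  exact: continuous_subspaceT.
have mk : measurable_fun setT (fun t => k (- t) * gam t).
  apply: measurable_funM; last exact: gam_measurable.
  by apply: continuous_measurable_fun; exact: continuous_reflect.
have fin (A : set R) : measurable A -> (\int[mu]_(x in A) (`|k x| * gam x)%:E < +oo)%E.
  move=> mA; have /integrableP[_] := gintS mA (gint_norm ik).
  by under eq_integral do rewrite /= ger0_norm//.
apply/integrableP; split; first exact/measurable_EFinP.
under eq_integral do rewrite /= normrM (ger0_norm (gam_ge0 _)) -gamN.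
have crg := continuous_reflect cg.
have mrg (A : set R) : measurable_fun A (fun x => (`|k (- x)| * gam (- x))%:E).
  apply/measurable_EFinP; apply: measurable_funTS.
  exact: (continuous_measurable_fun crg).
rewrite mU ge0_integral_setU//; last 3 first.
  - exact: mrg.
  - by move=> x _; rewrite lee_fin.
  - apply/disj_setPRL => x; rewrite /= !in_itv/= andbT => x0.
    by apply/negP; rewrite -ltNge.
rewrite integral_itv_obnd_cbnd//.
rewrite (half (fun x => `|k (- x)| * gam (- x)))// -(half (fun x => `|k x| * gam x))//.
under eq_integral do rewrite !opprK.
by rewrite lte_add_pinfty ?fin.
Qed.

Lemma ge0_tail_reflect k w : (forall t, 0 <= k t) -> continuous k ->
  tail (fun t => k (- t)) w = \int[mu]_(t in `]-oo, - w]) (k t * gam t).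
Proof.
move=> k0 ck; rewrite /tail /Rintegral; congr fine.
rewrite (@ge0_integration_by_substitutionNy _ (fun t => k t * gam t)).
- by apply: eq_integral => t _ /=; rewrite gamN.
- apply: continuous_subspaceT => x; apply: cvgM; first exact: ck.
  exact: gam_continuous.
- by move=> x _; rewrite mulr_ge0 ?gam_ge0.
Qed.

(** The change of sign is carried out for nonnegative integrands; [k] is the difference of k + |k|
    and |k|. *)
Lemma tail_reflect k w : continuous k -> gint k ->
  tail (fun t => k (- t)) w = \int[mu]_(t in `]-oo, - w]) (k t * gam t).
Proof.
move=> ck ik; pose q t := `|k t|; pose p := k \+ q.
have cq : continuous q by exact: continuous_norm.
have iq : gint q by exact: gint_norm.
have cp : continuous p by move=> x; apply: cvgD; [exact: ck|exact: cq].
have p0 t : 0 <= p t by have := ler_norm (- k t); rewrite normrN /p /q /=; lra.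
have ip : gint p := gintD ik iq.
have := ge0_tail_reflect w p0 cp.
rewrite (_ : (fun t => p (- t)) = (fun t => k (- t)) \+ (fun t => q (- t)))//.
rewrite tailD; [|exact: gint_reflect..].
rewrite (ge0_tail_reflect w (fun t => normr_ge0 (k t)) cq).
under [in RHS]eq_Rintegral do rewrite /p /= mulrDl.
by rewrite RintegralD//; [move/addIr|exact: gintS..].
Qed.

(** This carries statements at a negative argument over to a positive one: the function t -> - k(-
    t) is nondecreasing with mean zero whenever [k] is. *)
Lemma stein_u_reflect k w : continuous k -> gint k -> gmean k = 0 ->
  stein_u k (- w) = stein_u (fun t => - k (- t)) w.
Proof.
move=> ck ik k0; rewrite /stein_u gamN; congr (_ / _).
rewrite tailE// k0 sub0r -tail_reflect// -mulN1r -tailZ; last exact: gint_reflect.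
by apply: eq_Rintegral => t _; rewrite mulN1r.
Qed.

Lemma even_gmean k : continuous k -> gint k -> (forall t, k (- t) = k t) ->
  gmean k = 2 * tail k 0.
Proof.
move=> ck ik ek; have := tailE 0 ik.
rewrite -{2}oppr0 -tail_reflect// (_ : (fun t => k (- t)) = k); last exact/funext.
lra.
Qed.

(** If [V w] is nonnegative, so is the integrand of the tail. Otherwise mean zero turns the tail
    into minus the integral over []-oo, w]], where [V] is negative. *)
Lemma stein_u_ge0 V w : {homo V : x y / x <= y} -> gint V -> gmean V = 0 ->
  0 <= stein_u V w.
Proof.
move=> ndV iV V0; rewrite divr_ge0 ?gam_ge0//.
have [Vw|Vw] := leP 0 (V w).
  by apply: tail_ge0 => t wt; exact: le_trans (ndV _ _ wt).
rewrite tailE// V0 sub0r -mulN1r -RintegralZl//; last exact: gintS.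
apply: Rintegral_ge0 => t; rewrite /= in_itv/= => tw.
rewrite mulN1r oppr_ge0 nmulr_rle0 ?gam_ge0//.
exact: le_lt_trans (ndV _ _ tw) Vw.
Qed.

(* The derivative of [w * stein_u V w] is the difference of the two sides. *)
Lemma stein_u_deriv_ge0 V w : {homo V : x y / x <= y} -> continuous V -> gint V ->
  gmean V = 0 -> w * V w <= (1 + w ^+ 2) * stein_u V w.
Proof.
wlog w0 : V w / 0 <= w => [H|].
  have [w0|w0] := leP 0 w; first exact: H.
  move=> ndV cV iV V0; rewrite -[w]opprK stein_u_reflect// sqrrN mulNr -mulrN.
  apply: H.
  - by rewrite oppr_ge0 ltW.
  - by move=> x y xy; rewrite lerN2 ndV// lerN2.
  - by move=> x; apply: cvgN; exact: continuous_reflect.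
  - apply: eq_integrable (gintZ (-1) (gint_reflect cV iV)) => // t _ /=.
    by rewrite mulN1r.
  - rewrite (_ : (fun t => - V (- t)) = (fun t => -1 * V (- t))); last first.
      by apply/funext => t; rewrite mulN1r.
    rewrite gmeanZ; last exact: gint_reflect.
    have : gmean V = gmean (fun t => V (- t)).
      have := tailE 0 iV; have := tailE 0 (gint_reflect cV iV).
      have := tail_reflect 0 (continuous_reflect cV) (gint_reflect cV iV).
      under eq_fun do rewrite opprK.
      have := tail_reflect 0 cV iV; rewrite oppr0; lra.
    by rewrite V0 => <-; rewrite mulr0.
move=> ndV cV iV V0.
have u0 := stein_u_ge0 w ndV iV V0.
have [Vw|Vw] := leP 0 (V w); last first.
  apply: (@le_trans _ _ 0); first by rewrite mulr_ge0_le0// ltW.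
  by rewrite mulr_ge0// addr_ge0 ?sqr_ge0.
rewrite /stein_u mulrA ler_pdivlMr ?gam_gt0// mulrAC.
have i1 : gint (fun=> 1 : R) := gint_cst _.
have iVw : gint (fun=> V w * 1) := gintZ (V w) i1.
(* Monotonicity gives tail V >= V(w) tail 1 beyond [w], and the Mills inequality bounds tail 1 from
   below. *)
apply: (@le_trans _ _ ((1 + w ^+ 2) * (V w * tail (fun=> 1) w))).
  by have := ler_wpM2l Vw (mills w); lra.
rewrite ler_wpM2l ?addr_ge0 ?sqr_ge0// -tailZ//.
by apply: tail_le => // t wt; rewrite mulr1 ndV.
Qed.

Lemma stein_u_monotone V : {homo V : x y / x <= y} -> continuous V -> gint V ->
  gmean V = 0 -> {homo (fun w => w * stein_u V w) : x y / x <= y}.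
Proof.
move=> ndV cV iV V0 x y xy.
have d z : is_derive z 1 (fun w => w * stein_u V w) ((1 + z ^+ 2) * stein_u V z - z * V z).
  have du := stein_u_is_derive z cV iV; apply: is_derive_eq.
  by rewrite /GRing.scale/=; ring.
have dd z : derivable (fun w => w * stein_u V w) z 1 by have [] := d z.
have cw : {within `[x, y], continuous (fun w => w * stein_u V w)}.
  by apply: derivable_within_continuous => z _; exact: dd.
have [c _ E] := MVT_segment xy (fun z _ => d z) cw.
by rewrite -subr_ge0 E mulr_ge0 ?subr_ge0// stein_u_deriv_ge0.
Qed.

End reflection.

(** * Powers and their Gaussian tails *)

Section powers.
Context {R : realType}.
Notation mu := (@lebesgue_measure R).
Notation gam := (@gam R).
Implicit Types (k V : R -> R) (w x y z t p r : R).

Lemma powRD1 x p : 0 <= x -> 0 <= p -> x `^ (p + 1) = x `^ p * x.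
Proof.
move=> x0 p0; rewrite powRD; first by rewrite powRr1.
by rewrite gt_eqF// ltr_wpDl.
Qed.

Lemma powRB1 x p : 0 <= x -> 1 <= p -> x `^ p = x `^ (p - 1) * x.
Proof. by move=> x0 p1; rewrite -powRD1 ?subr_ge0// subrK. Qed.

Lemma is_derive_signed_powR r t : 0 < r ->
  is_derive t 1 (fun x : R => x * `|x| `^ r) ((r + 1) * `|t| `^ r).
Proof.
move=> r0; wlog t0 : t / 0 <= t => [H|].
  have [t0|t0] := leP 0 t; first exact: H.
  have Nt0 : 0 <= - t by rewrite oppr_ge0 ltW.
  have d := H _ Nt0; rewrite normrN in d.
  have -> : (fun x : R => x * `|x| `^ r) = (\- ((fun x : R => x * `|x| `^ r) \o -%R)).
    by apply/funext => x /=; rewrite normrN mulNr opprK.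
  have dN : is_derive t 1 (-%R : R -> R) (-1) by apply: is_derive_eq.
  have dc := is_derive1_comp d dN.
  by apply: is_derive_eq; rewrite mulrN1 opprK.
move: t0; rewrite le_eqVlt => /predU1P[<-|t0].
  rewrite normr0 powR0 ?gt_eqF// mulr0.
  (* At 0 the slope function is |x|^r itself, continuous and zero at 0 because [r > 0]. *)
  apply/is_derive1_caratheodory; exists (fun x => `|x| `^ r); split => [z||].
  - by rewrite mul0r !subr0 mulrC.
  - exact/continuous_abs_powR/ltW.
  - by rewrite normr0 powR0 ?gt_eqF.
have dp : is_derive t 1 (fun x : R => x * x `^ r) ((r + 1) * t `^ r).
  have d := @is_derive1_powR R r t t0; apply: is_derive_eq; rewrite /GRing.scale/=.
  by have := mulr_powRB1 (ltW t0) r0 => <-; ring.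
rewrite (gtr0_norm t0); apply: near_eq_is_derive dp.
by near=> x; rewrite gtr0_norm//; near: x; exact: lt_nbhsr.
Unshelve. all: by end_near. Qed.

Definition apow p t := `|t| `^ p.
Definition spow r t := t * `|t| `^ r / (r + 1).

Lemma apow_ge0 p t : 0 <= apow p t. Proof. exact: powR_ge0. Qed.

Lemma apow_continuous p : 0 <= p -> continuous (apow p).
Proof. exact: continuous_abs_powR. Qed.

Lemma gint_apow p : 0 <= p -> gint (apow p).
Proof. exact: gint_abs_powR. Qed.

Lemma spow_is_derive r t : 0 < r -> is_derive t 1 (spow r) (apow r t).
Proof.
move=> r0; have d := is_derive_signed_powR t r0; rewrite /spow.
have r1 : r + 1 != 0 by rewrite gt_eqF// addr_gt0.
by apply: is_derive_eq; rewrite /GRing.scale/= /apow; field.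
Qed.

Lemma spow_continuous r : 0 < r -> continuous (spow r).
Proof.
move=> r0 x; apply/differentiable_continuous/derivable1_diffP.
by have [] := spow_is_derive x r0.
Qed.

Lemma spowN r t : spow r (- t) = - spow r t.
Proof. by rewrite /spow normrN !mulNr. Qed.

Lemma norm_spow r t : 0 < r -> `|spow r t| = apow (r + 1) t / (r + 1).
Proof.
move=> r0; have r1 : 0 < r + 1 by rewrite addr_gt0.
rewrite /spow /apow powRD1 ?(ltW r0)// !normrM normfV (gtr0_norm r1).
by rewrite (ger0_norm (powR_ge0 _ _)) [_ * `|t|]mulrC.
Qed.

Lemma gint_spow r : 0 < r -> gint (spow r).
Proof.
move=> r0; have r1 : 0 <= r + 1 by rewrite addr_ge0// ltW.
apply: (gint_le (spow_continuous r0) (gintZ (r + 1)^-1 (gint_apow r1))) => t.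
by rewrite norm_spow// mulrC.
Qed.

Lemma odd_gmean k : continuous k -> gint k -> (forall t, k (- t) = - k t) -> gmean k = 0.
Proof.
move=> ck ik ok; have E := tailE 0 ik.
have := tail_reflect 0 ck ik; rewrite oppr0.
rewrite (_ : (fun t => k (- t)) = (fun t => -1 * k t)); last first.
  by apply/funext => t; rewrite ok mulN1r.
by rewrite tailZ//; lra.
Qed.

(** Convexity of the power function at the midpoint of [x] and [y]. *)
Lemma ler_powD r x y : 0 <= x -> 0 <= y -> 1 <= r ->
  (x + y) `^ r <= 2 `^ (r - 1) * (x `^ r + y `^ r).
Proof.
move=> x0 y0 r1.
have r0 : 0 <= r by exact: le_trans r1.
have h : 0 <= (2^-1 : R) <= 1 by lra.
have := @convex_powR R r r1 (@Itv01 R 2^-1 (proj1 (andP h)) (proj2 (andP h))) x y.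
rewrite !inE/= !in_itv/= !andbT => /(_ x0 y0) H.
have {}H : (2^-1 * x + (1 - 2^-1) * y) `^ r <= 2^-1 * x `^ r + (1 - 2^-1) * y `^ r := H.
have -> : x + y = 2 * (2^-1 * x + (1 - 2^-1) * y) by field.
have xy0 : 0 <= 2^-1 * x + (1 - 2^-1) * y by lra.
rewrite powRM// (powRB1 (ler0n R 2) r1) -mulrA ler_wpM2l ?powR_ge0//.
lra.
Qed.

(* For [0 <= w <= t], [gam t <= gam w gam (t - w) / gam 0]. *)
Lemma tail_translate (q : R -> R) w : (forall t, 0 <= q t) -> continuous q -> gint q ->
  0 <= w -> tail (fun t => q (t - w)) w <= gam w / gam 0 * tail q 0.
Proof.
move=> q0 cq iq w0.
have cqw : continuous (fun t => q (t - w)).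
  move=> x; suff: {for x, continuous (q \o (fun t => t - w))} by [].
  apply: continuous_comp; last exact: cq.
  by apply: cvgB; [exact: cvg_id|exact: cvg_cst].
have cshift (h : R -> R) : continuous h -> (forall t, 0 <= h t) ->
   (\int[mu]_(t in `[0%R, +oo[) (h t)%:E = \int[mu]_(t in `[w, +oo[) (h (t - w))%:E)%E.
  move=> ch h0; have F'E : (fun t => t - w)^`()%classic = cst (1 : R).
    apply/funext => t; rewrite derive1E.
    by apply: derive_val; apply: is_derive_eq; rewrite subr0.
  rewrite -{1}(subrr w) (@increasing_ge0_integration_by_substitutiony _ (fun t => t - w) h).
  - by apply: eq_integral => t _; rewrite F'E /= mulr1.
  - by move=> x y _ _ xy; rewrite ltrD2r.
  - by rewrite F'E => x _; exact: cst_continuous.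
  - by rewrite F'E; exact: is_cvg_cst.
  - by rewrite F'E; exact: is_cvg_cst.
  - split => //.
    by apply: cvg_at_right_filter; apply: cvgB; [exact: cvg_id|exact: cvg_cst].
  - exact: cvg_addrr.
  - exact: continuous_subspaceT.
  by [].
have iqw : mu.-integrable `[w, +oo[ (EFin \o (fun t => q (t - w) * gam (t - w))).
  apply/integrableP; split.
    apply/measurable_EFinP; apply: measurable_funTS; apply: continuous_measurable_fun.
    move=> x; apply: cvgM; first exact: cqw.
    suff: {for x, continuous (gam \o (fun t => t - w))} by [].
    apply: continuous_comp; last exact: gam_continuous.
    by apply: cvgB; [exact: cvg_id|exact: cvg_cst].
  under eq_integral do rewrite /= ger0_norm ?mulr_ge0 ?gam_ge0//.
  rewrite -(cshift (fun t => q t * gam t)); last 2 first.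
  - by move=> x; apply: cvgM; [exact: cq|exact: gam_continuous].
  - by move=> t; rewrite mulr_ge0 ?gam_ge0.
  have /integrableP[_] := @gintS R q `[0, +oo[ (measurable_itv _) iq.
  by under eq_integral do rewrite /= ger0_norm ?mulr_ge0 ?gam_ge0//.
have -> : tail q 0 = \int[mu]_(t in `[w, +oo[) (q (t - w) * gam (t - w)).
  rewrite /tail /Rintegral (cshift (fun t => q t * gam t))//.
  - by move=> x; apply: cvgM; [exact: cq|exact: gam_continuous].
  - by move=> t; rewrite mulr_ge0 ?gam_ge0.
rewrite -RintegralZl//.
have dom t : w <= t -> q (t - w) * gam t <= gam w / gam 0 * (q (t - w) * gam (t - w)).
  move=> wt; rewrite mulrCA ler_wpM2l//; apply: (le_trans (gam_sub w0 wt)).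
  by rewrite mulrAC.
have iZ : mu.-integrable `[w, +oo[
    (EFin \o (fun t => gam w / gam 0 * (q (t - w) * gam (t - w)))).
  by apply: eq_integrable (integrableZl _ (gam w / gam 0) iqw).
apply: le_Rintegral => //.
- apply: integrable_dominated iZ _ => //.
    apply: measurable_funTS; apply: continuous_measurable_fun.
    by move=> x; apply: cvgM; [exact: cqw|exact: gam_continuous].
  move=> t; rewrite /= in_itv/= andbT => wt.
  by rewrite ger0_norm ?mulr_ge0 ?gam_ge0// dom.
- by move=> t; rewrite /= in_itv/= andbT; exact: dom.
Qed.

(* [(t^r gam)' = - (t^(r+1) - r t^(r-1)) gam], integrated over [t >= w], where
   [t^(r-1) <= t^(r+1) / w^2]. *)
Lemma tail_apow_sub r w : 1 <= r -> 0 <= w ->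
  (w ^+ 2 - r) * tail (apow (r + 1)) w <= w ^+ 2 * w `^ r * gam w.
Proof.
move=> r1 w0; have r0 : 0 < r by exact: lt_le_trans r1.
have r10 : 0 <= r + 1 by rewrite addr_ge0// ltW.
(* If w^2 <= r the left side is not positive. Otherwise t^2 - r is nonnegative for t >= w, so the
   half-line fundamental theorem applies to [k]. *)
have [wr|rw] := leP (w ^+ 2) r.
  apply: (@le_trans _ _ 0); last by rewrite !mulr_ge0 ?gam_ge0 ?powR_ge0 ?sqr_ge0.
  by rewrite mulr_le0_ge0 ?subr_le0// tail_ge0// => t _; exact: apow_ge0.
have wpos : 0 < w by rewrite lt_neqAle w0 andbT; apply: contraTneq rw => <-; rewrite expr0n/= -leNgt ltW.
pose k t := apow (r + 1) t - r * apow (r - 1) t.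
have ck : continuous k.
  move=> x; apply: cvgB; first exact: apow_continuous.
  apply: cvgM; first exact: cvg_cst.
  by apply: apow_continuous; rewrite subr_ge0.
have ik : gint k.
  have rm1 : 0 <= r - 1 by rewrite subr_ge0.
  apply: eq_integrable (gintD (gint_apow r10) (gintZ (- r) (gint_apow rm1))) => // t _ /=.
  by rewrite mulNr.
have kE t : 0 < t -> k t = t `^ (r - 1) * (t ^+ 2 - r).
  move=> t0; rewrite /k /apow gtr0_norm// (powRD1 (ltW t0) (ltW r0)) (powRB1 (ltW t0) r1).
  by ring.
have kT : tail k w = w `^ r * gam w.
  have dF t : 0 < t -> is_derive t 1 (fun t => - (t `^ r * gam t)) (k t * gam t).
    move=> t0; have dg := gam_is_derive t; have dp := is_derive1_powR r t0.
    apply: is_derive_eq; rewrite /GRing.scale/= kE// (powRB1 (ltW t0) r1); ring.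
  rewrite /tail (@Rintegral_ge0_continuous_FTC2y R (fun t => k t * gam t) (fun t => - (t `^ r * gam t)) w (- 0)).
  - by rewrite oppr0 sub0r opprK.
  - move=> t wt; have t0 := lt_le_trans wpos wt.
    rewrite mulr_ge0 ?gam_ge0// kE// mulr_ge0 ?powR_ge0// subr_ge0.
    by apply: (le_trans (ltW rw)); rewrite ler_pXn2r// nnegrE ltW.
  - apply: continuous_subspaceT => x; apply: cvgM; [exact: ck|exact: gam_continuous].
  - apply: cvgN; have := @powR_gam_cvg0 R _ (ltW r0); apply: cvg_trans.
    apply: near_eq_cvg; apply: filterS (nbhs_pinfty_gt (num_real (0 : R))) => x x0 /=.
    by rewrite gtr0_norm.
  - by move=> t wt; have [] := dF t (lt_trans wpos wt).
  - suff: {for w, continuous (fun t => - (t `^ r * gam t))} by exact: cvg_at_right_filter.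
    by apply/differentiable_continuous/derivable1_diffP; have [] := dF w wpos.
  - move=> t; rewrite in_itv/= andbT => wt.
    by rewrite derive1E; have [] := dF t (lt_trans wpos wt).
rewrite -mulrA -kT -(tailZ _ _ (gint_apow r10)) -(tailZ _ _ ik).
apply: tail_le.
- exact/gintZ/gint_apow.
- exact: gintZ.
move=> t wt; have t0 := lt_le_trans wpos wt.
rewrite kE// /apow gtr0_norm// (powRD1 (ltW t0) (ltW r0)) (powRB1 (ltW t0) r1).
have := powR_ge0 t (r - 1); set P := _ `^ _ => P0.
have wt2 : w ^+ 2 <= t ^+ 2 by rewrite ler_pXn2r// nnegrE ltW.
rewrite -subr_ge0 [leRHS](_ : _ = P * r * (t ^+ 2 - w ^+ 2)); last by ring.
by rewrite !mulr_ge0 ?subr_ge0// ltW.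
Qed.

(** The left side is the derivative of [w * stein_u (spow r) w]. As [spow r t] is t^(r+1) / (r+1)
    for t >= 0, multiplication by r + 1 turns the claim into [tail_apow_sub]. *)
Lemma stein_u_spow_deriv r w : 1 <= r -> 0 <= w ->
  (1 + w ^+ 2) * stein_u (spow r) w - w * spow r w <= tail (apow (r + 1)) w / gam w.
Proof.
move=> r1 w0; have r0 : 0 < r by exact: lt_le_trans r1.
have r10 : 0 < r + 1 by rewrite addr_gt0.
have -> : stein_u (spow r) w = (r + 1)^-1 * (tail (apow (r + 1)) w / gam w).
  rewrite /stein_u mulrA -(tailZ _ _ (gint_apow (ltW r10))); congr (_ / _).
  apply: eq_Rintegral => t; rewrite inE/= in_itv/= andbT => wt.
  have t0 := le_trans w0 wt; rewrite /spow /apow ger0_norm// (powRD1 t0 (ltW r0)).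
  by ring.
have H := tail_apow_sub r1 w0.
have {}H : (w ^+ 2 - r) * (tail (apow (r + 1)) w / gam w) <= w ^+ 2 * w `^ r.
  by rewrite mulrA ler_pdivrMr ?gam_gt0.
set T := tail _ _ / _ in H *; set P := w `^ r in H.
have -> : w * spow r w = (r + 1)^-1 * (w ^+ 2 * P).
  by rewrite /spow ger0_norm// -/P; ring.
by rewrite mulrCA -mulrBr ler_pdivrMl//; lra.
Qed.

(** Convexity gives t^(r+1) <= 2^r (w^(r+1) + (t - w)^(r+1)). In the first term one factor [w] is
    raised to [t], whose tail is exactly [gam w]; the second term is a translate. *)
Lemma tail_apow_le r w : 1 <= r -> 0 <= w ->
  tail (apow (r + 1)) w / gam w <= 2 `^ r * (w `^ r + tail (apow (r + 1)) 0 / gam 0).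
Proof.
move=> r1 w0; have r0 : 0 <= r by exact: le_trans r1.
have r10 : 0 <= r + 1 by rewrite addr_ge0.
have r11 : 1 <= r + 1 by rewrite lerDr.
rewrite ler_pdivrMr ?gam_gt0//.
have i1 := gint_id.
pose q2 t := 2 `^ r * apow (r + 1) (t - w).
have cq : continuous (fun t => apow (r + 1) (t - w)).
  move=> x; suff: {for x, continuous (apow (r + 1) \o (fun t => t - w))} by [].
  apply: continuous_comp; last exact: apow_continuous.
  by apply: cvgB; [exact: cvg_id|exact: cvg_cst].
have iq : gint (fun t => apow (r + 1) (t - w)).
  apply: (gint_le cq (gintD (gintZ (2 `^ r) (gint_apow r10)) (gint_cst (2 `^ r * w `^ (r + 1))))) => t.
  rewrite ger0_norm ?apow_ge0// /= -mulrDr.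
  apply: (@le_trans _ _ ((`|t| + w) `^ (r + 1))).
    rewrite /apow ge0_ler_powR ?nnegrE ?addr_ge0//.
    by rewrite (le_trans (ler_normB _ _))// (ger0_norm w0).
  by have := ler_powD (normr_ge0 t) w0 r11; rewrite addrK.
apply: (@le_trans _ _ (tail ((fun t => 2 `^ r * w `^ r * t) \+ q2) w)).
  apply: tail_le.
  - exact: gint_apow.
  - exact: gintD (gintZ _ gint_id) (gintZ _ iq).
  move=> t wt; have t0 := le_trans w0 wt; have tw0 : 0 <= t - w by rewrite subr_ge0.
  rewrite /q2 /apow /= (ger0_norm t0) (ger0_norm tw0).
  have := ler_powD w0 tw0 r11; rewrite addrK subrKC => /le_trans; apply.
  rewrite -mulrA -mulrDr ler_wpM2l ?powR_ge0// lerD2r powRD1//.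
  by rewrite ler_wpM2l ?powR_ge0.
rewrite (tailD _ (gintZ _ gint_id) (gintZ _ iq)) (tailZ _ _ gint_id) (tailZ _ _ iq) tail_id.
rewrite mulrDr mulrDl lerD2l -[leRHS]mulrA ler_wpM2l ?powR_ge0//.
have := tail_translate (apow_ge0 (r + 1)) (apow_continuous r10) (gint_apow r10) w0.
by move/le_trans; apply; rewrite mulrC mulrA mulrAC.
Qed.

(** At exponent 1 the tail is explicit, and the coefficient 1 of [w] improves on the factor 2 of the
    general bound. The case r <= 1 of the theorem rests on this estimate. *)
Lemma tail_sqr_le w : 0 <= w ->
  tail (apow 2) w / gam w <= w + tail (fun=> 1) 0 / gam 0.
Proof.
move=> w0; rewrite ler_pdivrMr ?gam_gt0//.
have -> : apow 2 = (fun t => t ^+ 2).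
  by apply/funext => t; rewrite /apow powR_mulrn// real_normK ?num_real.
rewrite tail_sqr mulrDl lerD2l.
have := tail_translate (q := fun=> 1) (fun=> ler01) (@cst_continuous _ _ _) (gint_cst _) w0.
by move/le_trans; apply; rewrite mulrC mulrA mulrAC.
Qed.

End powers.

(** * The modulus of continuity of the Stein solution *)

Section stein_solution.
Context {R : realType}.
Notation gam := (@gam R).
Implicit Types (k V : R -> R) (w x y z t p r m : R).

Lemma stein_uD k1 k2 w : gint k1 -> gint k2 ->
  stein_u (k1 \+ k2) w = stein_u k1 w + stein_u k2 w.
Proof. by move=> i1 i2; rewrite /stein_u tailD// mulrDl. Qed.

Lemma stein_uZ c k w : gint k -> stein_u (fun t => c * k t) w = c * stein_u k w.
Proof. by move=> i; rewrite /stein_u tailZ// mulrA. Qed.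

Lemma stein_u_id w : stein_u id w = 1.
Proof. by rewrite /stein_u tail_id divff ?gam_neq0. Qed.

Lemma stein_u_spowN r w : 0 < r -> stein_u (spow r) (- w) = stein_u (spow r) w.
Proof.
move=> r0; rewrite stein_u_reflect.
- by congr stein_u; apply/funext => t; rewrite spowN opprK.
- exact: spow_continuous.
- exact: gint_spow.
- by apply: odd_gmean; [exact: spow_continuous|exact: gint_spow|exact: spowN].
Qed.

Lemma derive_le_lipschitz (F dF : R -> R) x y M : y <= x ->
  (forall z, is_derive z 1 F (dF z)) -> (forall z, y <= z -> z <= x -> dF z <= M) ->
  F x - F y <= (x - y) * M.
Proof.
move=> yx dFz dFM.
have cw : {within `[y, x], continuous F}.
  by apply: derivable_within_continuous => z _; have [] := dFz z.
have [c] := MVT_segment yx (fun z _ => dFz z) cw.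
rewrite in_itv/= => /andP[yc cx] ->.
by rewrite mulrC ler_wpM2l ?subr_ge0// dFM.
Qed.

Lemma norm_between y x z m : `|y| <= m -> `|x| <= m -> y <= z -> z <= x -> `|z| <= m.
Proof. by rewrite !ler_norml; lra. Qed.

(* The odd primitive of [A + B |t|^r]. *)
Definition growth (A B r : R) t := A * t + B * spow r t.

Lemma growth_is_derive A B r t : 0 < r ->
  is_derive t 1 (growth A B r) (A + B * apow r t).
Proof.
move=> r0; have d := spow_is_derive t r0.
by apply: is_derive_eq; rewrite /GRing.scale/=; ring.
Qed.

(** The pair ([alpha], [beta]) abstracts the tail bound; it is instantiated with 2^r and 2^r mills0
    E|Z|^(r+1) and, at exponent 1, with 1 and [mills0]. In the final constant one [A] and the 1 of
    [1 + alpha] come from the increments of [G]; the other [A], with [alpha] and [beta], comes from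
    those of [w * stein_u G w]. *)
Lemma stein_solution (A B r alpha beta : R) (H : R -> R) :
  0 <= A -> 0 <= B -> 1 <= r -> 0 <= alpha -> 0 <= beta ->
  (forall w, 0 <= w -> tail (apow (r + 1)) w / gam w <= alpha * w `^ r + beta) ->
  (forall x y, y <= x -> `|H x - H y| <= growth A B r x - growth A B r y) ->
  gint H /\ exists psi p : R -> R,
   [/\ forall w, is_derive w 1 psi (p w), continuous p,
     forall w, p w - w * psi w = H w - gmean H &
     forall m x y, `|x| <= m -> `|y| <= m ->
       `|p x - p y| <= `|x - y| * (2 * A + B * ((1 + alpha) * m `^ r + beta))].
Proof.
move=> A0 B0 r1 al0 be0 Hs HG.
have r0 : 0 < r by exact: lt_le_trans r1.
set G := growth A B r in HG *.
have dG z : is_derive z 1 G (A + B * apow r z) by exact: growth_is_derive.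
have cG : continuous G.
  by move=> x; apply/differentiable_continuous/derivable1_diffP; have [] := dG x.
have iG : gint G := gintD (gintZ A gint_id) (gintZ B (gint_spow r0)).
have oG t : G (- t) = - G t by rewrite /G /growth spowN !mulrN opprD.
have G0 : gmean G = 0 by exact: odd_gmean.
have HGn x y : `|H x - H y| <= `|G x - G y|.
  have [yx|/ltW xy] := leP y x; first exact: le_trans (HG _ _ yx) (ler_norm _).
  by rewrite distrC (distrC (G x)); exact: le_trans (HG _ _ xy) (ler_norm _).
have cH : continuous H.
  move=> x; apply/cvgrPdist_lt => e e0; near=> y.
  apply: (le_lt_trans (HGn x y)); near: y; apply: cvgr_dist_lt => //; exact: cG.
have iH : gint H.
  apply: (gint_le cH (gintD (gint_cst `|H 0|) (gint_norm iG))) => t /=.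
  have := HGn t 0; have G00 : G 0 = 0 by rewrite /G /growth /spow mulr0 !mul0r mulr0 addr0.
  rewrite G00 subr0 => h; rewrite -lerBlDl; apply: le_trans h.
  exact: lerB_dist.
split => //.
pose Hc := H \+ (fun=> - gmean H).
have cHc : continuous Hc by move=> x; apply: cvgD; [exact: cH|exact: cvg_cst].
have iHc : gint Hc := gintD iH (gint_cst _).
have Hc0 : gmean Hc = 0 by rewrite gmeanD ?gint_cst// gmean_cst subrr.
pose NHc := fun t => -1 * Hc t.
have iN : gint NHc := gintZ _ iHc.
exists (fun w => - stein_u Hc w), (fun w => Hc w - w * stein_u Hc w).
have du w := stein_u_is_derive w cHc iHc.
split.
- by move=> w; have d := du w; apply: is_derive_eq; rewrite opprB.
- move=> x; apply: cvgB; first exact: cHc.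
  apply: cvgM; first exact: cvg_id.
  by apply/differentiable_continuous/derivable1_diffP; have [] := du x.
- by move=> w; rewrite /Hc /=; ring.
move=> m x y; wlog yx : x y / y <= x => [K|] xm ym.
  have [yx|/ltW xy] := leP y x; first exact: K.
  by rewrite distrC (distrC x); exact: K.
have HcE s t : Hc s - Hc t = H s - H t by rewrite /Hc /=; ring.
have ndP : {homo (G \+ Hc) : s t / s <= t}.
  move=> s t st; have := HG _ _ st; rewrite ler_norml => /andP[+ _].
  by have := HcE t s; rewrite /=; lra.
have ndM : {homo (G \+ NHc) : s t / s <= t}.
  move=> s t st; have := HG _ _ st; rewrite ler_norml => /andP[_ +].
  by have := HcE t s; rewrite /NHc /=; lra.
have cP : continuous (G \+ Hc) by move=> z; apply: cvgD; [exact: cG|exact: cHc].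
have cM : continuous (G \+ NHc).
  move=> z; apply: cvgD; first exact: cG.
  by apply: cvgM; [exact: cvg_cst|exact: cHc].
have P0 : gmean (G \+ Hc) = 0 by rewrite (gmeanD iG iHc) G0 Hc0 addr0.
have M0 : gmean (G \+ NHc) = 0 by rewrite (gmeanD iG iN) (gmeanZ _ iHc) G0 Hc0 mulr0 addr0.
have := stein_u_monotone ndP cP (gintD iG iHc) P0 yx.
rewrite !(stein_uD _ iG iHc) => hP.
have := stein_u_monotone ndM cM (gintD iG iN) M0 yx.
rewrite !(stein_uD _ iG iN) !(stein_uZ _ _ iHc) => hM.
pose S z := (1 + z ^+ 2) * stein_u G z - z * G z.
have dS z : is_derive z 1 (fun w => w * stein_u G w) (S z).
  have d := stein_u_is_derive z cG iG; apply: is_derive_eq.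
  by rewrite /GRing.scale/= /S; ring.
have uGE w : stein_u G w = A + B * stein_u (spow r) w.
  rewrite /G (stein_uD w (gintZ A gint_id) (gintZ B (gint_spow r0))).
  by rewrite (stein_uZ _ _ gint_id) (stein_uZ _ _ (gint_spow r0)) stein_u_id mulr1.
have SE z : S z = A + B * ((1 + z ^+ 2) * stein_u (spow r) z - z * spow r z).
  by rewrite /S uGE /G /growth; ring.
(* [S] is even, so the tail estimate at |z| suffices. *)
have Sle z : S z <= A + B * (alpha * `|z| `^ r + beta).
  have -> : S z = A + B * ((1 + `|z| ^+ 2) * stein_u (spow r) `|z| - `|z| * spow r `|z|).
    rewrite SE; have [z0|z0] := ger0P z; first by [].
    by rewrite sqrrN stein_u_spowN// spowN mulrNN.
  rewrite lerD2l ler_wpM2l//.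
  exact: le_trans (stein_u_spow_deriv r1 (normr_ge0 z)) (Hs _ (normr_ge0 z)).
have m0 : 0 <= m := le_trans (normr_ge0 _) xm.
have powm z : y <= z -> z <= x -> `|z| `^ r <= m `^ r.
  move=> yz zx; apply: ge0_ler_powR; rewrite ?nnegrE ?(ltW r0)//.
  exact: norm_between ym xm yz zx.
have b1 : x * stein_u G x - y * stein_u G y <= (x - y) * (A + B * (alpha * m `^ r + beta)).
  apply: derive_le_lipschitz yx dS _ => z yz zx; apply: (le_trans (Sle z)).
  by rewrite lerD2l ler_wpM2l// lerD2r ler_wpM2l// powm.
have b2 : G x - G y <= (x - y) * (A + B * m `^ r).
  apply: derive_le_lipschitz yx dG _ => z yz zx.
  by rewrite lerD2l ler_wpM2l// powm.
have hH := HG _ _ yx; rewrite ler_norml in hH; have /andP[h1 h2] := hH.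
have := HcE x y => E1.
rewrite (@ger0_norm _ (x - y)) ?subr_ge0//.
have -> : (x - y) * (2 * A + B * ((1 + alpha) * m `^ r + beta)) =
   (x - y) * (A + B * m `^ r) + (x - y) * (A + B * (alpha * m `^ r + beta)) by ring.
move: b1 b2; set b1 := (x - y) * (A + _ * (_ + _)); set b2 := (x - y) * (A + _) => h3 h4.
by rewrite ler_norml; apply/andP; split; lra.
Unshelve. all: by end_near. Qed.

End stein_solution.

(** * Independence *)

Section law_on.
Context d d2 (T : measurableType d) (T2 : measurableType d2) (R : realType)
  (P : probability T R) (E : set T) (mE : measurable E) (Y : {mfun T >-> T2}).

(** The law of [Y] restricted to the event [E], without division by [P E]; no exception arises when
    that probability is 0. *)
Definition law_on (A : set T2) : \bar R := mrestr P mE (Y @^-1` A).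

Let law_on0 : law_on set0 = 0%E.
Proof. by rewrite /law_on preimage_set0 measure0. Qed.

Let law_on_ge0 A : (0 <= law_on A)%E.
Proof. exact: measure_ge0. Qed.

Let law_on_sigma_additive : semi_sigma_additive law_on.
Proof.
exact: (@measure_semi_sigma_additive _ _ _
  (pushforward (mrestr P mE) Y : {measure set T2 -> \bar R})).
Qed.

HB.instance Definition _ := isMeasure.Build _ _ _ law_on law_on0 law_on_ge0
  law_on_sigma_additive.

Let law_on_fin : fin_num_fun law_on.
Proof.
move=> A mA; rewrite ge0_fin_numE// /law_on /mrestr.
apply: (@le_lt_trans _ _ (P setT)); last by rewrite probability_setT ltry.
apply: le_measure; rewrite ?inE//.
by apply: measurableI => //; rewrite -[X in measurable X]setTI; exact: measurable_funP.
Qed.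

HB.instance Definition _ := @Measure_isFinite.Build _ _ _ law_on law_on_fin.
End law_on.

Section independence.
Context d (T : measurableType d) (R : realType) (P : probability T R).

Lemma measurable_preimage d2 (T2 : measurableType d2) (Y : {mfun T >-> T2}) (A : set T2) :
  measurable A -> measurable (Y @^-1` A).
Proof. by move=> mA; rewrite -[X in measurable X]setTI; exact: measurable_funP. Qed.

Section pair.
Variables (U V : {mfun T >-> R}).
Definition pair_fun (w : T) : R * R := (U w, V w).
Let measurable_pair_fun : measurable_fun setT pair_fun.
Proof. by apply: measurable_fun_pair. Qed.
HB.instance Definition _ := isMeasurableFun.Build _ _ _ _ pair_fun measurable_pair_fun.
End pair.

Definition independent2 (U V : T -> R) := forall A C : set R, measurable A -> measurable C ->
  P (U @^-1` A `&` V @^-1` C) = (P (U @^-1` A) * P (V @^-1` C))%E.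

(* Conditioning on [E] with [E] independent of [(U, V)] does not change the joint law. *)
Lemma independent_event_sum (U V : {mfun T >-> R}) (E : set T) (c : {nonneg R}) :
  measurable E ->
  (forall A C : set R, measurable A -> measurable C ->
    P ((U @^-1` A `&` V @^-1` C) `&` E) = (P (U @^-1` A) * P (V @^-1` C) * c%:num%:E)%E) ->
  independent2 U V ->
  forall M : set (R * R), measurable M ->
    P (pair_fun U V @^-1` M `&` E) = (P (pair_fun U V @^-1` M) * c%:num%:E)%E.
Proof.
move=> mE H UV M mM.
have PE A : measurable A -> P (U @^-1` A `&` E) = (P (U @^-1` A) * c%:num%:E)%E.
  move=> mA; have := H A setT mA measurableT.
  by rewrite preimage_setT setIT probability_setT mule1.
(* Both sides are identified with the product of the law of [U] on [E] and the law of [V]; a finite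
   product measure is determined by its values on rectangles. *)
have E1 : (law_on P mE U \x distribution P V)%E M = law_on P mE (pair_fun U V) M.
  apply: product_measure_unique => // A C mA mC.
  transitivity (P ((U @^-1` A `&` V @^-1` C) `&` E)); first by [].
  transitivity (P (U @^-1` A `&` E) * P (V @^-1` C))%E; last by [].
  by rewrite H// PE// muleAC.
have E2 : (law_on P mE U \x distribution P V)%E M = mscale c (distribution P (pair_fun U V)) M.
  apply: product_measure_unique => // A C mA mC.
  transitivity (c%:num%:E * P (U @^-1` A `&` V @^-1` C))%E; first by [].
  transitivity (P (U @^-1` A `&` E) * P (V @^-1` C))%E; last by [].
  by rewrite UV// PE// muleAC muleC.
by rewrite -[LHS]/(law_on P mE (pair_fun U V) M) -E1 E2 /mscale muleC.
Qed.

(** Under independence the joint law is the product of the laws, and Fubini's theorem factors the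
    integral. *)
Lemma independent2_expectation (U V : {mfun T >-> R}) (a b : R -> R) :
  independent2 U V -> measurable_fun setT a -> measurable_fun setT b ->
  P.-integrable setT (EFin \o (a \o U)) -> P.-integrable setT (EFin \o (b \o V)) ->
  P.-integrable setT (EFin \o (fun w => a (U w) * b (V w))) /\
  \int[P]_w (a (U w) * b (V w)) = (\int[P]_w a (U w)) * (\int[P]_w b (V w)).
Proof.
move=> UV ma mb ia ib.
pose m := (distribution P U \x distribution P V)%E.
have mE (M : set (R * R)) : measurable M -> m M = distribution P (pair_fun U V) M.
  by move=> mM; apply: product_measure_unique => // A C mA mC; exact: UV.
pose f (z : R * R) := (a z.1 * b z.2)%:E.
have mf : measurable_fun setT f.
  apply/measurable_EFinP; apply: measurable_funM; exact: measurableT_comp.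
have law_int (W : {mfun T >-> R}) (k : R -> R) : measurable_fun setT k ->
   P.-integrable setT (EFin \o (k \o W)) ->
   (distribution P W).-integrable setT (EFin \o k) /\
   (\int[distribution P W]_x (k x)%:E = \int[P]_w (k (W w))%:E)%E.
  move=> mk ik; split; last first.
    by rewrite (@integral_distribution _ _ _ _ _ P W (EFin \o k))//; exact/measurable_EFinP.
  apply/integrableP; split; first exact/measurable_EFinP.
  rewrite (@ge0_integral_distribution _ _ _ _ _ P W (fun x => `|(k x)%:E|%E))//.
    by have /integrableP[] := ik.
  by apply: measurableT_comp => //; exact/measurable_EFinP.
have [iaU aE] := law_int U a ma ia.
have [ibV bE] := law_int V b mb ib.
have ifm : m.-integrable setT f.
  apply/integrable12ltyP => //.
  under eq_integral => x _.
    under eq_integral => y _ do rewrite /f /= normrM EFinM.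
    rewrite ge0_integralZl//; last by apply/measurable_EFinP; exact: measurableT_comp.
    over.
  have /integrableP[_ fa] := iaU; have /integrableP[_ fb] := ibV.
  rewrite ge0_integralZr//.
  - by rewrite lte_mul_pinfty//; [exact: integral_ge0|
      rewrite ge0_fin_numE//; exact: integral_ge0].
  - by apply/measurable_EFinP; apply: measurableT_comp.
  - exact: integral_ge0.
have ip : P.-integrable setT (f \o pair_fun U V).
  apply/integrableP; split; first exact: measurableT_comp.
  rewrite -(@ge0_integral_distribution _ _ _ _ _ P (pair_fun U V) (fun z => `|f z|%E))//; last first.
    exact: measurableT_comp.
  have /integrableP[_] := ifm; congr (_ < _)%E.
  by apply: eq_measure_integral => M mM _; exact: mE.
split; first exact: ip.
rewrite /Rintegral -[X in fine X](integral_distribution mf ip).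
rewrite (eq_measure_integral m) => [|M mM _]; last exact/esym/mE.
rewrite /m -integral12_prod_meas1//.
transitivity (fine (\int[distribution P U]_x
    ((a x)%:E * \int[distribution P V]_y (b y)%:E))%E).
  congr fine; apply: eq_integral => x _; rewrite /fubini_F -integralZl//.
rewrite -(fineK (integrable_fin_num measurableT ibV)) integralZr// fineM//; last first.
  exact: integrable_fin_num.
by rewrite aE bE.
Qed.

End independence.

(** * Sums of independent variables *)

Section independent_sums.
Context d (T : measurableType d) (R : realType) (P : probability T R).
Context (I : finType) (X : I -> {mfun T >-> R}).

Definition rv_sum (s : seq I) (w : T) : R := \sum_(j <- s) X j w.

Let measurable_rv_sum s : measurable_fun setT (rv_sum s).
Proof. by apply: measurable_sum. Qed.

HB.instance Definition _ s :=
  isMeasurableFun.Build _ _ _ _ (rv_sum s) (measurable_rv_sum s).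

Hypothesis indepX : mutually_independent P (fun i => X i : T -> R).

(** [K] varies in the induction: an index [j] removed from the sum joins the events. The sum over
    [j :: s] is a function of the sum over [s] and of [X j], and the joint law of these two is the
    same on [E] up to the factor [P E]. *)
Lemma independent_sum_events (s : seq I) (K : {set I}) (A : set R) (B : I -> set R) :
  uniq s -> (forall k, k \in K -> k \notin s) ->
  measurable A -> (forall i, measurable (B i)) ->
  P (rv_sum s @^-1` A `&` \bigcap_(k in [set` K]) (X k @^-1` B k)) =
  (P (rv_sum s @^-1` A) * \prod_(k in K) P (X k @^-1` B k))%E.
Proof.
elim: s K A B => [|j s IH] K A B.
  move=> _ _ mA mB; rewrite -indepX//.
  have [A0|A0] := pselect (A 0).
    rewrite (_ : rv_sum [::] @^-1` A = setT); first by rewrite setTI probability_setT mul1e.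
    by apply/seteqP; split => // w _; rewrite /rv_sum /= big_nil.
  rewrite (_ : rv_sum [::] @^-1` A = set0); first by rewrite set0I measure0 mul0e.
  by apply/seteqP; split => // w; rewrite /rv_sum /= big_nil.
move=> /= /andP[js us] Ks mA mB.
have mcap (L : {set I}) : measurable (\bigcap_(k in [set` L]) (X k @^-1` B k)).
  apply: fin_bigcap_measurable => [|k _]; first exact: finite_finset.
  exact: measurable_preimage.
have jK : j \notin K by apply/negP => /Ks; rewrite mem_head.
have Ks' k : k \in K -> k \notin s by move=> /Ks; rewrite inE negb_or => /andP[].
set E := \bigcap_(k in [set` K]) _; set prodE := (\prod_(k in K) _)%E.
have PE : P E = prodE by rewrite /E indepX.
pose c := NngNum (fine_ge0 (measure_ge0 P E)).
have cE : (c%:num%:E = prodE)%E.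
  rewrite -PE [LHS]fineK//; apply: fin_num_measure; exact: mcap.
rewrite -cE.
pose M := [set z : R * R | A (z.2 + z.1)].
have mM : measurable M.
  have : measurable_fun setT (fun z : R * R => z.2 + z.1) by exact: measurable_funD.
  by move=> /(_ measurableT A mA); rewrite setTI.
have preM : rv_sum (j :: s) @^-1` A = pair_fun (rv_sum s) (X j) @^-1` M.
  by apply/seteqP; split => w; rewrite /M /pair_fun /rv_sum /= big_cons.
rewrite preM; apply: independent_event_sum => //.
- exact: mcap.
- move=> C D mC mD; rewrite cE.
  pose B' k := if k == j then D else B k.
  have mB' k : measurable (B' k) by rewrite /B'; case: ifP.
  have := IH (j |: K)%SET C B' us _ mC mB'.
  have B'j : B' j = D by rewrite /B' eqxx.
  rewrite big_setU1//= B'j muleA.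
  have -> : (\prod_(k in K) P (X k @^-1` B' k) = prodE)%E.
    by apply: eq_bigr => k kK; rewrite /B'; case: eqP => // kj; rewrite -kj kK in jK.
  move=> <-.
    congr (P _); rewrite -setIA; congr (_ `&` _).
    apply/seteqP; split => w /=.
      move=> [Dw Ew] k /=; rewrite !inE => /orP[/eqP ->|kK]; first by rewrite /B' eqxx.
      by rewrite /B'; case: eqP => [->//|_]; exact: Ew.
    move=> H; split; first by have := H j; rewrite /= !inE eqxx /B' eqxx; apply.
    move=> k /= kK; have := H k; rewrite /= !inE kK orbT /B' => /(_ isT).
    by case: eqP => // kj; rewrite -kj kK in jK.
  by move=> k; rewrite !inE => /orP[/eqP ->//|]; exact: Ks'.
- move=> C D mC mD.
  have := IH [set j]%SET C (fun=> D) us _ mC (fun=> mD).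
  rewrite big_set1 => <-.
    by congr (P (_ `&` _)); apply/seteqP; split => w /=;
      [move=> Dw k /=; rewrite inE => /eqP ->|move=> H; apply: H; rewrite /= inE].
  by move=> k; rewrite inE => /eqP ->.
Qed.

Lemma independent2_rv_sum (i : I) (s : seq I) : uniq s -> i \notin s ->
  independent2 P (X i) (rv_sum s).
Proof.
move=> us is_ A C mA mC.
have := @independent_sum_events s [set i]%SET C (fun=> A) us _ mC (fun=> mA).
rewrite big_set1 muleC => <-.
  by rewrite setIC; congr (P (_ `&` _)); apply/seteqP; split => w /=;
    [move=> Dw k /=; rewrite inE => /eqP ->|move=> H; apply: H; rewrite /= inE].
by move=> k; rewrite inE => /eqP ->.
Qed.

End independent_sums.

(** * Stein's method for sums *)

Section smooth.
Context {R : realType}.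
Implicit Types (x y z t m : R).

Lemma norm_derive_le (F dF : R -> R) m K x y :
  (forall z, is_derive z 1 F (dF z)) -> (forall z, `|z| <= m -> `|dF z| <= K) ->
  `|x| <= m -> `|y| <= m -> `|F x - F y| <= `|x - y| * K.
Proof.
move=> d dK; wlog yx : x y / y <= x => [H|] xm ym.
  have [yx|/ltW xy] := leP y x; first exact: H.
  by rewrite distrC (distrC x); exact: H.
have cw : {within `[y, x], continuous F}.
  by apply: derivable_within_continuous => z _; have [] := d z.
have [c] := MVT_segment yx (fun z _ => d z) cw.
rewrite in_itv/= => /andP[yc cx] ->.
rewrite normrM mulrC ler_wpM2l//; apply: dK.
exact: norm_between ym xm yc cx.
Qed.

Context (psi p : R -> R) (a b r : R).
Hypotheses (a0 : 0 <= a) (b0 : 0 <= b) (r1 : 1 <= r).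
Hypothesis dpsi : forall z, is_derive z 1 psi (p z).
Hypothesis cp : continuous p.
Hypothesis plip : forall m x y, `|x| <= m -> `|y| <= m ->
  `|p x - p y| <= `|x - y| * (a + b * m `^ r).

Let r0 : 0 <= r. Proof. exact: le_trans r1. Qed.

Lemma psi_continuous : continuous psi.
Proof.
by move=> x; apply/differentiable_continuous/derivable1_diffP; have [] := dpsi x.
Qed.

(** The growth exponents are [r + 1] for [p] and [r + 2] for [psi], so that [w * psi w] grows with
    exponent [r + 3], the order of the moments assumed in the expansion. *)
Lemma p_growth : exists2 C, 0 <= C & forall z, `|p z| <= C * (1 + `|z|) `^ (r + 1).
Proof.
exists (`|p 0| + a + b); first by rewrite !addr_ge0.
move=> z; set t := 1 + `|z|.
have t1 : 1 <= t by rewrite lerDl.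
have t0 : 0 <= t := le_trans ler01 t1.
have tr : 1 <= t `^ r by rewrite -(powRr0 t) ler_powR.
have tr1 : t `^ (r + 1) = t `^ r * t := powRD1 t0 r0.
have zr : `|z| `^ r <= t `^ r by rewrite ge0_ler_powR ?nnegrE ?lerDr.
have := plip (lexx `|z|) (_ : `|0| <= `|z|); rewrite normr0 subr0 => /(_ (normr_ge0 _)) h.
have : `|p z| <= `|p 0| + `|p z - p 0| by have := ler_normD (p 0) (p z - p 0); rewrite subrKC.
move=> /le_trans; apply; rewrite !mulrDl.
have zt : `|z| <= t by rewrite lerDr.
have h1 : `|p 0| <= `|p 0| * t `^ (r + 1) by rewrite ler_peMr// tr1 mulr_ege1.
have h2 : `|z| * a <= a * t `^ (r + 1).
  by rewrite mulrC ler_wpM2l// (le_trans zt)// tr1 ler_peMl.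
have h3 : `|z| * (b * `|z| `^ r) <= b * t `^ (r + 1).
  by rewrite mulrCA ler_wpM2l// tr1 mulrC ler_pM ?powR_ge0.
by move: h; rewrite mulrDr; lra.
Qed.

Lemma psi_growth : exists2 C, 0 <= C & forall z, `|psi z| <= C * (1 + `|z|) `^ (r + 2).
Proof.
have [C C0 pC] := p_growth; exists (`|psi 0| + C); first by rewrite addr_ge0.
move=> z; set t := 1 + `|z|.
have t1 : 1 <= t by rewrite lerDl.
have t0 : 0 <= t := le_trans ler01 t1.
have r10 : 0 <= r + 1 by rewrite addr_ge0.
have tr : 1 <= t `^ (r + 2) by rewrite -[leLHS](powRr0 t) ler_powR// addr_ge0.
have tr2 : t `^ (r + 2) = t `^ (r + 1) * t by rewrite -(powRD1 t0 r10); congr (_ `^ _); ring.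
have h : `|psi z - psi 0| <= `|z - 0| * (C * t `^ (r + 1)).
  apply: (@norm_derive_le psi p `|z|) => //; last by rewrite normr0.
  move=> y yz; apply: (le_trans (pC y)); rewrite ler_wpM2l//.
  by rewrite ge0_ler_powR ?nnegrE ?addr_ge0// lerD2l.
have : `|psi z| <= `|psi 0| + `|psi z - psi 0|.
  by have := ler_normD (psi 0) (psi z - psi 0); rewrite subrKC.
move=> /le_trans; apply; rewrite mulrDl; apply: lerD; first by rewrite ler_peMr.
apply: (le_trans h); rewrite subr0 mulrCA ler_wpM2l// tr2 mulrC ler_wpM2l ?powR_ge0//.
by rewrite lerDr.
Qed.

(** The Lipschitz constant of [p] at radius |y| + |x| replaces a bound on the second derivative: for
    e = 1 and e = -1 the function [F e] is nonincreasing on [0, 1]. *)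
Lemma taylor_psi y x : `|psi (y + x) - psi y - x * p y| <=
  x ^+ 2 / 2 * (a + b * (`|y| + `|x|) `^ r).
Proof.
set nu := a + _.
have nu0 : 0 <= nu by rewrite addr_ge0// mulr_ge0// powR_ge0.
have key t : 0 <= t -> t <= 1 -> `|p (y + t * x) - p y| <= t * `|x| * nu.
  move=> t0 t1; have h1 : `|y + t * x| <= `|y| + `|x|.
    rewrite (le_trans (ler_normD _ _))// lerD2l normrM ler_piMl// ger0_norm//.
  have h2 : `|y| <= `|y| + `|x| by rewrite lerDl.
  have := plip h1 h2; rewrite addrAC subrr add0r normrM (ger0_norm t0).
  by [].
pose F e t := e * (psi (y + t * x) - t * (x * p y)) - nu * x ^+ 2 * (t ^+ 2 / 2).
have dF e t : is_derive t 1 (F e) (e * (x * (p (y + t * x) - p y)) - nu * x ^+ 2 * t).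
  have di : is_derive t 1 (fun t => y + t * x) x.
    by apply: is_derive_eq; rewrite /GRing.scale/=; ring.
  have dc : is_derive t 1 (fun t => psi (y + t * x)) (p (y + t * x) * x).
    exact: (@is_derive1_comp R psi (fun t => y + t * x)).
  by apply: is_derive_eq; rewrite /GRing.scale/=; field.
have main e : `|e| = 1 -> e * (psi (y + x) - psi y - x * p y) <= x ^+ 2 / 2 * nu.
  move=> e1; have := @derive_le_lipschitz R (F e) _ 1 0 0 ler01 (dF e).
  rewrite mulr0 /F !mul1r !mul0r addr0 => H.
  suff : e * (psi (y + x) - x * p y) - nu * x ^+ 2 * (1 ^+ 2 / 2) -
         (e * (psi y - 0) - nu * x ^+ 2 * (0 ^+ 2 / 2)) <= 0 by rewrite expr1n expr0n/=; lra.
  apply: H => t t0 t1; rewrite subr_le0.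
  apply: (le_trans (ler_norm _)); rewrite !normrM e1 mul1r.
  apply: (@le_trans _ _ (`|x| * (t * `|x| * nu))); first by rewrite ler_wpM2l// key.
  by rewrite -(real_normK (num_real x)); lra.
have h1 := main 1 (normr1 _); have h2 : _ := main (-1) (normrN1 _).
by rewrite ler_norml; apply/andP; split; lra.
Qed.

End smooth.

(** * Tangent lines of |x|^r *)

Section tangent.
Context {R : realType}.
Implicit Types (x y r a b : R).

(** Young's inequality for [a] and b^(r-1), with the conjugate exponents [r] and [r / (r - 1)]. *)
Lemma powR_tangent a b r : 0 <= a -> 0 <= b -> 1 <= r ->
  b `^ r + r * b `^ (r - 1) * (a - b) <= a `^ r.
Proof.
move=> a0 b0; rewrite le_eqVlt => /predU1P[<-|r1].
  by rewrite subrr powRr0 !powRr1// mul1r mul1r subrKC.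
have r0 : 0 < r := lt_trans ltr01 r1.
have r10 : 0 < r - 1 by rewrite subr_gt0.
have q0 : 0 < r / (r - 1) by rewrite divr_gt0.
have bb : b `^ r = b `^ (r - 1) * b by rewrite mulrC mulr_powRB1.
have := @conjugate_powR R a (b `^ (r - 1)) r (r / (r - 1)) a0 (powR_ge0 _ _) r0 q0.
rewrite -powRrM (_ : (r - 1) * (r / (r - 1)) = r); last by field; rewrite gt_eqF.
have -> : r^-1 + (r / (r - 1))^-1 = 1 by field; rewrite !gt_eqF.
move=> /(_ erefl).
have -> : a `^ r / r + b `^ r / (r / (r - 1)) = (a `^ r + b `^ r * (r - 1)) / r.
  by field; rewrite !gt_eqF.
rewrite ler_pdivlMr// bb; lra.
Qed.

(** A subgradient of |y|^r. For r = 1 its value at 0 is 1, because 0 to the power 0 is 1. *)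
Definition subgrad r y := (if 0 <= y then 1 else -1) * (r * `|y| `^ (r - 1)).

Lemma measurable_subgrad r : measurable_fun setT (subgrad r).
Proof.
apply: measurable_funM; last first.
  apply: measurable_funM => //.
  by apply: (measurableT_comp (measurable_powR (r - 1))).
by apply: measurable_fun_ifT => //; apply: measurable_fun_ler.
Qed.

Lemma norm_powR_tangent x y r : 1 <= r ->
  `|y| `^ r + subgrad r y * x <= `|y + x| `^ r.
Proof.
move=> r1; have r0 : 0 <= r := le_trans ler01 r1.
set e : R := if 0 <= y then 1 else -1.
have ey : e * y = `|y|.
  by rewrite /e; case: ger0P => y0; rewrite ?mul1r// mulN1r.
have e1 : `|e| = 1 by rewrite /e; case: ifP => _; rewrite ?normr1// normrN1.
have -> : subgrad r y * x = r * `|y| `^ (r - 1) * (`|y| + e * x - `|y|).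
  by rewrite /subgrad -/e; ring.
have [h|h] := leP 0 (`|y| + e * x).
  apply: (le_trans (powR_tangent h (normr_ge0 y) r1)).
  rewrite ge0_ler_powR ?nnegrE// -ey -mulrDr.
  by rewrite (le_trans (ler_norm _))// normrM e1 mul1r.
(* Where |y| + e x is negative, the tangent at |y| lies below its value at 0, which is at most 0. *)
apply: (@le_trans _ _ 0); last exact: powR_ge0.
have := powR_tangent (lexx 0) (normr_ge0 y) r1; rewrite sub0r.
have p0 := powR_ge0 `|y| (r - 1).
have [->|yn] := eqVneq r 1; first by rewrite subrr powRr0 !powRr1//; lra.
rewrite powR0 ?gt_eqF ?(lt_le_trans ltr01)// => H.
apply: le_trans H; rewrite lerD2l ler_wpM2l ?mulr_ge0//.
by lra.
Qed.

Lemma subgrad_growth r y : 1 <= r -> `|subgrad r y| <= r * (1 + `|y|) `^ r.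
Proof.
move=> r1; have r0 : 0 <= r := le_trans ler01 r1.
rewrite /subgrad normrM; set e : R := if _ then _ else _.
have -> : `|e| = 1 by rewrite /e; case: ifP => _; rewrite ?normr1// normrN1.
rewrite mul1r ger0_norm ?mulr_ge0 ?powR_ge0// ler_wpM2l//.
apply: (@le_trans _ _ ((1 + `|y|) `^ (r - 1))).
  by rewrite ge0_ler_powR ?nnegrE ?subr_ge0 ?lerDr ?addr_ge0.
by rewrite ler_powR ?lerDl// gerDl.
Qed.

End tangent.

(** The multiple of Y^2 - 1 has mean zero; [c] is a Lagrange multiplier for the variance constraint
    and reduces comparisons of moments to pointwise inequalities. *)
Lemma Rintegral_le_unit_variance d (T : measurableType d) (R : realType)
  (P : probability T R) (Y Y1 Y2 : T -> R) (c : R) :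
  P.-integrable setT (EFin \o (fun w => Y w ^+ 2)) -> \int[P]_w (Y w ^+ 2) = 1 ->
  P.-integrable setT (EFin \o Y1) -> P.-integrable setT (EFin \o Y2) ->
  (forall w, Y1 w + c * (Y w ^+ 2 - 1) <= Y2 w) ->
  \int[P]_w Y1 w <= \int[P]_w Y2 w.
Proof.
move=> iY EY i1 i2 H.
have ic : P.-integrable setT (EFin \o (fun=> 1 : R)) := finite_measure_integrable_cst P 1 measurableT.
have iB : P.-integrable setT (EFin \o (fun w => Y w ^+ 2 - 1)).
  exact: integrableB iY ic.
have iZ : P.-integrable setT (EFin \o (fun w => c * (Y w ^+ 2 - 1))).
  exact: integrableZl iB.
have E0 : \int[P]_w (c * (Y w ^+ 2 - 1)) = 0.
  have E1 : \int[P]_w (1 : R) = 1.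
    by rewrite Rintegral_cst// mul1r -[X in fine X]/(P setT) probability_setT.
  by rewrite RintegralZl// RintegralB// EY E1 subrr mulr0.
rewrite -[leLHS]addr0 -E0 -RintegralD//.
apply: le_Rintegral => //; exact: integrableD i1 iZ.
Qed.

Lemma Rintegral_sum_seq d (T : measurableType d) (R : realType) (P : probability T R)
  (I : Type) (l : seq I) (F : I -> T -> R) :
  (forall i, P.-integrable setT (EFin \o F i)) ->
  P.-integrable setT (EFin \o (fun w => \sum_(i <- l) F i w)) /\
  \int[P]_w (\sum_(i <- l) F i w) = \sum_(i <- l) \int[P]_w F i w.
Proof.
move=> iF; elim: l => [|i l [IH1 IH2]].
  under eq_fun do rewrite big_nil; rewrite big_nil; split.
    exact: (finite_measure_integrable_cst P 0).
  by rewrite Rintegral_cst// mul0r.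
under eq_fun do rewrite big_cons; split; first exact: integrableD (iF i) IH1.
by rewrite RintegralD// IH2 big_cons.
Qed.

(** * Expansion around the sums that omit one summand *)

Section discrepancy.
Context d (T : measurableType d) (R : realType) (P : probability T R).
Context (n : nat) (X : 'I_n -> {mfun T >-> R}) (r : R).
Hypothesis n_gt0 : (0 < n)%N.
Hypothesis r1 : 1 <= r.
Hypothesis indepX : mutually_independent P (fun i => X i : T -> R).
Hypothesis EX : forall i, \int[P]_w X i w = 0.
Hypothesis EX2 : forall i, \int[P]_w (X i w ^+ 2) = 1.
Hypothesis momX : forall i, P.-integrable setT (EFin \o (fun w => `|X i w| `^ (r + 3))).

Let r0 : 0 <= r. Proof. exact: le_trans r1. Qed.
Let s : R := (Num.sqrt n%:R)^-1.

Let s_gt0 : 0 < s. Proof. by rewrite invr_gt0 sqrtr_gt0 ltr0n. Qed.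
Let s_le1 : s <= 1.
Proof. by rewrite invf_le1 ?sqrtr_gt0 ?ltr0n// -[leLHS]sqrtr1 ler_wsqrtr// ler1n. Qed.
Let s_sqr : n%:R * s ^+ 2 = 1.
Proof. by rewrite exprVn sqr_sqrtr ?ler0n// divff// pnatr_eq0 -lt0n. Qed.

Let M w := \sum_i `|X i w|.
Let M0 w : 0 <= M w. Proof. by apply: sumr_ge0. Qed.
Let M1 w : 1 <= 1 + M w. Proof. by rewrite lerDl. Qed.
Let M10 w : 0 <= 1 + M w. Proof. exact: le_trans (M1 w). Qed.

Lemma integrable_powR_sum (I : Type) (l : seq I) (F : I -> T -> R) (q : R) : 1 <= q ->
  (forall i, measurable_fun setT (F i)) -> (forall i w, 0 <= F i w) ->
  (forall i, P.-integrable setT (EFin \o (fun w => F i w `^ q))) ->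
  P.-integrable setT (EFin \o (fun w => (\sum_(i <- l) F i w) `^ q)).
Proof.
move=> q1 mF F0 iF; have q0 : 0 < q := lt_le_trans ltr01 q1.
elim: l => [|i l IH].
  under eq_fun do rewrite big_nil powR0 ?gt_eqF//.
  exact: (finite_measure_integrable_cst P 0).
have i1 := integrableZl measurableT (2 `^ (q - 1)) (integrableD measurableT (iF i) IH).
apply: integrable_dominated i1 _ => //.
  apply: (measurableT_comp (measurable_powR q)).
  by apply: measurable_sum.
move=> w _ /=; rewrite ger0_norm ?powR_ge0// big_cons.
by apply: ler_powD => //; exact: sumr_ge0.
Qed.

Let D_integrable : P.-integrable setT (EFin \o (fun w => (1 + M w) `^ (r + 3))).
Proof.
have q1 : 1 <= r + 3 by rewrite (le_trans r1)// lerDl.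
pose F (o : option 'I_n) w := if o is Some i then `|X i w| else 1.
have := @integrable_powR_sum _ (None :: [seq Some i | i <- enum 'I_n]) F _ q1.
have E w : \sum_(i <- None :: [seq Some i | i <- enum 'I_n]) F i w = 1 + M w.
  by rewrite big_cons big_map big_enum.
under eq_fun do rewrite E.
apply.
- by move=> [i|] /=; [exact: measurableT_comp|exact: measurable_cst].
- by move=> [i|] w /=.
- move=> [i|] /=; first exact: momX.
  exact: (finite_measure_integrable_cst P (1 `^ (r + 3))).
Qed.

(** All integrands of the section are dominated by powers of one envelope [1 + M]. Exponents add
    under products, and an exponent of at most [r + 3] gives integrability. *)
Definition poly_bounded (k : R) (Y : T -> R) := measurable_fun setT Y /\
  exists2 C, 0 <= C & forall w, `|Y w| <= C * (1 + M w) `^ k.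

Lemma pb_integrable k Y : poly_bounded k Y -> k <= r + 3 ->
  P.-integrable setT (EFin \o Y).
Proof.
move=> [mY [C C0 YC]] kq.
have := integrableZl measurableT C D_integrable.
move=> iC; apply: integrable_dominated iC _ => // w _ /=.
by apply: (le_trans (YC w)); rewrite ler_wpM2l// ler_powR.
Qed.

Lemma pb_mul k1 k2 Y1 Y2 : poly_bounded k1 Y1 -> poly_bounded k2 Y2 ->
  poly_bounded (k1 + k2) (fun w => Y1 w * Y2 w).
Proof.
move=> [m1 [C1 C10 H1]] [m2 [C2 C20 H2]]; split; first exact: measurable_funM.
exists (C1 * C2); first exact: mulr_ge0.
move=> w; have Mn0 : 1 + M w != 0 by rewrite gt_eqF// (lt_le_trans ltr01).
by rewrite normrM powRD ?Mn0 ?implybT// mulrACA ler_pM.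
Qed.

Lemma pb_weaken k1 k2 Y : poly_bounded k1 Y -> k1 <= k2 -> poly_bounded k2 Y.
Proof.
move=> [mY [C C0 YC]] kk; split => //; exists C => // w.
by apply: (le_trans (YC w)); rewrite ler_wpM2l// ler_powR.
Qed.

Lemma pb_add k Y1 Y2 : poly_bounded k Y1 -> poly_bounded k Y2 ->
  poly_bounded k (fun w => Y1 w + Y2 w).
Proof.
move=> [m1 [C1 C10 H1]] [m2 [C2 C20 H2]]; split; first exact: measurable_funD.
exists (C1 + C2); first exact: addr_ge0.
by move=> w; rewrite (le_trans (ler_normD _ _))// mulrDl lerD.
Qed.

Lemma pb_scale k c Y : poly_bounded k Y -> poly_bounded k (fun w => c * Y w).
Proof.
move=> [mY [C C0 YC]]; split; first exact: measurable_funM.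
exists (`|c| * C); first exact: mulr_ge0.
by move=> w; rewrite normrM -mulrA ler_wpM2l.
Qed.

Lemma pb_cst c : poly_bounded 0 (fun=> c).
Proof.
split => //; exists `|c| => // w.
by rewrite powRr0 mulr1.
Qed.

Lemma pb_comp k (f : R -> R) C (Y : T -> R) : 0 <= k -> 0 <= C -> measurable_fun setT f ->
  (forall z, `|f z| <= C * (1 + `|z|) `^ k) ->
  measurable_fun setT Y -> (forall w, `|Y w| <= M w) -> poly_bounded k (fun w => f (Y w)).
Proof.
move=> k0 C0 mf fC mY YM; split; first exact: measurableT_comp.
exists C => // w; apply: (le_trans (fC _)); rewrite ler_wpM2l//.
by rewrite ge0_ler_powR ?nnegrE ?addr_ge0// lerD2l.
Qed.

Let V i := rv_sum X (rem i (enum 'I_n)).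
Let W w := s * \sum_i X i w.

Let WE i w : W w = s * V i w + s * X i w.
Proof.
rewrite /W -mulrDr /V /rv_sum; congr (_ * _).
by rewrite -big_enum (big_rem i) ?mem_enum//= addrC.
Qed.

Let norm_X i w : `|X i w| <= M w.
Proof. by rewrite /M (bigD1 i)//= lerDl sumr_ge0. Qed.

Let norm_V i w : `|V i w| <= M w.
Proof.
rewrite /V /rv_sum (le_trans (ler_norm_sum _ _ _))// /M -big_enum.
by rewrite [leRHS](big_rem i) ?mem_enum//= lerDr.
Qed.

Let norm_sM Y w : `|Y| <= M w -> `|s * Y| <= M w.
Proof.
move=> h; apply: le_trans h; rewrite normrM (gtr0_norm s_gt0).
by rewrite ler_piMl.
Qed.

Let norm_W w : `|W w| <= M w.
Proof. by apply: norm_sM; rewrite /M ler_norm_sum. Qed.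

Let mV i : measurable_fun setT (V i).
Proof. by rewrite /V /rv_sum; apply: measurable_sum. Qed.

Let mW : measurable_fun setT W.
Proof. by apply: measurable_funM => //; exact: measurable_sum. Qed.

Let indepV i : independent2 P (X i) (rv_sum X (rem i (enum 'I_n))).
Proof.
apply: independent2_rv_sum => //; first exact/rem_uniq/enum_uniq.
by rewrite mem_rem_uniq ?enum_uniq// inE eqxx.
Qed.

Let pbX i : poly_bounded 1 (X i).
Proof. by split => //; exists 1 => // w; rewrite powRr1// mul1r (le_trans (norm_X i w))// lerDr. Qed.

Let pb_norm k Y : poly_bounded k Y -> poly_bounded k (fun w => `|Y w|).
Proof.
move=> [mY [C C0 H]]; split; first exact: measurableT_comp.
by exists C => // w; rewrite normr_id.
Qed.

Let pb_powX i p : 0 <= p -> poly_bounded p (fun w => `|X i w| `^ p).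
Proof.
move=> p0; apply: (@pb_comp p (fun x => `|x| `^ p) 1 (X i)) => //.
- by apply: (measurableT_comp (measurable_powR p)).
- move=> z; rewrite mul1r ger0_norm ?powR_ge0// ge0_ler_powR ?nnegrE ?addr_ge0//.
  by rewrite lerDr.
Qed.

Let pb_powW (Y : T -> R) : measurable_fun setT Y -> (forall w, `|Y w| <= M w) ->
  poly_bounded r (fun w => `|Y w| `^ r).
Proof.
move=> mY YM; apply: (@pb_comp r (fun x => `|x| `^ r) 1 Y) => //.
- by apply: (measurableT_comp (measurable_powR r)).
- move=> z; rewrite mul1r ger0_norm ?powR_ge0// ge0_ler_powR ?nnegrE ?addr_ge0//.
  by rewrite lerDr.
Qed.

Let msV i : measurable_fun setT (fun w => s * V i w).
Proof. by apply: measurable_funM => //; exact: mV. Qed.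

Let Ex (Y : T -> R) : R := \int[P]_w Y w.

(* Jensen's inequality conditionally on [V i]; the linear term of the tangent has mean zero
   by independence. *)
Lemma moment_W_ge i : Ex (fun w => `|s * V i w| `^ r) <= Ex (fun w => `|W w| `^ r).
Proof.
have pbV : poly_bounded r (fun w => `|s * V i w| `^ r).
  by apply: pb_powW => // w; apply: norm_sM; exact: norm_V.
have pbG : poly_bounded r (fun w => subgrad r (s * V i w)).
  apply: (@pb_comp r (subgrad r) r) => //; first exact: measurable_subgrad.
    by move=> z; exact: subgrad_growth.
  by move=> w; apply: norm_sM; exact: norm_V.
have pbsX : poly_bounded 1 (fun w => s * X i w) := pb_scale s (pbX i).
have rq : r <= r + 3 by rewrite lerDl.
have r1q : 1 + r <= r + 3 by lra.
have h1q : 1 <= r + 3 by have := r1; lra.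
have [ip E] := @independent2_expectation _ _ _ P (X i) _ (fun x => s * x)
  (fun v => subgrad r (s * v)) (indepV i)
  (measurable_funM (measurable_cst s) (@measurable_id _ _ setT))
  (measurableT_comp (measurable_subgrad r)
    (measurable_funM (measurable_cst s) (@measurable_id _ _ setT)))
  (pb_integrable pbsX h1q) (pb_integrable pbG rq).
have E0 : Ex (fun w => s * X i w * subgrad r (s * V i w)) = 0.
  rewrite /Ex E RintegralZl//; last exact: pb_integrable (pbX i) h1q.
  by rewrite EX mulr0 mul0r.
rewrite -[leLHS]addr0 -E0 /Ex -RintegralD//; last exact: pb_integrable pbV rq.
apply: le_Rintegral => //.
- exact: integrableD (pb_integrable pbV rq) ip.
- by apply: pb_integrable rq; apply: pb_powW.
move=> w _; rewrite (WE i w) mulrC [s * X i w * _]mulrC.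
exact: norm_powR_tangent.
Qed.

Let pbX2 i : poly_bounded 2 (fun w => X i w ^+ 2).
Proof. exact: pb_mul (pbX i) (pbX i). Qed.

Let pb_nX i k : poly_bounded k%:R (fun w => `|X i w| ^+ k).
Proof.
elim: k => [|k IH]; first by under eq_fun do rewrite expr0; exact: pb_cst.
under eq_fun do rewrite exprS.
by rewrite -natr1 addrC; exact: pb_mul (pb_norm (pbX i)) IH.
Qed.

Let iX2 i : P.-integrable setT (EFin \o (fun w => X i w ^+ 2)).
Proof. by apply: pb_integrable (pbX2 i) _; have := r1; lra. Qed.

Lemma norm_moment_le i : Ex (fun w => `|X i w|) <= Ex (fun w => `|X i w| ^+ 3).
Proof.
apply: (Rintegral_le_unit_variance (c := 1) (iX2 i) (EX2 i)).
- by apply: pb_integrable (pb_norm (pbX i)) _; have := r1; lra.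
- by apply: pb_integrable (pb_nX i 3) _; have := r1; lra.
move=> w; rewrite -(real_normK (num_real (X i w))); have := normr_ge0 (X i w).
set x := `|_| => x0; rewrite -subr_ge0.
have -> : x ^+ 3 - (x + 1 * (x ^+ 2 - 1)) = (x - 1) ^+ 2 * (x + 1) by ring.
by rewrite mulr_ge0 ?sqr_ge0 ?addr_ge0.
Qed.

(** x^(r+3) - x^(r+1) - (x^2 - 1) is (x^2 - 1)(x^(r+1) - 1), and for x >= 0 these factors have the
    same sign. With [norm_moment_le], this lets the increments of [p] be estimated by the same
    moments as the Taylor remainder. *)
Lemma norm_powR_moment_le i : Ex (fun w => `|X i w| * `|X i w| `^ r) <=
  Ex (fun w => `|X i w| ^+ 3 * `|X i w| `^ r).
Proof.
apply: (Rintegral_le_unit_variance (c := 1) (iX2 i) (EX2 i)).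
- by apply: pb_integrable (pb_mul (pb_norm (pbX i)) (pb_powX i r0)) _; have := r1; lra.
- by apply: pb_integrable (pb_mul (pb_nX i 3) (pb_powX i r0)) _; have := r1; lra.
move=> w; rewrite -(real_normK (num_real (X i w))); have := normr_ge0 (X i w).
set x := `|_| => x0; rewrite -subr_ge0.
have -> : x ^+ 3 * x `^ r - (x * x `^ r + 1 * (x ^+ 2 - 1)) =
  (x - 1) * (x * x `^ r - 1) * (x + 1) by ring.
rewrite mulr_ge0 ?addr_ge0//.
have [x1|x1] := leP 1 x.
  rewrite mulr_ge0 ?subr_ge0// mulr_ege1// -[leLHS](powRr0 x) ler_powR//.
rewrite mulr_le0 ?subr_le0 ?(ltW x1)// mulr_ile1 ?powR_ge0 ?(ltW x1)//.
have [->|xn0] := eqVneq x 0; first by rewrite powR0 ?gt_eqF// (lt_le_trans ltr01).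
by rewrite -[leRHS](powRr0 x) ger_powR// lt_neqAle eq_sym xn0 x0 ltW.
Qed.

Context (psi p H : R -> R) (a b e0 : R).
Hypotheses (a0 : 0 <= a) (b0 : 0 <= b).
Hypothesis dpsi : forall z : R, is_derive z 1 psi (p z).
Hypothesis cp : continuous p.
Hypothesis plip : forall m x y, `|x| <= m -> `|y| <= m ->
  `|p x - p y| <= `|x - y| * (a + b * m `^ r).
Hypothesis steinE : forall w, p w - w * psi w = H w - e0.

Let b' := b * 2 `^ (r - 1).
Let b'0 : 0 <= b'. Proof. by rewrite mulr_ge0// powR_ge0. Qed.
(** A majorant of the Lipschitz constant between [W w] and [s * V i w], split by convexity (whence
    the 2^(r-1) in [b']) into one part depending on [V i] and one depending on [X i], so that
    independence applies. *)
Let nu i w := a + b' * `|s * V i w| `^ r + b' * `|s * X i w| `^ r.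

Let nu_ge i w : a + b * (`|s * V i w| + `|s * X i w|) `^ r <= nu i w.
Proof.
rewrite /nu -addrA lerD2l /b' -mulrDr -mulrA ler_wpM2l//.
exact: ler_powD.
Qed.

Let pb_nu i : poly_bounded r (nu i).
Proof.
apply: pb_add; first apply: pb_add.
- by apply: pb_weaken (pb_cst a) r0.
- apply: pb_scale; apply: pb_powW => [|w]; first exact: msV.
  by apply: norm_sM; exact: norm_V.
- apply: pb_scale; apply: pb_powW => [|w]; first exact: measurable_funM.
  by apply: norm_sM; exact: norm_X.
Qed.

Let rem_i i w := s * X i w * (psi (W w) - psi (s * V i w) - s * X i w * p (s * V i w)).

Let rem_bound i w : `|rem_i i w| <= s ^+ 3 / 2 * (`|X i w| ^+ 3 * nu i w).
Proof.
have := taylor_psi a0 b0 dpsi plip (s * V i w) (s * X i w); rewrite -WE => h.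
rewrite /rem_i normrM.
apply: (@le_trans _ _ (`|s * X i w| * ((s * X i w) ^+ 2 / 2 * nu i w))).
  rewrite ler_wpM2l//; apply: (le_trans h).
  by rewrite ler_wpM2l ?divr_ge0 ?sqr_ge0.
rewrite le_eqVlt; apply/orP; left; apply/eqP.
rewrite -(real_normK (num_real (s * X i w))) normrM (gtr0_norm s_gt0).
by field.
Qed.

Let diff_bound i w : `|p (W w) - p (s * V i w)| <= s * (`|X i w| * nu i w).
Proof.
have h1 : `|W w| <= `|s * V i w| + `|s * X i w| by rewrite (WE i w) ler_normD.
have h2 : `|s * V i w| <= `|s * V i w| + `|s * X i w| by rewrite lerDl.
apply: (le_trans (plip h1 h2)).
have -> : `|W w - s * V i w| = s * `|X i w|.
  by rewrite (WE i w) addrAC subrr add0r normrM gtr0_norm.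
by rewrite -mulrA (ler_wpM2l (ltW s_gt0))// ler_wpM2l// nu_ge.
Qed.

Let pb_p (Y : T -> R) : measurable_fun setT Y -> (forall w, `|Y w| <= M w) ->
  poly_bounded (r + 1) (fun w => p (Y w)).
Proof.
move=> mY YM; have [C C0 pC] := p_growth a0 b0 r1 plip.
by apply: (@pb_comp _ p C Y) => //; [rewrite addr_ge0|exact: continuous_measurable_fun].
Qed.

Let pb_psi (Y : T -> R) : measurable_fun setT Y -> (forall w, `|Y w| <= M w) ->
  poly_bounded (r + 2) (fun w => psi (Y w)).
Proof.
move=> mY YM; have [C C0 pC] := psi_growth a0 b0 r1 dpsi plip.
apply: (@pb_comp _ psi C Y) => //; first by rewrite addr_ge0.
by apply: continuous_measurable_fun; exact: psi_continuous dpsi.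
Qed.

Let x3 i := Ex (fun w => `|X i w| ^+ 3).
Let x3r i := Ex (fun w => `|X i w| ^+ 3 * `|X i w| `^ r).
Let Omega := Ex (fun w => `|W w| `^ r).

Let x3_ge0 i : 0 <= x3 i.
Proof. by apply: Rintegral_ge0 => w _; rewrite exprn_ge0. Qed.

(** Independence factors the term with [V i]; [moment_W_ge] then replaces its moment by that of [W],
    which is the same for all [i]. *)
Let Ex_nu i k : (k <= 3)%N ->
  Ex (fun w => `|X i w| ^+ k * nu i w) <=
  Ex (fun w => `|X i w| ^+ k) * (a + b' * Omega) +
  b' * s `^ r * Ex (fun w => `|X i w| ^+ k * `|X i w| `^ r).
Proof.
move=> k3; have kr : k%:R <= (3 : R) by rewrite ler_nat.
have pbV : poly_bounded r (fun w => `|s * V i w| `^ r).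
  by apply: pb_powW => // w; apply: norm_sM; exact: norm_V.
have ik : P.-integrable setT (EFin \o (fun w => `|X i w| ^+ k)).
  by apply: pb_integrable (pb_nX i k) _; have := r0; lra.
have iV : P.-integrable setT (EFin \o (fun w => `|s * V i w| `^ r)).
  by apply: pb_integrable pbV _; lra.
have ikr : P.-integrable setT (EFin \o (fun w => `|X i w| ^+ k * `|X i w| `^ r)).
  by apply: pb_integrable (pb_mul (pb_nX i k) (pb_powX i r0)) _; lra.
have [ikV E] := @independent2_expectation _ _ _ P (X i) _ (fun x => `|x| ^+ k)
  (fun v => `|s * v| `^ r) (indepV i) (measurable_funX k (@normr_measurable R setT))
  (measurableT_comp (measurable_powR r) (measurableT_comp (@normr_measurable R setT)
    (measurable_funM (measurable_cst s) (@measurable_id _ _ setT)))) ik iV.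
have -> : Ex (fun w => `|X i w| ^+ k * nu i w) =
  Ex (fun w => a * `|X i w| ^+ k + b' * (`|X i w| ^+ k * `|s * V i w| `^ r) +
     b' * s `^ r * (`|X i w| ^+ k * `|X i w| `^ r)).
  apply: eq_Rintegral => w _; rewrite /nu.
  have -> : `|s * X i w| `^ r = s `^ r * `|X i w| `^ r.
    by rewrite normrM (gtr0_norm s_gt0) powRM// ltW.
  by ring.
have i1 := integrableZl measurableT a ik.
have i2 := integrableZl measurableT b' ikV.
have i3 := integrableZl measurableT (b' * s `^ r) ikr.
have i12 := integrableD measurableT i1 i2.
rewrite /Ex RintegralD// RintegralD// !RintegralZl// E -/(Ex _).
rewrite lerD2r mulrDr [_ * a]mulrC lerD2l mulrCA.
apply: ler_wpM2l; first by apply: Rintegral_ge0 => w _; rewrite exprn_ge0.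
by apply: ler_wpM2l => //; exact: moment_W_ge.
Qed.

(** The factor 3/2 is 1 + 1/2: the increment of [p] contributes s^2 times s, the Taylor remainder
    s^3 / 2. *)
Let summand_bound i :
  `|s ^+ 2 * Ex (fun w => p (W w) - p (s * V i w)) - Ex (rem_i i)| <=
  s ^+ 3 * (3 / 2) * (x3 i * (a + b' * Omega) + b' * s `^ r * x3r i).
Proof.
have msi := msV i; have nsi w := norm_sM (norm_V i w).
have iW : P.-integrable setT (EFin \o (fun w => p (W w))).
  by apply: pb_integrable (pb_p mW norm_W) _; lra.
have iVi : P.-integrable setT (EFin \o (fun w => p (s * V i w))).
  by apply: pb_integrable (pb_p msi nsi) _; lra.
have pbr : poly_bounded (1 + (r + 2)) (rem_i i).
  have pbsX : poly_bounded 1 (fun w => s * X i w) := pb_scale s (pbX i).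
  apply: pb_mul => //; apply: pb_add; first apply: pb_add.
  - exact: pb_psi.
  - under eq_fun do rewrite -mulN1r.
    by apply: pb_scale; exact: pb_psi.
  - under eq_fun do rewrite -mulN1r.
    apply: pb_scale; rewrite (_ : r + 2 = 1 + (r + 1)); last by ring.
    by apply: pb_mul => //; exact: pb_p.
have ir : P.-integrable setT (EFin \o rem_i i) by apply: pb_integrable pbr _; lra.
have in1 : P.-integrable setT (EFin \o (fun w => `|X i w| ^+ 1 * nu i w)).
  by apply: pb_integrable (pb_mul (pb_nX i 1) (pb_nu i)) _; lra.
have in3 : P.-integrable setT (EFin \o (fun w => `|X i w| ^+ 3 * nu i w)).
  by apply: pb_integrable (pb_mul (pb_nX i 3) (pb_nu i)) _; lra.
have ipp := integrableB measurableT iW iVi.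
have s30 : 0 <= s ^+ 3 / 2 by rewrite divr_ge0// exprn_ge0 ?(ltW s_gt0).
have B1 : `|Ex (fun w => p (W w) - p (s * V i w))| <= s * Ex (fun w => `|X i w| ^+ 1 * nu i w).
  rewrite /Ex -RintegralZl//; apply: (le_trans (le_normr_Rintegral measurableT ipp)).
  by apply: le_Rintegral => //; [exact: integrable_abse ipp|exact: integrableZl in1].
have B2 : `|Ex (rem_i i)| <= s ^+ 3 / 2 * Ex (fun w => `|X i w| ^+ 3 * nu i w).
  rewrite /Ex -RintegralZl//; apply: (le_trans (le_normr_Rintegral measurableT ir)).
  by apply: le_Rintegral => //; [exact: integrable_abse ir|exact: integrableZl in3].
have {}B1 := le_trans B1 (ler_wpM2l (ltW s_gt0) (@Ex_nu i 1 isT)).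
have {}B2 := le_trans B2 (ler_wpM2l s30 (@Ex_nu i 3 (leqnn 3))).
have m1 := norm_moment_le i; have mr := norm_powR_moment_le i.
have aO : 0 <= a + b' * Omega.
  by rewrite addr_ge0// mulr_ge0//; apply: Rintegral_ge0 => w _; exact: powR_ge0.
have bs : 0 <= b' * s `^ r by rewrite mulr_ge0// powR_ge0.
have h1 : Ex (fun w => `|X i w| ^+ 1) * (a + b' * Omega) <= x3 i * (a + b' * Omega).
  by rewrite ler_wpM2r.
have h2 : b' * s `^ r * Ex (fun w => `|X i w| ^+ 1 * `|X i w| `^ r) <= b' * s `^ r * x3r i.
  by rewrite ler_wpM2l.
set Q := _ + b' * s `^ r * x3r i in B2 *.
have {}B1 : `|Ex (fun w => p (W w) - p (s * V i w))| <= s * Q.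
  by apply: (le_trans B1); rewrite ler_wpM2l ?(ltW s_gt0)// lerD.
apply: (le_trans (ler_normB _ _)); rewrite normrM (@ger0_norm _ (s ^+ 2)) ?sqr_ge0//.
have := ler_wpM2l (sqr_ge0 s) B1; move: B2; lra.
Qed.

Theorem stein_discrepancy :
  P.-integrable setT (EFin \o (fun w => H (W w))) /\
  `|Ex (fun w => H (W w)) - e0| <=
    \sum_i s ^+ 3 * (3 / 2) * (x3 i * (a + b' * Omega) + b' * s `^ r * x3r i).
Proof.
have pW := pb_p mW norm_W; have psiW := pb_psi mW norm_W.
have iW : P.-integrable setT (EFin \o (fun w => p (W w))).
  by apply: pb_integrable pW _; lra.
have pbW1 : poly_bounded 1 W.
  split; first exact: mW.
  by exists 1 => // w; rewrite powRr1// mul1r (le_trans (norm_W w))// lerDr.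
have iWpsi : P.-integrable setT (EFin \o (fun w => W w * psi (W w))).
  by apply: pb_integrable (pb_mul pbW1 psiW) _; lra.
have HE w : H (W w) = p (W w) - W w * psi (W w) + e0 by rewrite steinE subrK.
have ic : P.-integrable setT (EFin \o (fun=> e0)) := finite_measure_integrable_cst P e0 measurableT.
have iB := integrableB measurableT iW iWpsi.
have iH : P.-integrable setT (EFin \o (fun w => H (W w))).
  by under eq_fun do rewrite HE; exact: integrableD iB ic.
split; first exact: iH.
have E1 : Ex (fun w => H (W w)) - e0 = Ex (fun w => p (W w)) - Ex (fun w => W w * psi (W w)).
  have -> : Ex (fun w => H (W w)) = Ex (fun w => p (W w) - W w * psi (W w) + e0).
    by apply: eq_Rintegral => w _; exact: HE.
  rewrite /Ex RintegralD// RintegralB//.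
  have -> : \int[P]_w e0 = e0.
    by rewrite Rintegral_cst// -[X in fine X]/(P setT) probability_setT mulr1.
  by rewrite addrK.
have pbsX i : poly_bounded 1 (fun w => s * X i w) := pb_scale s (pbX i).
have E2 : Ex (fun w => W w * psi (W w)) = \sum_i Ex (fun w => s * X i w * psi (W w)).
  have -> : Ex (fun w => W w * psi (W w)) = Ex (fun w => \sum_i s * X i w * psi (W w)).
    by apply: eq_Rintegral => w _; rewrite -mulr_suml -mulr_sumr.
  apply: (proj2 (Rintegral_sum_seq _ _)) => i.
  by apply: pb_integrable (pb_mul (pbsX i) psiW) _; lra.
(* In the expansion at [s * V i w] the term of order zero vanishes by independence and mean zero,
   and the term of order one factors with E X_i^2 = 1. *)
have E3 i : Ex (fun w => s * X i w * psi (W w)) =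
   Ex (rem_i i) + s ^+ 2 * Ex (fun w => p (s * V i w)).
  have msi := msV i; have nsi w := norm_sM (norm_V i w).
  have pVi := pb_p msi nsi; have psiVi := pb_psi msi nsi.
  have iX : P.-integrable setT (EFin \o (fun w => s * X i w)).
    by apply: pb_integrable (pbsX i) _; have := r0; lra.
  have ms : measurable_fun setT (fun v : R => s * v).
    exact: measurable_funM (measurable_cst s) (@measurable_id _ _ setT).
  have cpsi : continuous psi := psi_continuous dpsi.
  have ipV : P.-integrable setT (EFin \o (fun w => p (s * V i w))).
    by apply: pb_integrable pVi _; lra.
  have ipsV : P.-integrable setT (EFin \o (fun w => psi (s * V i w))).
    by apply: pb_integrable psiVi _; lra.
  have [i1 F1] := @independent2_expectation _ _ _ P (X i) _ (fun x => s * x)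
    (fun v => psi (s * v)) (indepV i) ms
    (measurableT_comp (continuous_measurable_fun cpsi) ms) iX ipsV.
  have [i2 F2] := @independent2_expectation _ _ _ P (X i) _ (fun x => x ^+ 2)
    (fun v => p (s * v)) (indepV i) (measurable_funX 2 (@measurable_id _ _ setT))
    (measurableT_comp (continuous_measurable_fun cp) ms) (iX2 i) ipV.
  have ir : P.-integrable setT (EFin \o rem_i i).
    have j1 : P.-integrable setT (EFin \o (fun w => s * X i w * psi (W w))).
      by apply: pb_integrable (pb_mul (pbsX i) psiW) _; lra.
    have j2 := integrableZl measurableT (s ^+ 2) i2.
    apply: eq_integrable (integrableB measurableT (integrableB measurableT j1 i1) j2) => //.
    by move=> w _; rewrite /= -?EFinM -?EFinB; congr EFin; rewrite /rem_i; ring.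
  have -> : Ex (fun w => s * X i w * psi (W w)) =
     Ex (fun w => rem_i i w + (s * X i w * psi (s * V i w) +
        s ^+ 2 * (X i w ^+ 2 * p (s * V i w)))).
    by apply: eq_Rintegral => w _; rewrite /rem_i; ring.
  have i2s := integrableZl measurableT (s ^+ 2) i2.
  have i12 := integrableD measurableT i1 i2s.
  have {}F1 : Ex (fun w => s * X i w * psi (s * V i w)) =
    Ex (fun w => s * X i w) * Ex (fun w => psi (s * V i w)) := F1.
  have {}F2 : Ex (fun w => X i w ^+ 2 * p (s * V i w)) =
    Ex (fun w => X i w ^+ 2) * Ex (fun w => p (s * V i w)) := F2.
  rewrite {1}/Ex RintegralD// RintegralD// RintegralZl// -!/(Ex _) F1 F2.
  rewrite (EX2 i : Ex (fun w => X i w ^+ 2) = 1) {1 2}/Ex.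
  have iX1 : P.-integrable setT (EFin \o X i).
    by apply: pb_integrable (pbX i) _; have := r0; lra.
  by rewrite RintegralZl// EX mulr0 mul0r add0r mul1r.
(* Since n s^2 = 1, the mean of [p (W w)] is spread evenly over the summands, each to be paired with
   its term at [s * V i w]. *)
have E4 : Ex (fun w => p (W w)) = \sum_(i < n) s ^+ 2 * Ex (fun w => p (W w)).
  by rewrite sumr_const card_ord -mulrnAl -mulr_natl s_sqr mul1r.
rewrite E1 E2 [X in X - _]E4 -sumrB; apply: (le_trans (ler_norm_sum _ _ _)).
apply: ler_sum => i _; rewrite E3.
have msi := msV i; have nsi w := norm_sM (norm_V i w).
have iVi : P.-integrable setT (EFin \o (fun w => p (s * V i w))).
  by apply: pb_integrable (pb_p msi nsi) _; lra.
rewrite -[leLHS]/(`|_|) (_ : _ - _ = s ^+ 2 * Ex (fun w => p (W w) - p (s * V i w)) - Ex (rem_i i)).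
  exact: summand_bound.
by rewrite /Ex RintegralB//; ring.
Qed.

End discrepancy.

(** * Moments and constants *)

Section gaussian_link.
Context d (T : measurableType d) (R : realType) (Q : probability T R) (Z : {RV Q >-> R}).
Hypothesis Z_normal : standard_normal Z.
Notation mu := (@lebesgue_measure R).
Notation gam := (@gam R).

(** The Radon-Nikodym derivative of [normal_prob 0 1] and [gam] have the same integral over every
    measurable set, so they agree almost everywhere. *)
Lemma ge0_normal_integral (f : R -> \bar R) : measurable_fun setT f -> (forall x, 0 <= f x)%E ->
  (\int[normal_prob 0 1]_x f x = \int[mu]_x (f x * (gam x)%:E))%E.
Proof.
move=> mf f0.
have dom := @normal_prob_dominates R 0 1.
have E := Radon_Nikodym_SigmaFinite.change_of_variables dom f0 measurableT mf.
rewrite -E; apply: ae_eq_integral => //.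
- apply: emeasurable_funM => //; exact: measurable_int (Radon_Nikodym_SigmaFinite.f_integrable dom).
- by apply: emeasurable_funM => //; apply/measurable_EFinP; exact: gam_measurable.
suff H : ae_eq mu setT (Radon_Nikodym_SigmaFinite.f (normal_prob 0 1 : probability _ R) mu) (EFin \o gam) by apply: filterS H => x H y; rewrite H.
apply: integral_ae_eq => //.
- exact: Radon_Nikodym_SigmaFinite.f_integrable.
- by apply/measurable_EFinP; exact: gam_measurable.
move=> A _ mA; rewrite -Radon_Nikodym_SigmaFinite.f_integral//.
Qed.

Lemma ge0_integral_normalZ (k : R -> \bar R) : measurable_fun setT k -> (forall x, 0 <= k x)%E ->
  (\int[Q]_w k (Z w) = \int[mu]_x (k x * (gam x)%:E))%E.
Proof.
move=> mk k0; rewrite -ge0_normal_integral//.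
have mZ : measurable_fun setT (Z : T -> measurableTypeR R) by move=> _ Y mY; exact: (measurable_funPT Z measurableT).
rewrite -[LHS](@ge0_integral_pushforward _ _ _ (measurableTypeR R) _ Z mZ Q setT k)//.
by symmetry; apply: eq_measure_integral => A mA _; symmetry; exact: Z_normal.
Qed.

Lemma integrable_normalZ (k : R -> R) : measurable_fun setT k -> gint k ->
  Q.-integrable setT (EFin \o (k \o Z)).
Proof.
move=> mk /integrableP[mi ik]; apply/integrableP; split.
  by apply/measurable_EFinP; apply: measurableT_comp.
have -> : (\int[Q]_x `|(EFin \o (k \o Z)) x| = \int[mu]_x (`|k x|%:E * (gam x)%:E))%E.
  apply: (@ge0_integral_normalZ (fun t => `|k t|%:E)) => //.
  by apply/measurable_EFinP; exact: measurableT_comp.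
apply: le_lt_trans ik; rewrite le_eqVlt; apply/orP; left; apply/eqP.
by apply: eq_integral => x _ /=; rewrite normrM (ger0_norm (gam_ge0 _)) EFinM.
Qed.

Lemma Rintegral_normalZ (k : R -> R) : measurable_fun setT k -> gint k ->
  \int[Q]_w k (Z w) = gmean k.
Proof.
move=> mk ik; rewrite /gmean /Rintegral; congr fine.
rewrite integralE [RHS]integralE.
have h1 := @ge0_integral_normalZ (fun x => (EFin \o k)^\+ x)%E.
have h2 := @ge0_integral_normalZ (fun x => (EFin \o k)^\- x)%E.
have mEk : measurable_fun setT (EFin \o k) by apply/measurable_EFinP.
congr (_ - _)%E.
  transitivity (\int[mu]_x ((EFin \o k)^\+ x * (gam x)%:E))%E.
    by rewrite -h1//; [apply: eq_integral => x _; rewrite !funeposE|exact: measurable_funepos].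
  by apply: eq_integral => x _; rewrite !funeposE/= EFinM maxeMl ?lee_fin ?gam_ge0// mul0e.
transitivity (\int[mu]_x ((EFin \o k)^\- x * (gam x)%:E))%E.
  by rewrite -h2//; [apply: eq_integral => x _; rewrite !funenegE|exact: measurable_funeneg].
by apply: eq_integral => x _; rewrite !funenegE/= -!EFin_max -EFinM maxr_pMl ?gam_ge0// mulNr mul0r.
Qed.

End gaussian_link.

(** * An upper bound for pi *)

Section pi_bound.
Context {R : realType}.
Implicit Types (x z : R).

Lemma sin_le_id x : 0 <= x -> sin x <= x.
Proof.
move=> x0; have d z : is_derive z 1 (fun z => sin z - z) (cos z - 1).
  by apply: is_derive_eq.
have := @derive_le_lipschitz R _ _ x 0 0 x0 d; rewrite sin0 mulr0 !subr0 subr_le0.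
by apply=> z _ _; rewrite subr_le0 cos_le1.
Qed.

Lemma cos_ge_taylor x : 0 <= x -> 1 - x ^+ 2 / 2 <= cos x.
Proof.
move=> x0; have d z : is_derive z 1 (fun z => 1 - z ^+ 2 / 2 - cos z) (sin z - z).
  by apply: is_derive_eq; rewrite /GRing.scale/=; field.
have := @derive_le_lipschitz R _ _ x 0 0 x0 d.
rewrite cos0 expr0n/= mul0r subr0 subrr mulr0 subr0 subr_le0; apply=> z z0 _.
by rewrite subr_le0 sin_le_id.
Qed.

Lemma sin_ge_taylor x : 0 <= x -> x - x ^+ 3 / 6 <= sin x.
Proof.
move=> x0; have d z : is_derive z 1 (fun z => z - z ^+ 3 / 6 - sin z) (1 - z ^+ 2 / 2 - cos z).
  by apply: is_derive_eq; rewrite /GRing.scale/=; field.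
have := @derive_le_lipschitz R _ _ x 0 0 x0 d.
rewrite sin0 expr0n/= mul0r !subr0 mulr0 subr_le0; apply=> z z0 _.
by rewrite subr_le0 cos_ge_taylor.
Qed.

(** The value 32/9 is what sqrt(pi / 2) <= 4/3 amounts to. If pi were larger, the cosine of 16/9
    would be positive, whereas sin(8/9) >= 3/4 makes it at most 1 - 9/8. *)
Lemma pi_le : pi <= 32 / 9 :> R.
Proof.
have [//|h] := leP pi (32 / 9 : R).
have a0 : 0 <= 8 / 9 :> R by lra.
have := sin_ge_taylor a0.
move=> hs; have {}hs : 3 / 4 <= sin (8 / 9) :> R by lra.
have : 0 < cos ((8 / 9) *+ 2 : R).
  by apply: cos_gt0_pihalf; rewrite (mulr2n (8 / 9)); apply/andP; split; lra.
have hss : (3 / 4) * (3 / 4) <= sin (8 / 9) * sin (8 / 9) :> R by rewrite ler_pM//; lra.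
by rewrite cos_mulr2n cos2sin2 (mulr2n (1 - _)) expr2; lra.
Qed.

End pi_bound.

(** * Gaussian moments and the Mills ratio at 0 *)

Section gaussian_moments.
Context {R : realType}.
Notation gam := (@gam R).
Implicit Types (x p r : R).

Lemma gam0_ge : 3 / 8 <= gam 0.
Proof.
rewrite /gam normal_pdfE ?oner_neq0//= /normal_fun subrr expr0n/= oppr0 mul0r expR0 mulr1.
rewrite /normal_peak expr1n mul1r -[leLHS]invrK.
have p0 : 0 < Num.sqrt (@pi R *+ 2) by rewrite sqrtr_gt0 mulrn_wgt0// pi_gt0.
have q0 : 0 < (3 / 8)^-1 :> R by rewrite invr_gt0; lra.
rewrite lef_pV2 ?posrE//.
rewrite -[leRHS](ger0_norm (ltW q0)) -sqrtr_sqr ler_wsqrtr//.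
have -> : (3 / 8)^-1 ^+ 2 = 64 / 9 :> R by field.
by have := @pi_le R; rewrite (mulr2n pi); lra.
Qed.

(* The Mills ratio at [0], that is [sqrt (pi / 2)]. *)
Definition mills0 : R := tail (fun=> 1) 0 / gam 0.

Lemma tail_cst1 : tail (fun=> 1) 0 = 1 / 2 :> R.
Proof.
have := @even_gmean R (fun=> 1) (fun=> cvg_cst _) (gint_cst 1) (fun=> erefl).
rewrite gmean_cst => e; apply: (@mulfI _ 2) => //.
by rewrite -[LHS]e; field.
Qed.

Lemma mills0_ge0 : 0 <= mills0.
Proof. by rewrite /mills0 tail_cst1 divr_ge0// gam_ge0. Qed.

Lemma mills0_le : mills0 <= 4 / 3.
Proof.
rewrite /mills0 tail_cst1 ler_pdivrMr ?gam_gt0//; have := gam0_ge; lra.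
Qed.

Lemma tail_apow0 p : 0 <= p -> tail (apow p) 0 = gmean (apow p) / 2 :> R.
Proof.
move=> p0; rewrite (@even_gmean R (apow p)) ?(mulrC 2) ?mulfK//.
- exact: apow_continuous.
- exact: gint_apow.
- by move=> t; rewrite /apow normrN.
Qed.

Lemma gmean_apow_ge0 p : 0 <= gmean (apow p) :> R.
Proof. by apply: Rintegral_ge0 => t _; rewrite mulr_ge0 ?apow_ge0 ?gam_ge0. Qed.

Lemma mills0_moment p : 0 <= p -> tail (apow p) 0 / gam 0 = mills0 * gmean (apow p).
Proof. by move=> p0; rewrite tail_apow0// /mills0 tail_cst1; field; exact: gam_neq0. Qed.

Lemma gmean_apow1 : gmean (apow 1) = mills0^-1 :> R.
Proof.
have h : tail (apow 1) 0 = gam 0 :> R.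
  rewrite -tail_id /tail; apply: eq_Rintegral => t; rewrite inE/= in_itv/= andbT => t0.
  by rewrite /apow powRr1// ger0_norm.
have := tail_apow0 (ler01 : 0 <= 1 :> R); rewrite h /mills0 tail_cst1 => e.
have -> : gmean (apow 1) = 2 * gam 0 by rewrite e; field.
by field; exact: gam_neq0.
Qed.

End gaussian_moments.

(** * Elementary inequalities for powers *)

Section powers.
Context {R : realType}.
Implicit Types (x r w : R).

(** x^r = exp(r ln x) >= 1 + r ln x, and ln x >= 1 - 1/x. *)
Lemma powR_ge_tangent x r : 0 < x -> 0 <= r -> 1 + r * (1 - x^-1) <= x `^ r.
Proof.
move=> x0 r0; rewrite /powR gt_eqF//.
have h : 1 - x^-1 <= ln x.
  have := @le_ln1Dx R (x^-1 - 1); rewrite (subrKC 1) lnV ?posrE// => h.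
  by have := h _; rewrite ltrBrDl subrr invr_gt0 => /(_ x0); lra.
apply: le_trans (expR_ge1Dx _); rewrite lerD2l ler_wpM2l//.
Qed.

Lemma powR_two_ge r : 0 <= r -> 1 + r / 2 <= 2 `^ r :> R.
Proof.
move=> r0; have := @powR_ge_tangent 2 r (ltr0Sn _ _) r0.
by have -> : 1 - 2^-1 = 2^-1 :> R by field.
Qed.

Lemma powR_le_tangent w r : 0 <= w -> 0 <= r -> r <= 1 -> w `^ r <= (1 - r) + r * w.
Proof.
move=> w0; rewrite le_eqVlt => /predU1P[<- _|r0 r1]; first by rewrite powRr0; lra.
have q1 : 1 <= r^-1 by rewrite invf_ge1.
have := @powR_tangent R (w `^ r) 1 (r^-1) (powR_ge0 _ _) ler01 q1.
rewrite -powRrM mulfV ?gt_eqF// powRr1// !powR1 mulr1 => h.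
have : r * (1 + r^-1 * (w `^ r - 1)) <= r * w by rewrite ler_wpM2l// ltW.
by rewrite mulrDr mulr1 mulrA mulfV ?gt_eqF// mul1r; lra.
Qed.

(** For r <= 1 the reduction to exponent 1 produces E|W|, while the statement has E|W|^r and
    E|W|^(r+1). The first of these powers dominates [w] on [0, 1], the second beyond 1. *)
Lemma le_powR_addS w r : 0 <= w -> 0 <= r -> r <= 1 -> w <= w `^ r + w `^ (r + 1).
Proof.
move=> w0 r0 r1; rewrite powRD1//; have p0 := powR_ge0 w r.
have [w1|/ltW w1] := leP w 1.
  have [->|wn0] := eqVneq w 0; first by rewrite mulr0 addr0 powR_ge0.
  have q0 : 0 <= w `^ r * w by rewrite mulr_ge0.
  suff : w <= w `^ r by lra.
  rewrite -[leLHS]powRr1//; apply: ger_powR => //.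
  by rewrite lt0r wn0 w0.
have : 1 <= w `^ r by rewrite -(powRr0 w) ler_powR.
move=> h; have : w <= w `^ r * w by rewrite ler_peMl.
lra.
Qed.
End powers.

(** Increments of the composite are controlled without differentiating [h]: its Lipschitz bound
    reduces them to those of [g], which are compared with the odd primitive of the bound on [dg]. *)
Lemma comp_growth (R : realType) (h g dg : R -> R) (L a b r x y : R) :
  0 <= L -> 1 <= r -> (forall x y, `|h x - h y| <= L * `|x - y|) ->
  (forall z : R, is_derive z 1 g (dg z)) -> (forall z : R, `|dg z| <= a + b * `|z| `^ r) ->
  y <= x -> `|h (g x) - h (g y)| <= growth (L * a) (L * b) r x - growth (L * a) (L * b) r y.
Proof.
move=> L0 r1 hL dgz dgb yx; apply: le_trans (hL _ _) _.
have -> : growth (L * a) (L * b) r x - growth (L * a) (L * b) r y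
    = L * (growth a b r x - growth a b r y) by rewrite /growth; ring.
rewrite ler_wpM2l//.
have main (e : R) : `|e| = 1 -> e * (g x - g y) <= growth a b r x - growth a b r y.
  move=> e1.
  have d (z : R) : is_derive z 1 (fun z => e * g z - growth a b r z)
      (e * dg z - (a + b * apow r z)).
    have dG := growth_is_derive a b z (lt_le_trans ltr01 r1).
    by apply: is_derive_eq; rewrite /GRing.scale/=; ring.
  have := @derive_le_lipschitz R _ _ x y 0 yx d; rewrite mulr0 => H.
  suff /H : forall z, y <= z -> z <= x -> e * dg z - (a + b * apow r z) <= 0 by lra.
  move=> z _ _; rewrite subr_le0; apply: le_trans (dgb z).
  by apply: le_trans (ler_norm _) _; rewrite normrM e1 mul1r.
have := main 1 (normr1 _); have := main (- 1) (normrN1 _).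
by rewrite ler_norml; lra.
Qed.

(** * Comparison of moments under unit variance *)

Section moments.
Context d (T : measurableType d) (R : realType) (P : probability T R).
Context (Y : T -> R) (q : R).
Hypothesis mY : measurable_fun setT Y.
Hypothesis momY : P.-integrable setT (EFin \o (fun w => `|Y w| `^ q)).

Lemma integrable_powR_le (p : R) : 0 <= p -> p <= q ->
  P.-integrable setT (EFin \o (fun w => `|Y w| `^ p)).
Proof.
move=> p0 pq; have i1 := finite_measure_integrable_cst P 1 measurableT.
have iD : P.-integrable setT (EFin \o (fun w => 1 + `|Y w| `^ q)).
  exact: (integrableD measurableT i1 momY).
apply: (integrable_dominated measurableT _ iD).
  apply: (measurableT_comp (measurable_powR p)).
  by apply: measurableT_comp => //.
move=> w _; rewrite ger0_norm ?powR_ge0//; have [w1|/ltW w1] := leP `|Y w| 1.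
  have : `|Y w| `^ p <= 1 `^ p by rewrite ge0_ler_powR ?nnegrE.
  by rewrite powR1 => /le_trans; apply; rewrite lerDl powR_ge0.
by rewrite ler_wpDl// ler_powR.
Qed.

Hypothesis EY2 : \int[P]_w (Y w ^+ 2) = 1.

Let iY2 : 2 <= q -> P.-integrable setT (EFin \o (fun w => Y w ^+ 2)).
Proof.
move=> q2; have := integrable_powR_le (ler0n R 2) q2; congr (integrable _ _ _).
by apply/funext => w /=; rewrite powR_mulrn// real_normK// num_real.
Qed.

Lemma moment_le (p u : R) : 3 <= p -> 0 <= u -> p + u <= q ->
  \int[P]_w (`|Y w| `^ p) <= \int[P]_w (`|Y w| `^ (p + u)).
Proof.
move=> p3 u0 puq.
(* [x^p (x^u - 1) >= u (x^2 - 1) / 2], and [Y^2 - 1] has mean zero. *)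
apply: (@Rintegral_le_unit_variance _ _ _ P Y _ _ (u / 2)) => //.
- by apply: iY2; lra.
- by apply: integrable_powR_le; lra.
- by apply: integrable_powR_le; lra.
move=> w; rewrite -[Y w ^+ 2]real_normK ?num_real//; set x := `|Y w|.
have [x0|xn0] := eqVneq x 0.
  have p0 : p != 0 by rewrite gt_eqF//; lra.
  have pu0 : p + u != 0 by rewrite gt_eqF//; lra.
  by rewrite x0 (powR0 p0) (powR0 pu0) expr0n/=; lra.
have x0 : 0 < x by rewrite lt0r xn0 normr_ge0.
have t := powR_ge_tangent x0 u0.
rewrite powRD ?xn0 ?implybT//.
have -> : x `^ p = x `^ (p - 1) * x by rewrite -powRB1//; lra.
have h1 : x `^ (p - 1) * x * (1 + u * (1 - x^-1)) <= x `^ (p - 1) * x * x `^ u.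
  by rewrite ler_wpM2l// mulr_ge0 ?powR_ge0// ltW.
have h2 : x `^ (p - 1) * x * (1 + u * (1 - x^-1)) = x `^ (p - 1) * x + u * (x `^ (p - 1) * (x - 1)).
  by field.
(* The inequality is proved with x^2 in place of x^(p-1). Since p - 1 >= 2, the replacement
   increases the product with x - 1 whichever sign x - 1 has. *)
have h3 : (x ^+ 2 - 1) / 2 <= x `^ (p - 1) * (x - 1).
  have k : (x ^+ 2 - 1) / 2 <= x ^+ 2 * (x - 1).
    rewrite -subr_ge0 (_ : _ - _ = (x - 1) ^+ 2 * (2 * x + 1) / 2); last by field.
    by rewrite divr_ge0// mulr_ge0 ?sqr_ge0//; lra.
  apply: le_trans k _; have [x1|/ltW x1] := leP x 1.
    have : x `^ (p - 1) <= x ^+ 2.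
      by rewrite -(powR_mulrn 2 (ltW x0)) ger_powR ?x0//; lra.
    by move=> h; rewrite ler_wnM2r// subr_le0.
  have : x ^+ 2 <= x `^ (p - 1) by rewrite -(powR_mulrn 2 (ltW x0)) ler_powR//; lra.
  by move=> h; rewrite ler_wpM2r// subr_ge0.
have h4 : u * ((x ^+ 2 - 1) / 2) <= u * (x `^ (p - 1) * (x - 1)) by rewrite ler_wpM2l.
lra.
Qed.

End moments.

(** * Comparison of constants *)

Section budgets.
Context {R : realFieldType}.

(* In the two budgets [t = 2^r], [c = mills0], [mu = E|Z|^(r+1)], [S = n^(-r/2)],
   [s = n^(-1/2)], [w0 = E|W|^r], [w1 = E|W|^(r+1)] and [w = E|W|]. *)
Lemma budget_ge1 (L a b c t mu S w0 w1 x3 x4 x3r x4r : R) : 0 <= L -> 0 <= b -> 0 <= c ->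
  c <= 4 / 3 -> 2 <= t -> 0 <= mu -> 0 <= S -> 0 <= w0 -> 0 <= w1 ->
  0 <= x3 -> x3 <= x4 -> 0 <= x3r -> x3r <= x4r ->
  3 / 2 * (x3 * ((2 * (L * a) + L * b * (t * (c * mu))) + L * b * (1 + t) * (t / 2) * w0)
    + L * b * (1 + t) * (t / 2) * S * x3r) <=
  L * (3 * a * x3 + t * b * (t * 2 * x4 * (w1 + w0) + 4 * mu * x4 + t * 4 * S * x4r)).
Proof.
move=> L0 b0 c0 c1 t2 mu0 S0 w00 w10 x30 x34 x3r0 x34r.
have Lbt : 0 <= L * b * t by rewrite !mulr_ge0//; lra.
have p1 : x3 * w0 <= x4 * (w1 + w0) by rewrite ler_pM//; lra.
have q1 : 3 / 4 * (1 + t) * (x3 * w0) <= 2 * t * (x4 * (w1 + w0)).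
  by rewrite ler_pM ?mulr_ge0//; lra.
have p2 : c * mu * x3 <= 4 / 3 * mu * x4.
  by rewrite ler_pM ?mulr_ge0// ler_wpM2r.
have p20 : 0 <= mu * x4 by rewrite mulr_ge0//; lra.
have q3 : 3 / 4 * (1 + t) * (S * x3r) <= 4 * t * (S * x4r).
  by rewrite ler_pM ?mulr_ge0//; [lra|lra|rewrite ler_wpM2l].
(* With c <= 4/3 and t >= 2 the coefficients compare term by term: 3/2 c <= 2 <= 4 and 3/4 (1 + t)
   <= 2 t. The terms in [a] agree exactly, since 3/2 times 2 is 3. *)
have q : 3 / 2 * (c * mu * x3) + 3 / 4 * (1 + t) * (x3 * w0) + 3 / 4 * (1 + t) * (S * x3r) <=
   2 * t * (x4 * (w1 + w0)) + 4 * (mu * x4) + 4 * t * (S * x4r) by lra.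
have := ler_wpM2l Lbt q.
by lra.
Qed.

Lemma budget_le1 (L a b c r t mu s S w w0 w1 x3 x4 x4r : R) : 0 <= L -> 0 <= b -> 0 <= c ->
  c <= 4 / 3 -> 0 <= r -> r <= 1 -> 1 + r / 2 <= t -> (3 - r) / 4 <= mu ->
  0 <= s -> s <= S -> 0 <= w -> w <= w1 + w0 ->
  0 <= x3 -> x3 <= x4 -> x4 <= x4r ->
  3 / 2 * (x3 * ((2 * (L * (a + b * (1 - r))) + L * (b * r) * c) + L * (b * r) * 2 * 1 * w)
    + L * (b * r) * 2 * 1 * s * x4) <=
  L * (3 * a * x3 + t * b * (t * 2 * x4 * (w1 + w0) + 4 * mu * x4 + t * 4 * S * x4r)).
Proof.
move=> L0 b0 c0 c1 r0 r1 tr mur s0 sS w0' ww x30 x34 x44.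
have Lb : 0 <= L * b by rewrite mulr_ge0.
have rc : r * c <= r * (4 / 3) by rewrite ler_wpM2l.
have mt : (1 + r / 2) * ((3 - r) / 4) <= t * mu by rewrite ler_pM//; lra.
have mt2 : (3 - r) / 4 <= (1 + r / 2) * ((3 - r) / 4) by rewrite ler_peMl//; lra.
have tt : (1 + r / 2) * (1 + r / 2) <= t * t by rewrite ler_pM//; lra.
have rr : 0 <= r * r by rewrite mulr_ge0.
(* The lower bound (3 - r)/4 for [mu] fits here: c <= 4/3 gives 3 (1 - r) + 3/2 r c <= 3 (1 - r) + 2
   r = 3 - r. *)
have p1 : x3 * (3 * (1 - r) + 3 / 2 * (r * c)) <= x4 * (4 * (t * mu)).
  have ? : 0 <= r * c by rewrite mulr_ge0.
  by rewrite ler_pM//; lra.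
have p2 : 3 * r * (x3 * w) <= 2 * (t * t) * (x4 * (w1 + w0)).
  by rewrite ler_pM//; [lra|rewrite mulr_ge0|lra|rewrite ler_pM//; lra].
have p3 : 3 * r * (s * x4) <= 4 * (t * t) * (S * x4r).
  by rewrite ler_pM//; [lra|rewrite mulr_ge0//; lra|lra|rewrite ler_pM//; lra].
have := ler_wpM2l Lb (lerD (lerD p1 p2) p3).
by lra.
Qed.

End budgets.

(** * The estimate for W with the constants of the theorem *)

Section discrepancy_bound.
Context d (T : measurableType d) (R : realType) (P : probability T R).
Context (n : nat) (X : 'I_n -> {mfun T >-> R}) (r : R).
Hypothesis n_gt0 : (0 < n)%N.
Hypothesis r0 : 0 <= r.
Hypothesis indepX : mutually_independent P (fun i => X i : T -> R).
Hypothesis EX : forall i, \int[P]_w X i w = 0.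
Hypothesis EX2 : forall i, \int[P]_w (X i w ^+ 2) = 1.
Hypothesis momX : forall i, P.-integrable setT (EFin \o (fun w => `|X i w| `^ (r + 4))).

Let s : R := (Num.sqrt n%:R)^-1.
Let W w := s * \sum_i X i w.

Let s_gt0 : 0 < s. Proof. by rewrite invr_gt0 sqrtr_gt0 ltr0n. Qed.
Let s_le1 : s <= 1.
Proof. by rewrite invf_le1 ?sqrtr_gt0 ?ltr0n// -[leLHS]sqrtr1 ler_wsqrtr// ler1n. Qed.

Lemma integrable_sum_powR p : 0 <= p -> p <= r + 4 ->
  P.-integrable setT (EFin \o (fun w => `|W w| `^ p)).
Proof.
have rge0 := r0.
have mW : measurable_fun setT W by apply: measurable_funM => //; exact: measurable_sum.
move=> p0 pr; apply: (integrable_powR_le mW _ p0 pr).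
have q1 : 1 <= r + 4 by lra.
have iM := @integrable_powR_sum _ _ _ P _ (index_enum 'I_n) (fun i w => `|X i w|) _ q1.
apply: (integrable_dominated measurableT _ (iM _ _ momX)) => //.
- by apply: (measurableT_comp (measurable_powR (r + 4))); exact: measurableT_comp.
- by move=> i; exact: measurableT_comp.
move=> w _; rewrite ger0_norm ?powR_ge0// ge0_ler_powR ?nnegrE//; [lra| |].
  by apply: sumr_ge0.
rewrite normrM (gtr0_norm s_gt0); apply: le_trans (ler_norm_sum _ _ _).
by rewrite ler_piMl.
Qed.

Let x3 i := \int[P]_w (`|X i w| ^+ 3).
Let x4 i := \int[P]_w (X i w ^+ 4).
Let x4r i := \int[P]_w (`|X i w| `^ (r + 4)).
Let w0 := \int[P]_w (`|W w| `^ r).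
Let w1 := \int[P]_w (`|W w| `^ (r + 1)).
Let mu1 : R := gmean (apow (r + 1)).

Let x3E i : x3 i = \int[P]_w (`|X i w| `^ 3).
Proof. by apply: eq_Rintegral => w _; rewrite (powR_mulrn 3). Qed.

Let x4E i : x4 i = \int[P]_w (`|X i w| `^ 4).
Proof.
apply: eq_Rintegral => w _; rewrite (powR_mulrn 4)// -normrX ger0_norm//.
by rewrite -[4%N]/(2 * 2)%N exprM sqr_ge0.
Qed.

Let x3_ge0 i : 0 <= x3 i. Proof. by apply: Rintegral_ge0 => w _; rewrite exprn_ge0. Qed.

Let x34 i : x3 i <= x4 i.
Proof.
have rge0 := r0.
rewrite x3E x4E -[4](_ : 3 + 1 = _); last by lra.
by apply: (moment_le _ (momX i) (EX2 i)) => //; lra.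
Qed.

Let x44r i : x4 i <= x4r i.
Proof.
have rge0 := r0.
rewrite x4E /x4r addrC; apply: (moment_le _ (momX i) (EX2 i)) => //; lra.
Qed.

Let w0_ge0 : 0 <= w0. Proof. by apply: Rintegral_ge0 => w _; exact: powR_ge0. Qed.
Let w1_ge0 : 0 <= w1. Proof. by apply: Rintegral_ge0 => w _; exact: powR_ge0. Qed.

Context (h g dg : R -> R) (L a b : R).
Hypotheses (L0 : 0 <= L) (a0 : 0 <= a) (b0 : 0 <= b).
Hypothesis hL : forall x y, `|h x - h y| <= L * `|x - y|.
Hypothesis dgz : forall z : R, is_derive z 1 g (dg z).
Hypothesis dgb : forall z : R, `|dg z| <= a + b * `|z| `^ r.

Let H := h \o g.
Let bound i := 3 * a * x3 i + 2 `^ r * b *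
  (2 `^ (r + 1) * x4 i * (w1 + w0) + 4 * mu1 * x4 i + 2 `^ (r + 2) * s `^ r * x4r i).

Let concl := P.-integrable setT (EFin \o (fun w => H (W w))) /\
  `|\int[P]_w H (W w) - gmean H| <= L * s ^+ 3 * \sum_i bound i.

Let two_r : 2 `^ (r + 1) = 2 `^ r * 2 :> R /\ 2 `^ (r + 2) = 2 `^ r * 4 :> R.
Proof.
by split; rewrite powRD ?pnatr_eq0 ?implybT// ?powRr1// (powR_mulrn 2)// -natrX.
Qed.

Let discrepancy_ge1 : 1 <= r -> gint H /\ concl.
Proof.
have rge0 := r0.
move=> r1; have mu0 : 0 <= mu1 := gmean_apow_ge0 _.
have t0 := powR_ge0 (2 : R) r; have c0 : 0 <= mills0 := @mills0_ge0 R.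
have Hs w : 0 <= w -> tail (apow (r + 1)) w / gam w <= 2 `^ r * w `^ r + 2 `^ r * (mills0 * mu1).
  move=> w00; apply: le_trans (tail_apow_le r1 w00) _.
  by rewrite mulrDr mills0_moment// addr_ge0.
have Hg x y : y <= x -> `|H x - H y| <= growth (L * a) (L * b) r x - growth (L * a) (L * b) r y.
  exact: (comp_growth L0 r1 hL dgz dgb).
have [] := stein_solution (mulr_ge0 L0 a0) (mulr_ge0 L0 b0) r1 t0
  (mulr_ge0 t0 (mulr_ge0 c0 mu0)) Hs Hg.
move=> gH [psi [p [dpsi cp steinE plip]]]; split => //.
pose a' := 2 * (L * a) + L * b * (2 `^ r * (mills0 * mu1)).
pose b' := L * b * (1 + 2 `^ r).
have a'0 : 0 <= a' by apply: addr_ge0; apply: mulr_ge0 => //; apply: mulr_ge0 => //; exact: mulr_ge0.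
have b'0 : 0 <= b' by rewrite !mulr_ge0// addr_ge0.
have momX3 i : P.-integrable setT (EFin \o (fun w => `|X i w| `^ (r + 3))).
  by apply: (integrable_powR_le _ (momX i)) => //; lra.
have plip' m x y : `|x| <= m -> `|y| <= m -> `|p x - p y| <= `|x - y| * (a' + b' * m `^ r).
  by move=> xm ym; apply: le_trans (plip m x y xm ym) _; rewrite le_eqVlt /a' /b'; apply/orP; left; apply/eqP; ring.
have [iH] := stein_discrepancy n_gt0 r1 indepX EX EX2 momX3 a'0 b'0 dpsi cp plip' steinE.
move=> D; split => //; apply: le_trans D _.
rewrite mulr_sumr; apply: ler_sum => i _.
have -> : L * s ^+ 3 * bound i = s ^+ 3 * (L * bound i) by ring.
rewrite -mulrA; apply: ler_wpM2l; first by rewrite exprn_ge0// ltW.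
rewrite /bound; have [-> ->] := two_r.
have -> : 2 `^ (r - 1) = 2 `^ r / 2 :> R.
  by rewrite powRD ?pnatr_eq0 ?implybT// powRN powRr1.
have x3rE : \int[P]_w (`|X i w| ^+ 3 * `|X i w| `^ r) = \int[P]_w (`|X i w| `^ (r + 3)).
  apply: eq_Rintegral => w _; rewrite powRD ?(powR_mulrn 3) 1?mulrC//.
  by rewrite gt_eqF//; lra.
have x3r_le : \int[P]_w (`|X i w| `^ (r + 3)) <= x4r i.
  have e : r + 4 = r + 3 + 1 by lra.
  have r3 : 3 <= r + 3 by lra.
  have r4 : r + 3 + 1 <= r + 4 by lra.
  rewrite /x4r e.
  exact: (moment_le (measurable_funPT (X i)) (momX i) (EX2 i) r3 ler01 r4).
have x3r_ge0 : 0 <= \int[P]_w (`|X i w| `^ (r + 3)).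
  by apply: Rintegral_ge0 => w _; exact: powR_ge0.
have t2 : 2 <= 2 `^ r :> R by rewrite -[leLHS](powRr1 (ler0n _ 2)) ler_powR// ler1n.
rewrite x3rE; exact: (budget_ge1 a L0 b0 c0 mills0_le t2 mu0 (powR_ge0 _ _) w0_ge0 w1_ge0
  (x3_ge0 i) (x34 i) x3r_ge0 x3r_le).
Qed.

(** The tangent at 1 gives |z|^(r+1) >= (1 + r)|z| - r, and E|Z| = 2 gam(0) is at least 3/4. *)
Let gmean_apow_ge : r <= 1 -> (3 - r) / 4 <= mu1.
Proof.
have rge0 := r0; move=> r1.
have i1 : gint (apow 1 : R -> R) by exact: gint_apow.
have ir : gint (apow (r + 1)) by apply: gint_apow; lra.
have k : gmean ((fun t => (1 + r) * apow 1 t) \+ (fun=> - r)) <= mu1.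
  apply: le_Rintegral => //; [exact: gintD (gintZ _ i1) (gint_cst _)|].
  move=> t _ /=; rewrite ler_wpM2r ?gam_ge0//.
  rewrite /apow powRr1// powRD1//; set x := `|t|.
  have [x0|xn0] := eqVneq x 0; first by rewrite x0 !mulr0; lra.
  have x0 : 0 < x by rewrite lt0r xn0 normr_ge0.
  have := powR_ge_tangent x0 r0 => /(ler_wpM2r (ltW x0)); apply: le_trans.
  by rewrite le_eqVlt; apply/orP; left; apply/eqP; field.
move: k; rewrite (gmeanD (gintZ _ i1) (gint_cst _)) gmeanZ// gmean_cst.
have -> : gmean (apow 1) = 2 * gam 0 :> R.
  by rewrite gmean_apow1 /mills0 tail_cst1; field; exact: gam_neq0.
have := @gam0_ge R; nra.
Qed.

Let discrepancy_le1 : r <= 1 -> gint H /\ concl.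
Proof.
have rge0 := r0; move=> r1; have mu0 := gmean_apow_ge r1.
have c0 : 0 <= mills0 := @mills0_ge0 R.
have a2 : 0 <= L * (a + b * (1 - r)) by rewrite mulr_ge0// addr_ge0// mulr_ge0//; lra.
have b2 : 0 <= L * (b * r) by rewrite mulr_ge0// mulr_ge0.
have dgb' (z : R) : `|dg z| <= a + b * (1 - r) + b * r * `|z| `^ 1.
  apply: le_trans (dgb z) _; rewrite powRr1//.
  have := ler_wpM2l b0 (powR_le_tangent (normr_ge0 z) r0 r1); lra.
have Hg x y : y <= x -> `|H x - H y| <=
    growth (L * (a + b * (1 - r))) (L * (b * r)) 1 x - growth (L * (a + b * (1 - r))) (L * (b * r)) 1 y.
  exact: (comp_growth L0 (lexx 1) hL dgz dgb').
have := @stein_solution R _ _ 1 1 mills0 H a2 b2 (lexx 1) ler01 c0.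
case=> [w w00|//|]; first by rewrite mul1r powRr1//; exact: tail_sqr_le.
move=> gH [psi [p [dpsi cp steinE plip]]]; split => //.
pose a' := 2 * (L * (a + b * (1 - r))) + L * (b * r) * mills0.
pose b' := L * (b * r) * 2.
have a'0 : 0 <= a' by apply: addr_ge0; apply: mulr_ge0.
have b'0 : 0 <= b' by apply: mulr_ge0.
have momX3 i : P.-integrable setT (EFin \o (fun w => `|X i w| `^ (1 + 3))).
  by apply: (integrable_powR_le _ (momX i)) => //; lra.
have plip' m x y : `|x| <= m -> `|y| <= m -> `|p x - p y| <= `|x - y| * (a' + b' * m `^ 1).
  by move=> xm ym; apply: le_trans (plip m x y xm ym) _; rewrite le_eqVlt /a' /b'; apply/orP; left; apply/eqP; ring.
have [iH] := stein_discrepancy n_gt0 (lexx 1) indepX EX EX2 momX3 a'0 b'0 dpsi cp plip' steinE.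
move=> D; split => //; apply: le_trans D _.
rewrite mulr_sumr; apply: ler_sum => i _.
have -> : L * s ^+ 3 * bound i = s ^+ 3 * (L * bound i) by ring.
rewrite -mulrA; apply: ler_wpM2l; first by rewrite exprn_ge0// ltW.
rewrite /bound; have [-> ->] := two_r.
rewrite subrr powRr0.
have x4E' : \int[P]_w (`|X i w| ^+ 3 * `|X i w| `^ 1) = x4 i.
  apply: eq_Rintegral => w _; rewrite powRr1// -exprSr -normrX ger0_norm//.
  by rewrite -[4%N]/(2 * 2)%N exprM sqr_ge0.
have iw q : 0 <= q -> q <= r + 4 -> P.-integrable setT (EFin \o (fun w => `|W w| `^ q)).
  exact: integrable_sum_powR.
have w1le : \int[P]_w (`|W w| `^ 1) <= w1 + w0.
  have i0 : P.-integrable setT (EFin \o (fun w => `|W w| `^ r)) by apply: iw; lra.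
  have i1 : P.-integrable setT (EFin \o (fun w => `|W w| `^ (r + 1))) by apply: iw; lra.
  have i2 : P.-integrable setT (EFin \o (fun w => `|W w| `^ 1)) by apply: iw; lra.
  rewrite -(RintegralD measurableT i1 i0).
  apply: (le_Rintegral measurableT i2 (integrableD measurableT i1 i0)).
  by move=> w _; rewrite powRr1// addrC; exact: le_powR_addS.
rewrite x4E' [s `^ 1]powRr1 ?(ltW s_gt0)// /a' /b'.
have ssr : s <= s `^ r by rewrite -[leLHS]powRr1 ?(ltW s_gt0)// ger_powR// s_gt0.
have w1_ge : 0 <= \int[P]_w (`|W w| `^ 1) by apply: Rintegral_ge0 => w _; exact: powR_ge0.
exact: (budget_le1 a L0 b0 c0 mills0_le r0 r1 (powR_two_ge r0) mu0 (ltW s_gt0) ssr w1_ge w1le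
  (x3_ge0 i) (x34 i) (x44r i)).
Qed.

Theorem discrepancy_bound : [/\ gint H, P.-integrable setT (EFin \o (fun w => H (W w))) &
  `|\int[P]_w H (W w) - gmean H| <= L * s ^+ 3 * \sum_i bound i].
Proof.
have [r1|r1] := leP 1 r; first by have [? []] := discrepancy_ge1 r1.
by have [? []] := discrepancy_le1 (ltW r1).
Qed.

End discrepancy_bound.

Lemma lipschitz_continuous (R : realType) (h : R -> R) (L : R) :
  (forall x y, `|h x - h y| <= L * `|x - y|) -> continuous h.
Proof.
move=> hL x; have L0 : 0 <= L.
  by have := le_trans (normr_ge0 _) (hL 1 0); rewrite subr0 normr1 mulr1.
apply/cvgrPdist_le => e e0.
near=> y; apply: le_trans (hL _ _) _.
have : `|x - y| <= e / (L + 1).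
  by near: y; apply: cvgr_dist_le => //; rewrite divr_gt0// ltr_wpDl.
rewrite ler_pdivlMr ?ltr_wpDl// => /(le_trans _); apply.
by rewrite mulrC ler_wpM2l// lerDl.
Unshelve. all: by end_near. Qed.

Lemma gmean_apow2 (R : realType) : gmean (apow 2) = 1 :> R.
Proof.
have h : tail (apow 2) 0 = tail (fun=> 1) 0 :> R.
  have := tail_sqr (0 : R); rewrite mul0r add0r => <-.
  by apply: eq_Rintegral => t _; rewrite /apow (powR_mulrn 2)// real_normK ?num_real.
have := tail_apow0 (ler0n R 2); rewrite h tail_cst1 => e.
have -> : gmean (apow 2) = 2 * (gmean (apow 2) / 2) :> R by field.
by rewrite -e; field.
Qed.

(** * The delta method *)

Section rescaling.
Context {R : realType}.
Context (f : R -> R) (A B C D r q s : R).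
Hypothesis f_derivable : forall x : R, derivable f x 1.
Hypothesis f'_derivable : forall x : R, derivable f^`()%classic x 1.
Hypothesis f'0_neq0 : f^`()%classic 0 != 0.
Hypotheses (C0 : 0 <= C) (D0 : 0 <= D) (q0 : 0 <= q) (s0 : 0 < s).
Hypothesis f'_bound : forall w : R, `|f^`()%classic w| <= A + B * `|w| `^ r.
Hypothesis f''_bound : forall w : R, `|f^`(2)%classic w| <= C + D * `|w| `^ q.

Let c := f^`()%classic 0.

Definition rescale w := s^-1 * (f (s * w) - f 0) / f^`()%classic 0.

Lemma rescale_is_derive (w : R) : is_derive w 1 rescale (f^`()%classic (s * w) / c).
Proof.
have di : is_derive w 1 (fun t : R => s * t) s.
  by apply: is_derive_eq; rewrite /GRing.scale/= mulr1.
have df (x : R) : is_derive x 1 f (f^`()%classic x) by rewrite derive1E; apply: DeriveDef.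
have dc : is_derive w 1 (fun t => f (s * t)) (f^`()%classic (s * w) * s).
  exact: (@is_derive1_comp R f (fun t => s * t)).
rewrite /rescale; apply: is_derive_eq; rewrite /GRing.scale/= /c.
by field; rewrite f'0_neq0 gt_eqF.
Qed.

Lemma norm_rescale_deriv w :
  `|f^`()%classic (s * w) / c| <= A / `|c| + B * s `^ r / `|c| * `|w| `^ r.
Proof.
rewrite normrM normfV.
have -> : A / `|c| + B * s `^ r / `|c| * `|w| `^ r = (A + B * `|s * w| `^ r) / `|c|.
  by rewrite normrM (gtr0_norm s0) powRM ?(ltW s0)//; field; rewrite normr_eq0.
by rewrite ler_wpM2r ?invr_ge0.
Qed.

(** The map [rescale] vanishes at 0 and has slope 1 there. One mean value inequality for f' bounds
    its slope minus 1, and a second one integrates this bound; each contributes a factor |w|. *)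
Lemma norm_rescale_sub w : `|rescale w - w| <=
  s / `|c| * (C * apow 2 w + D * s `^ q * apow (q + 2) w).
Proof.
have df x : is_derive (x : R) 1 f^`()%classic (f^`(2)%classic x) by rewrite derive1nS derive1n1 derive1E; apply: DeriveDef.
pose K := s * `|w| * (C + D * (s * `|w|) `^ q) / `|c|.
have d (z : R) : is_derive z 1 (fun t => rescale t - t) (f^`()%classic (s * z) / c - 1).
  by have dr := rescale_is_derive z; apply: is_derive_eq.
have := @norm_derive_le R _ _ `|w| K w 0 d.
rewrite /rescale mulr0 !subrr mulr0 mul0r !subr0 normr0 => H.
apply: le_trans (H _ (lexx _) (normr_ge0 _)) _.
  move=> z zw.
  have -> : f^`()%classic (s * z) / c - 1 = (f^`()%classic (s * z) - f^`()%classic 0) / c.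
    by rewrite mulrBl divff.
  rewrite normrM normfV /K ler_wpM2r ?invr_ge0//.
  have szw : `|s * z| <= s * `|w| by rewrite normrM (gtr0_norm s0) ler_wpM2l// ltW.
  have sw0 : 0 <= s * `|w| by rewrite mulr_ge0// ltW.
  have := @norm_derive_le R _ _ (s * `|w|) (C + D * (s * `|w|) `^ q) (s * z) 0 df.
  rewrite normr0 subr0 => H1; apply: le_trans (H1 _ szw sw0) _.
    move=> x xs; apply: le_trans (f''_bound x) _; rewrite lerD2l ler_wpM2l//.
    by rewrite ge0_ler_powR ?nnegrE.
  by rewrite ler_wpM2r// addr_ge0// mulr_ge0// powR_ge0.
rewrite /K powRM ?(ltW s0)//.
rewrite /apow -[q + 2](_ : q + 1 + 1 = _); last by lra.
rewrite (powR_mulrn 2)// !powRD1 ?addr_ge0// expr2.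
by rewrite le_eqVlt; apply/orP; left; apply/eqP; ring.
Qed.

Context (h : R -> R) (L : R).
Hypothesis hL : forall x y, `|h x - h y| <= L * `|x - y|.
Hypothesis L0 : 0 <= L.

Lemma gint_lipschitz : gint h.
Proof.
apply: (@gint_le R h (fun t => `|h 0| + L * apow 1 t)).
- exact: lipschitz_continuous hL.
- exact: gintD (gint_cst _) (gintZ _ (gint_apow ler01)).
move=> t; rewrite /apow powRr1//; have := hL t 0; rewrite subr0.
by have := ler_normD (h t - h 0) (h 0); rewrite subrK; lra.
Qed.

(** The pointwise bound [norm_rescale_sub] is integrated against [gam]; E Z^2 = 1 accounts for the
    bare coefficient [C]. *)
Lemma gmean_rescale : gint (h \o rescale) ->
  `|gmean (h \o rescale) - gmean h| <=
  L * (s / `|c|) * (C + D * s `^ q * gmean (apow (q + 2))).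
Proof.
move=> ig; have ih := gint_lipschitz.
pose k t := L * (s / `|c|) * (C * apow 2 t + D * s `^ q * apow (q + 2) t).
have q2 : 0 <= q + 2 by rewrite addr_ge0.
have i1 := gintZ C (gint_apow (ler0n R 2)).
have i2 := gintZ (D * s `^ q) (gint_apow q2).
have ik : gint k := gintZ (L * (s / `|c|)) (gintD i1 i2).
have <- : gmean k = L * (s / `|c|) * (C + D * s `^ q * gmean (apow (q + 2))).
  rewrite (gmeanZ (L * (s / `|c|)) (gintD i1 i2)) (gmeanD i1 i2).
  rewrite (gmeanZ C (gint_apow (ler0n R 2))) (gmeanZ (D * s `^ q) (gint_apow q2)).
  by rewrite gmean_apow2 mulr1.
have -> : gmean (h \o rescale) - gmean h = gmean (fun t => h (rescale t) - h t).
  have := gmeanD ig (gintZ (- 1) ih); rewrite (gmeanZ _ ih) mulN1r => <-.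
  by congr gmean; apply/funext => t /=; rewrite mulN1r.
have id : gint (fun t => h (rescale t) - h t).
  have := gintD ig (gintZ (- 1) ih).
  by congr gint; apply/funext => t /=; rewrite mulN1r.
apply: le_trans (le_normr_Rintegral _ id) _ => //.
apply: le_Rintegral => //; first exact: integrable_norm id.
move=> t _ /=; rewrite normrM (ger0_norm (gam_ge0 _)) ler_wpM2r ?gam_ge0//.
apply: le_trans (hL _ _) _; rewrite /k -mulrA ler_wpM2l//.
exact: norm_rescale_sub.
Qed.

End rescaling.

(** * Expectations, and moments of the summands *)

Section expectations.
Context d (T : measurableType d) (R : realType) (P : probability T R).

Lemma expectation_EFin (Y : T -> R) : P.-integrable setT (EFin \o Y) ->
  'E_P[Y]%E = (\int[P]_w Y w)%:E.
Proof. by move=> iY; rewrite unlock /Rintegral fineK// integrable_fin_num. Qed.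

Lemma integrable_of_moment (Y : T -> R) (p : R) : measurable_fun setT Y ->
  ('E_P[(fun w => (`|Y w| `^ p)%R)] < +oo)%E ->
  P.-integrable setT (EFin \o (fun w => `|Y w| `^ p)).
Proof.
move=> mY; rewrite unlock => h; apply/integrableP; split.
  apply/measurable_EFinP; apply: (measurableT_comp (measurable_powR p)).
  exact: measurableT_comp.
apply: le_lt_trans h; rewrite le_eqVlt; apply/orP; left; apply/eqP.
by apply: eq_integral => w _ /=; rewrite ger0_norm// powR_ge0.
Qed.

Lemma variance_centered (Y : T -> R) : P.-integrable setT (EFin \o Y) ->
  P.-integrable setT (EFin \o (fun w => Y w ^+ 2)) -> ('E_P[Y] = 0)%E ->
  'V_P[Y]%E = (\int[P]_w (Y w ^+ 2))%:E.
Proof.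
move=> iY iY2 EY; rewrite /variance covariance.unlock EY/= -expectation_EFin//.
by congr expectation; apply/funext => w; rewrite mulrfctE/= subr0 expr2.
Qed.
End expectations.

Section unit_variance.
Context d (T : measurableType d) (R : realType) (P : probability T R) (X : T -> R) (r : R).
Hypothesis r0 : 0 <= r.
Hypothesis mX : measurable_fun setT X.
Hypothesis momX : P.-integrable setT (EFin \o (fun w => `|X w| `^ (r + 4))).
Hypothesis EX2 : \int[P]_w (X w ^+ 2) = 1.

Lemma integrable_norm_exp k : (k <= 4)%N ->
  P.-integrable setT (EFin \o (fun w => `|X w| ^+ k)).
Proof.
have rge0 := r0; move=> k4; have kr : k%:R <= r + 4.
  by rewrite (le_trans (_ : k%:R <= 4)) ?ler_nat//; lra.
have := integrable_powR_le mX momX (ler0n R k) kr; congr (integrable _ _ _).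
by apply/funext => w /=; rewrite powR_mulrn.
Qed.

Lemma integrable_even_exp k : ~~ odd k -> (k <= 4)%N ->
  P.-integrable setT (EFin \o (fun w => X w ^+ k)).
Proof.
move=> ok k4; have := integrable_norm_exp k4; congr (integrable _ _ _).
apply/funext => w /=; rewrite -normrX ger0_norm//.
by rewrite exprn_even_ge0.
Qed.

(** x^3 - 1 - 3/2 (x^2 - 1) is (x - 1)^2 (x + 1/2). The lower bounds by 1 serve to make the bracket
    of the theorem strictly positive. *)
Lemma moment3_ge1 : 1 <= \int[P]_w (`|X w| ^+ 3).
Proof.
have <- : \int[P]_w (cst 1 w : R) = 1.
  by rewrite Rintegral_cst// [X in fine X]probability_setT mulr1.
apply: (@Rintegral_le_unit_variance _ _ _ P X _ _ (3 / 2)) => //.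
- exact: integrable_even_exp.
- exact: (finite_measure_integrable_cst P 1).
- exact: integrable_norm_exp.
move=> w; rewrite -[X w ^+ 2]real_normK ?num_real//=; set x := `|X w|.
have x0 : 0 <= x by exact: normr_ge0.
rewrite -subr_ge0 (_ : _ - _ = (x - 1) ^+ 2 * (x + 1 / 2)); last by field.
by rewrite mulr_ge0 ?sqr_ge0//; lra.
Qed.

Lemma moment_rD4_ge1 : 1 <= \int[P]_w (`|X w| `^ (r + 4)).
Proof.
have rge0 := r0; apply: le_trans moment3_ge1 _.
have h : 3 + (r + 1) <= r + 4 by lra.
have := moment_le mX momX EX2 (lexx 3) (_ : 0 <= r + 1) h.
have -> : 3 + (r + 1) = r + 4 by lra.
have -> : \int[P]_w (`|X w| `^ 3) = \int[P]_w (`|X w| ^+ 3).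
  by apply: eq_Rintegral => w _; rewrite (powR_mulrn 3).
by apply; lra.
Qed.
End unit_variance.

(** * Assembly of the two estimates *)

Theorem theorem3p9 (R : realType) (f : R -> R) (A B C D r s : R)
  (f_derivable : forall x : R, derivable f x 1)
  (f'_derivable : forall x : R, derivable f^`()%classic x 1)
  (f'0_neq0 : f^`()%classic 0 != 0)
  (A_ge0 : 0 <= A) (B_ge0 : 0 <= B) (C_ge0 : 0 <= C) (D_ge0 : 0 <= D)
  (r_ge0 : 0 <= r) (s_ge0 : 0 <= s)
  (f'_bound : forall w : R, `|f^`()%classic w| <= A + B * `|w| `^ r)
  (f''_bound : forall w : R, `|f^`(2)%classic w| <= C + D * `|w| `^ s)
  (d : measure_display) (T : measurableType d) (P : probability T R)
  (n : nat) (n_gt0 : (0 < n)%N) (X : 'I_n -> {RV P >-> R})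
  (X_indep : mutually_independent P (fun i => X i : T -> R))
  (X_mean : forall i, ('E_P[X i] = 0)%E)
  (X_var : forall i, ('V_P[X i] = 1)%E)
  (X_moment : forall i, ('E_P[(fun w => (`|X i w| `^ (r + 4))%R)] < +oo)%E)
  (d' : measure_display) (T' : measurableType d') (Q : probability T' R)
  (Z : {RV Q >-> R}) (Z_normal : standard_normal Z)
  (h : R -> R) (h_ac : abs_continuous h) :
  let W := scaled_mean X in
  let T1 := delta_statistic f X in
  (`| 'E_P[(h \o T1)] - 'E_Q[(h \o Z)] | <=
    deriv_norm h * ((`|f^`()%classic 0| * Num.sqrt n%:R)^-1)%:E *
    ((n%:R^-1)%:E *
       \sum_(i < n)
         ((3 * A)%:E * 'E_P[(fun w => (`|X i w| ^+ 3)%R)] +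
          (2 `^ r * B / n%:R `^ (r / 2))%:E *
          ((2 `^ (r + 1))%:E * 'E_P[(fun w => (X i w ^+ 4)%R)] *
             ('E_P[(fun w => (`|W w| `^ (r + 1))%R)] + 'E_P[(fun w => (`|W w| `^ r)%R)]) +
           4%:E * 'E_Q[(fun w => (`|Z w| `^ (r + 1))%R)] * 'E_P[(fun w => (X i w ^+ 4)%R)] +
           (2 `^ (r + 2) / n%:R `^ (r / 2))%:E *
             'E_P[(fun w => (`|X i w| `^ (r + 4))%R)])) +
     (C%:E + (D / n%:R `^ (s / 2))%:E * 'E_Q[(fun w => (`|Z w| `^ (s + 2))%R)])))%E.
Proof.
cbv zeta; set W := scaled_mean _; set T1 := delta_statistic _ _.
pose sn : R := Num.sqrt n%:R; pose u := sn^-1; pose c := f^`()%classic 0.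
have n0 : 0 < n%:R :> R by rewrite ltr0n.
have sn0 : 0 < sn by rewrite sqrtr_gt0.
have u0 : 0 < u by rewrite invr_gt0.
have c0 : 0 < `|c| by rewrite normr_gt0.
have uu : u * u = n%:R^-1 by rewrite -invfM -expr2 sqr_sqrtr// ltW.
have powu p : u `^ p = (n%:R `^ (p / 2))^-1.
  by rewrite /u /sn -powR12_sqrt ?ler0n// -powRN -powRrM -powRN; congr powR; ring.
have mX i : measurable_fun setT (X i) := measurable_funPT (X i).
have iXr i := integrable_of_moment (mX i) (X_moment i).
have iX i : P.-integrable setT (EFin \o X i).
  apply: (integrable_dominated measurableT (mX i) (integrable_norm_exp r_ge0 (mX i) (iXr i) (isT : (1 <= 4)%N))).
  by move=> w _; rewrite expr1.
have iX2 i := integrable_even_exp r_ge0 (mX i) (iXr i) (isT : ~~ odd 2) (isT : (2 <= 4)%N).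
have EX i : \int[P]_w X i w = 0.
  by have := X_mean i; rewrite expectation_EFin// => -[].
have EX2 i : \int[P]_w (X i w ^+ 2) = 1.
  by have := X_var i; rewrite (variance_centered (iX i) (iX2 i) (X_mean i)) => -[].
have WE : W = fun w => u * \sum_i X i w.
  apply/funext => w; rewrite /W /scaled_mean /sample_mean -uu /u -/sn.
  by field; rewrite gt_eqF.
have TE : T1 = rescale f u \o W.
  apply/funext => w; rewrite WE /T1 /delta_statistic /sample_mean /rescale/= mulrA uu /u invrK.
  by [].
have iW p : 0 <= p -> p <= r + 4 -> P.-integrable setT (EFin \o (fun w => `|W w| `^ p)).
  by rewrite WE => p0 pr; exact: (integrable_sum_powR n_gt0 r_ge0 iXr p0 pr).
have eZ p : 0 <= p -> 'E_Q[(fun w => (`|Z w| `^ p)%R)]%E = (gmean (apow p))%:E.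
  move=> p0; have m : measurable_fun setT (apow p : R -> R).
    by apply: continuous_measurable_fun; exact: apow_continuous.
  by rewrite -(Rintegral_normalZ Z_normal m (gint_apow p0)) -expectation_EFin//;
    exact: (integrable_normalZ Z_normal m (gint_apow p0)).
have r1_ge0 : 0 <= r + 1 by rewrite addr_ge0.
have s2_ge0 : 0 <= s + 2 by rewrite addr_ge0.
rewrite (eZ (s + 2))//.
pose x3 i := \int[P]_w (`|X i w| ^+ 3).
pose x4 i := \int[P]_w (X i w ^+ 4).
pose x4r i := \int[P]_w (`|X i w| `^ (r + 4)).
pose w1 := \int[P]_w (`|W w| `^ (r + 1)).
pose w0 := \int[P]_w (`|W w| `^ r).
pose mu1 : R := gmean (apow (r + 1)).
pose k i := 3 * A * x3 i + 2 `^ r * B / n%:R `^ (r / 2) *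
  (2 `^ (r + 1) * x4 i * (w1 + w0) + 4 * mu1 * x4 i + 2 `^ (r + 2) / n%:R `^ (r / 2) * x4r i).
pose tl := C + D / n%:R `^ (s / 2) * gmean (apow (s + 2)).
have -> : (\sum_(i < n)
         ((3 * A)%:E * 'E_P[(fun w => (`|X i w| ^+ 3)%R)] +
          (2 `^ r * B / n%:R `^ (r / 2))%:E *
          ((2 `^ (r + 1))%:E * 'E_P[(fun w => (X i w ^+ 4)%R)] *
             ('E_P[(fun w => (`|W w| `^ (r + 1))%R)] + 'E_P[(fun w => (`|W w| `^ r)%R)]) +
           4%:E * 'E_Q[(fun w => (`|Z w| `^ (r + 1))%R)] * 'E_P[(fun w => (X i w ^+ 4)%R)] +
           (2 `^ (r + 2) / n%:R `^ (r / 2))%:E *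
             'E_P[(fun w => (`|X i w| `^ (r + 4))%R)])))%E = (\sum_i k i)%:E.
  rewrite -sumEFin; apply: eq_bigr => i _.
  rewrite (expectation_EFin (integrable_norm_exp r_ge0 (mX i) (iXr i) (isT : (3 <= 4)%N))).
  rewrite (expectation_EFin (integrable_even_exp r_ge0 (mX i) (iXr i) (isT : ~~ odd 4) (isT : (4 <= 4)%N))).
  rewrite (expectation_EFin (iXr i)) (eZ (r + 1))//.
  by rewrite !(expectation_EFin (iW _ _ _))//; lra.
rewrite -!EFinM -!EFinD -/tl.
have x3_ge1 i : 1 <= x3 i := moment3_ge1 r_ge0 (mX i) (iXr i) (EX2 i).
have x4r_ge1 i : 1 <= x4r i := moment_rD4_ge1 r_ge0 (mX i) (iXr i) (EX2 i).
have x4_ge0 i : 0 <= x4 i.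
  by apply: Rintegral_ge0 => w _; rewrite exprn_even_ge0.
have w1_ge0 : 0 <= w1 by apply: Rintegral_ge0 => w _; exact: powR_ge0.
have w0_ge0 : 0 <= w0 by apply: Rintegral_ge0 => w _; exact: powR_ge0.
have mu1_ge0 : 0 <= mu1 := gmean_apow_ge0 _.
(* When [deriv_norm h] is infinite, the right side is [+oo] only if its cofactor is positive, as 0
   times [+oo] is 0. *)
have K_gt0 : 0 < n%:R^-1 * \sum_i k i + tl.
  have tl_ge0 : 0 <= tl.
    by rewrite addr_ge0// mulr_ge0 ?divr_ge0 ?powR_ge0// gmean_apow_ge0.
  rewrite ltr_wpDr// mulr_gt0 ?invr_gt0//.
  (* [A] and [B] cannot both vanish, since the derivative of [f] at 0 is nonzero. The third moment
     if [A] is nonzero, or else the moment of order [r + 4], then makes every summand positive. *)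
  have AB : 0 < A + B.
    rewrite lt0r addr_ge0// andbT; apply: contra_neq f'0_neq0 => AB0.
    have [A0' B0'] : A = 0 /\ B = 0 by split; lra.
    by have := f'_bound 0; rewrite A0' B0' mul0r addr0 normr_le0 => /eqP.
  have k_gt0 i : 0 < k i.
    have t0 : 0 < 2 `^ r :> R by exact: powR_gt0.
    have m0 : 0 < n%:R `^ (r / 2) :> R by exact: powR_gt0.
    have v0 : 0 < 2 `^ (r + 2) / n%:R `^ (r / 2) :> R by rewrite divr_gt0// powR_gt0.
    have y0 : 0 < 2 `^ (r + 1) * x4 i * (w1 + w0) + 4 * mu1 * x4 i + 2 `^ (r + 2) / n%:R `^ (r / 2) * x4r i.
      rewrite ltr_wpDl//; last by rewrite mulr_gt0// (lt_le_trans ltr01).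
      by rewrite addr_ge0 ?mulr_ge0 ?powR_ge0 ?addr_ge0.
    have z0 : 0 < x3 i by rewrite (lt_le_trans ltr01).
    move: AB; rewrite /k; have [A0' B0'|A0' _] := eqVneq A 0.
      rewrite A0' mulr0 mul0r add0r mulr_gt0// divr_gt0// mulr_gt0//; lra.
    rewrite ltr_wpDr//; first by rewrite mulr_ge0 ?(ltW y0)// divr_ge0 ?mulr_ge0 ?powR_ge0.
    by rewrite !mulr_gt0// lt0r A0' A_ge0.
  have i0 : 'I_n := Ordinal n_gt0.
  rewrite (bigD1 i0)//= ltr_wpDr// sumr_ge0// => i _; exact: ltW.
have v_gt0 : 0 < (`|f^`()%classic 0| * Num.sqrt n%:R)^-1 by rewrite invr_gt0 mulr_gt0.
have [hinf|[L L0 hfin]] : deriv_norm h = +oo%E \/ exists2 L : R, 0 <= L & deriv_norm h = L%:E.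
  have := deriv_norm_ge0 h; case: (deriv_norm h) => [L|_|//]; last by left.
  by rewrite lee_fin => L0; right; exists L.
  by rewrite hinf gt0_mulye ?lte_fin// gt0_mulye ?lte_fin// leey.
have hL x y : `|h x - h y| <= L * `|x - y|.
  by apply: ae_deriv_lipschitz; rewrite ?hfin.
have a0 : 0 <= A / `|c| by rewrite divr_ge0.
have b0 : 0 <= B * u `^ r / `|c| by rewrite divr_ge0// mulr_ge0// powR_ge0.
have [gH iH D1] := discrepancy_bound n_gt0 r_ge0 X_indep EX EX2 iXr L0 a0 b0 hL
  (rescale_is_derive f_derivable f'0_neq0 u0) (norm_rescale_deriv f'0_neq0 u0 f'_bound).
have D2 := gmean_rescale f_derivable f'_derivable f'0_neq0 C_ge0 D_ge0 s_ge0 u0 f''_bound hL L0 gH.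
have eT : 'E_P[(h \o T1)]%E = (\int[P]_w h (rescale f u (u * \sum_i X i w)))%:E.
  by rewrite TE WE; exact: expectation_EFin iH.
have ch := lipschitz_continuous hL.
have mh : measurable_fun setT h by exact: continuous_measurable_fun.
have gh := gint_lipschitz hL.
have eH : 'E_Q[(h \o Z)]%E = (gmean h)%:E.
  rewrite -(Rintegral_normalZ Z_normal mh gh).
  exact: expectation_EFin (integrable_normalZ Z_normal mh gh).
rewrite eT eH hfin -EFinB -!EFinM lee_fin.
(* As u = n^(-1/2), the cube of [u] is [u] times the factor 1/n of the average. *)
have -> : L / (`|c| * sn) * (n%:R^-1 * \sum_i k i + tl) =
    L * u ^+ 3 * (\sum_i k i / `|c|) + L * (u / `|c|) * tl.
  rewrite -mulr_suml -uu /u; set S := \sum_i _.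
  by field; rewrite !gt_eqF.
have w1E : w1 = \int[P]_w (`|u * \sum_i X i w| `^ (r + 1)) by rewrite /w1 WE.
have w0E : w0 = \int[P]_w (`|u * \sum_i X i w| `^ r) by rewrite /w0 WE.
apply: le_trans (ler_distD (gmean (h \o rescale f u)) _ _) _; apply: lerD.
  apply: le_trans D1 _; rewrite le_eqVlt; apply/orP; left; apply/eqP.
  congr (_ * _); apply: eq_bigr => i _.
  by rewrite -/sn -/u -w1E -w0E -/mu1 -/(x3 i) -/(x4 i) -/(x4r i) /k powu; ring.
by move: D2; rewrite powu.
Qed.
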